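(* Let $N=2$, let $\mu>0$ and $\lambda\in\mathbb{R}$ with $\lambda+\mu>0$, and let $\nu\in(-1,\tfrac12)$ be the associated Poisson coefficient, i.e. $\frac{\lambda+\mu}{\mu}=\frac{1}{1-2\nu}$. If $\nu<0.4$, then the disk is not a minimizer of $\Lambda$ among sets of given area; that is, for a disk $B\subset\mathbb{R}^2$ there exists a bounded open set $\Omega\subset\mathbb{R}^2$ with $|\Omega|=|B|$ and $\Lambda(\Omega)<\Lambda(B)$.
   Context: For a bounded open set $\Omega\subset\mathbb{R}^2$, $$\Lambda(\Omega)=\min_{u\in H^1_0(\Omega)^2\setminus\{0\}}\frac{\mu\int_\Omega|\nabla u|^2\,dx+(\lambda+\mu)\int_\Omega(\operatorname{div}u)^2\,dx}{\int_\Omega|u|^2\,dx}$$ is the first Dirichlet eigenvalue of the Lamé system, where $|\nabla u|^2=|\nabla u_1|^2+|\nabla u_2|^2$ and $|u|^2=u_1^2+u_2^2$. The Lamé parameters and the Poisson coefficient $\nu\in(-1,0.5)$ are related by $\lambda=\frac{E\nu}{(1+\nu)(1-2\nu)}$, $\mu=\frac{E}{2(1+\nu)}$, where $E>0$ is the Young modulus. *)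

(* Defs.v *)
From mathcomp Require Import all_boot all_order all_algebra.
From mathcomp Require Import all_classical all_reals all_analysis.

Set Implicit Arguments.
Unset Strict Implicit.
Unset Printing Implicit Defensive.

Import Order.TTheory GRing.Theory Num.Theory.
Import numFieldNormedType.Exports.

Local Open Scope classical_set_scope.
Local Open Scope ring_scope.

(* The plane is R * R. Its topology is the product one (the norm of the
   library on R * R is the sup norm, which has the same open sets and the same
   bounded sets as the Euclidean norm). *)

Notation lebesgue2 R := (@lebesgue_measure R \x @lebesgue_measure R)%E.

Definition disk (R : realType) (c : R * R) (r : R) : set (R * R) :=
  [set x | (x.1 - c.1) ^+ 2 + (x.2 - c.2) ^+ 2 < r ^+ 2].

Definition basis_vec (R : realType) (i : 'I_2) : R * R :=
  if i == ord0 then (1, 0) else (0, 1).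

Definition partial (R : realType) (i : 'I_2) (f : R * R -> R) : R * R -> R :=
  fun x => 'D_(basis_vec R i) f x.

Definition iter_partial (R : realType) (s : seq 'I_2) (f : R * R -> R) :
    R * R -> R :=
  foldr (@partial R) f s.

(* 'D_v is a total operator, so the existence of each partial derivative is
   required separately. *)
Definition smooth (R : realType) (f : R * R -> R) : Prop :=
  forall s : seq 'I_2,
    continuous (iter_partial s f) /\
    forall (i : 'I_2) (x : R * R), derivable (iter_partial s f) x (basis_vec R i).

Definition test_function (R : realType) (Omega : set (R * R))
    (f : R * R -> R) : Prop :=
  [/\ smooth f,
      compact (closure [set x | f x != 0]) &
      closure [set x | f x != 0] `<=` Omega].

(* Elements of L^2(Omega), H^1(Omega) and H^1_0(Omega) are represented by
   functions on the whole plane whose values outside Omega are irrelevant. *)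
Definition L2 (R : realType) (Omega : set (R * R)) (f : R * R -> R) : Prop :=
  measurable_fun Omega f /\
  (\int[lebesgue2 R]_(x in Omega) ((f x) ^+ 2)%:E < +oo)%E.

Definition L2_cvg (R : realType) (Omega : set (R * R))
    (f_ : nat -> R * R -> R) (f : R * R -> R) : Prop :=
  (fun n => \int[lebesgue2 R]_(x in Omega) ((f_ n x - f x) ^+ 2)%:E)%E
    @ \oo --> (0 : \bar R)%E.

Definition weak_partial (R : realType) (Omega : set (R * R)) (i : 'I_2)
    (u g : R * R -> R) : Prop :=
  forall phi : R * R -> R, test_function Omega phi ->
    \int[lebesgue2 R]_(x in Omega) (u x * partial i phi x) =
    - \int[lebesgue2 R]_(x in Omega) (g x * phi x).

(* u is in H^1(Omega) and Du is its weak gradient, which is determined by u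
   almost everywhere in Omega. *)
Definition H1 (R : realType) (Omega : set (R * R)) (u : R * R -> R)
    (Du : 'I_2 -> R * R -> R) : Prop :=
  L2 Omega u /\
  forall i : 'I_2, L2 Omega (Du i) /\ weak_partial Omega i u (Du i).

(* The closure of the test functions for the H^1(Omega) norm. *)
Definition H10 (R : realType) (Omega : set (R * R)) (u : R * R -> R)
    (Du : 'I_2 -> R * R -> R) : Prop :=
  H1 Omega u Du /\
  exists phi_ : nat -> R * R -> R,
    [/\ forall n, test_function Omega (phi_ n),
        L2_cvg Omega phi_ u &
        forall i : 'I_2, L2_cvg Omega (fun n => partial i (phi_ n)) (Du i)].

(* Du k i is the i-th weak partial derivative of the component u k. *)
Definition rayleigh (R : realType) (mu lambda : R) (Omega : set (R * R))
    (u : 'I_2 -> R * R -> R) (Du : 'I_2 -> 'I_2 -> R * R -> R) : R :=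
  (mu * \int[lebesgue2 R]_(x in Omega)
          (\sum_(k < 2) \sum_(i < 2) (Du k i x) ^+ 2)
   + (lambda + mu) * \int[lebesgue2 R]_(x in Omega)
          ((\sum_(k < 2) Du k k x) ^+ 2))
  / \int[lebesgue2 R]_(x in Omega) (\sum_(k < 2) (u k x) ^+ 2).

(* The infimum of the Rayleigh quotients over H^1_0(Omega)^2 minus 0; for a
   bounded nonempty open set it is attained, so it is the minimum. Nonzero
   means nonzero as a class of functions modulo null sets. *)
Definition Lame_eigenvalue (R : realType) (mu lambda : R)
    (Omega : set (R * R)) : \bar R :=
  ereal_inf [set q : \bar R |
    exists (u : 'I_2 -> R * R -> R) (Du : 'I_2 -> 'I_2 -> R * R -> R),
      [/\ forall k : 'I_2, H10 Omega (u k) (Du k),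
          ~ {ae lebesgue2 R, forall x, Omega x -> forall k : 'I_2, u k x = 0} &
          q = (rayleigh mu lambda Omega u Du)%:E]].

(* Main.v *)
(* Let a = (lambda + mu) / mu and s = sqrt (1 + a), so that 4/3 < s^2 < 6.
   The competitor is the ellipse with semi-axes r sqrt s and r / sqrt s. For a
   field u = (psi, 0) the affine map onto the unit disk turns the quotient into
   mu s / r^2 times a scalar Dirichlet quotient; a smoothing of the profile
   f0 = rho + rho^2/2, rho = 1 - |x|^2, brings it close to 110/19 < 29/5.

   On the disk every quotient is at least (29/5) mu s / r^2. Split both
   components by parity in each variable. A scalar function that is odd in one
   variable has Dirichlet quotient at least 356/25 > (29/5) s, by Picone's
   inequality on slices with a truncated Bessel series. What remains are pairs
   of an even-even v and an odd-odd w, coupled through the divergence. One has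
   |grad w|^2 >= (98/5) |w|^2 and, up to a rank-one correction in a mean of v,
   |grad v|^2 >= (441/20) |v|^2. Subtracting from v the multiple c f0 with the
   same mean, and from the divergence the multiple 2 c / (1 + s) of the
   x-derivative of f0, leaves c^2 times an explicit expression, whose sign is
   that of a quartic in s, positive on [23/20, 49/20]. *)

Require Import Defs.
From HB Require Import structures.
From mathcomp Require Import all_boot all_order all_algebra.
From mathcomp Require Import all_classical all_reals all_analysis.
From mathcomp Require Import measurable_realfun ring lra.

Set Implicit Arguments.
Unset Strict Implicit.
Unset Printing Implicit Defensive.

Import Order.TTheory GRing.Theory Num.Theory.
Import numFieldNormedType.Exports.

Local Open Scope classical_set_scope.
Local Open Scope ring_scope.

(** * Change of variables for the plane Lebesgue measure *)

(** For a field (psi, 0) the quotient weighs psi_x^2 by mu s^2 and psi_y^2 by mu; the semi-axes of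
    the ellipse make both weights equal to mu s / r^2. On the disk a radial psi gives the weight (1
    + s^2) / 2 in place of s, so the relative gain is at most (s - 1)^2 / (2 s), about one percent
    at s = 23/20. The lower bound on the disk must therefore be nearly sharp: 29/5 lies just above
    5.783..., the first Dirichlet eigenvalue of the unit disk, and the ground state has to be
    replaced by an explicit profile of almost the same quotient.

    At the other end s^2 < 6 keeps (29/5) s below 14.68..., the square of the first zero of J_1, and
    this fixes the precision asked of the Bessel truncation.

    Since H10 is a closure of test functions, the lower bound has only to be proved for C^1
    functions that vanish with their gradient outside the disk, where one-variable slices and
    explicit comparison functions suffice. The gradient of f0 does not vanish on the circle, so f0
    itself is outside this class; the smoothings [trial n] replace it, both in the lower bound and
    as trial field. *)

Lemma open_measurable_prod (R : realType) (A : set (R * R)) :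
  open A -> measurable (A : set (measurableTypeR R * measurableTypeR R)).
Proof.
move=> oA.
pose box (p q e : rat) : set (R * R) :=
  `](ratr p - ratr e), (ratr p + ratr e)[ `*` `](ratr q - ratr e), (ratr q + ratr e)[.
(* The product sigma-algebra is generated by rectangles; the rational boxes contained in [A] exhibit
   an open set as a countable union of them. *)
have -> : A = \bigcup_p \bigcup_q \bigcup_e
   (if `[< box p q e `<=` A >] then box p q e else set0).
  apply/seteqP; split => [[x y] Axy|[x y] [p _ [q _ [e _]]]]; last first.
    by case: ifPn => // /asboolP; exact.
  have [e /= e0 He] := (nbhs_ballP _ _).1 (oA _ Axy).
  have [d] := @rat_in_itvoo R 0 (e / 2) (divr_gt0 e0 (ltr0Sn R 1)).
  rewrite in_itv /= => /andP[d0 de].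
  have xd (z : R) : z - ratr d < z + ratr d by lra.
  have [p] := rat_in_itvoo (xd x).
  have [q] := rat_in_itvoo (xd y).
  rewrite !in_itv /= => /andP[q1 q2] /andP[p1 p2].
  exists p => //; exists q => //; exists d => //.
  case: ifPn => [_|/asboolP []].
    by split => /=; rewrite in_itv /=; apply/andP; split; lra.
  move=> [x' y'] [] /=; rewrite !in_itv /= => /andP[a1 a2] /andP[b1 b2].
  apply: He; split; rewrite /ball /= ltr_norml; apply/andP; split; lra.
apply: bigcupT_measurable_rat => p; apply: bigcupT_measurable_rat => q.
apply: bigcupT_measurable_rat => e; case: ifPn => // _.
by apply: measurableX.
Qed.

Lemma continuous_measurable_prod (R : realType) (D : set (R * R)) (f : R * R -> R) :
  measurable (D : set (measurableTypeR R * measurableTypeR R)) ->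
  continuous f ->
  measurable_fun (D : set (measurableTypeR R * measurableTypeR R)) f.
Proof.
move=> mD /continuousP cf; apply: (measurability _ (measurable_realfun.RGenOpens.measurableE R)).
move=> _ [_ [a [b ->] <-]]; apply: measurableI => //.
by apply: open_measurable_prod; exact/cf/interval_open.
Qed.

Definition image_measure d d' (T1 : measurableType d) (T2 : measurableType d')
    (R : realFieldType) (m : {measure set T1 -> \bar R}) (f : T1 -> T2)
    (mf : measurable_fun [set: T1] f) : {measure set T2 -> \bar R} :=
  measure_function_pushforward__canonical__measure_function_Measure m mf.

Section affine.
Context {R : realType}.
Notation mu := (@lebesgue_measure R).

(** The scaled pushforward of Lebesgue measure is identified by its values on half-open intervals.
    For [a < 0] the preimage of such an interval is half-open on the other side, hence the two
    computations. *)
Lemma lebesgue_measure_affine (c a : R) (A : set R) : a != 0 -> measurable A ->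
  (`|a|%:E * mu ((fun x => (c + a * x)%R) @^-1` A) = mu A)%E.
Proof.
move=> a0 mA.
have mf : measurable_fun [set: measurableTypeR R] (fun x => c + a * x : measurableTypeR R).
  by apply: continuous_measurable_fun => x; apply: cvgD; [exact: cvg_cst|apply: cvgM;
    [exact: cvg_cst|exact: cvg_id]].
have na0 : 0 <= `|a| by [].
pose m := mscale (NngNum na0) (image_measure mu mf).
rewrite -[LHS]/(m A); apply/esym; apply: (@lebesgue_measure_unique R m) => //.
move=> _ /= [[x y] /= xy <-].
rewrite /m /mscale /= /pushforward.
have [a_gt0|a_lt0] := ltP 0 a.
  have -> : (fun u : R => c + a * u) @^-1` `]x, y] = [set` `]((x - c) / a), ((y - c) / a)]].
    apply/seteqP; split => u /=; rewrite !in_itv /= ltr_pdivrMr // ler_pdivlMr //.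
      by move=> /andP[? ?]; apply/andP; split; lra.
    by move=> /andP[? ?]; apply/andP; split; lra.
  rewrite !lebesgue_measure_itv /= !lte_fin ltr_pM2r ?invr_gt0 // ltrD2r.
  case: ifP => _; last by rewrite mule0.
  rewrite -!EFinD -EFinM gtr0_norm //; congr (_ %:E).
  by field.
have {}a_lt0 : a < 0 by rewrite lt_neqAle a0.
have -> : (fun u : R => c + a * u) @^-1` `]x, y] = [set` `[((y - c) / a), ((x - c) / a)[].
  apply/seteqP; split => u /=; rewrite !in_itv /= ltr_ndivlMr // ler_ndivrMr //.
    by move=> /andP[? ?]; apply/andP; split; lra.
  by move=> /andP[? ?]; apply/andP; split; lra.
rewrite !lebesgue_measure_itv /= !lte_fin ltr_nM2r ?invr_lt0 // ltrD2r.
case: ifP => _; last by rewrite mule0.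
rewrite -!EFinD -EFinM ltr0_norm //; congr (_ %:E).
by field.
Qed.

Definition aff (c : R * R) (a b : R) (z : R * R) : R * R :=
  (c.1 + a * z.1, c.2 + b * z.2).

Notation mT := (measurableTypeR R * measurableTypeR R)%type.

Lemma measurable_aff c a b : measurable_fun [set: mT] (aff c a b : mT -> mT).
Proof.
apply/measurable_fun_pairP; split => /=.
  by apply: measurable_funD => //; apply: measurable_funM.
by apply: measurable_funD => //; apply: measurable_funM.
Qed.

Lemma lebesgue2_aff c a b (A : set (R * R)) : a != 0 -> b != 0 ->
  measurable (A : set mT) ->
  ((lebesgue2 R) A = (`|a| * `|b|)%:E * (lebesgue2 R) (aff c a b @^-1` A))%E.
Proof.
move=> a0 b0 mA.
have nab : 0 <= `|a| * `|b| by rewrite mulr_ge0.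
have mf := measurable_aff c a b.
pose m := mscale (NngNum nab) (image_measure (lebesgue2 R) mf).
rewrite -[RHS]/(m A); apply: product_measure_unique => // X Y mX mY.
transitivity ((`|a| * `|b|)%:E * (lebesgue2 R) (aff c a b @^-1` (X `*` Y)))%E; first by [].
have -> : aff c a b @^-1` (X `*` Y) =
  ((fun x => c.1 + a * x) @^-1` X) `*` ((fun x => c.2 + b * x) @^-1` Y).
  by [].
have mg (d e : R) (Z : set R) : measurable Z -> measurable ((fun x : R => d + e * x) @^-1` Z).
  move=> mZ; rewrite -[_ @^-1` _]setTI; apply: continuous_measurable_fun => // x; apply: cvgD;
    [exact: cvg_cst|apply: cvgM; [exact: cvg_cst|exact: cvg_id]].
rewrite product_measure1E; [|exact: mg..].
transitivity ((`|a|%:E * mu ((fun x => (c.1 + a * x)%R) @^-1` X)) *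
              (`|b|%:E * mu ((fun x => (c.2 + b * x)%R) @^-1` Y)))%E.
  by rewrite EFinM muleACA.
by congr (_ * _)%E; exact: lebesgue_measure_affine.
Qed.

Lemma lebesgue2_swap (A : set (R * R)) :
  measurable (A : set mT) ->
  ((lebesgue2 R) A = (lebesgue2 R) (@unstable.swap R R @^-1` A))%E.
Proof.
move=> mA.
have mf : measurable_fun [set: mT] (@unstable.swap R R : mT -> mT) by exact: measurable_swap.
rewrite -[RHS]/(image_measure (lebesgue2 R) mf A); apply: product_measure_unique => // X Y mX mY.
transitivity ((lebesgue2 R) (Y `*` X)); last by rewrite product_measure1E// muleC.
by congr (lebesgue2 R _); apply/seteqP; split => -[u v] [].
Qed.

End affine.

(** * Calculus rules and Picone's inequality *)

Section derive_rules.
Context {R : realType} {V : normedModType R}.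
Implicit Types (f g : V -> R) (x v : V) (a b : R).

Lemma dD f g x v a b : is_derive x v f a -> is_derive x v g b ->
  is_derive x v (fun t => f t + g t) (a + b).
Proof. exact: is_deriveD. Qed.

Lemma dN f x v a : is_derive x v f a -> is_derive x v (fun t => - f t) (- a).
Proof. exact: is_deriveN. Qed.

Lemma dB f g x v a b : is_derive x v f a -> is_derive x v g b ->
  is_derive x v (fun t => f t - g t) (a - b).
Proof. exact: is_deriveB. Qed.

Lemma dM f g x v a b : is_derive x v f a -> is_derive x v g b ->
  is_derive x v (fun t => f t * g t) (a * g x + f x * b).
Proof.
move=> fa gb; have := @is_deriveM _ _ f g x v a b fa gb.
by rewrite /GRing.scale /= addrC (mulrC (g x)).
Qed.

Lemma dC x v a : is_derive x v (fun=> a) 0.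
Proof. exact: is_derive_cst. Qed.

Lemma d_eq f x v a b : is_derive x v f a -> a = b -> is_derive x v f b.
Proof. by move=> + <-. Qed.

Lemma dX f n x v a : is_derive x v f a ->
  is_derive x v (fun t => f t ^+ n) (n%:R * f x ^+ n.-1 * a).
Proof.
move=> fa; elim: n => [|n IH].
  by rewrite !mul0r; exact: dC.
apply: d_eq; first by (under eq_fun do rewrite exprS); apply: (dM fa IH).
by case: n {IH} => [|n] /=; rewrite ?expr0 -?natr1 ?exprS /=; ring.
Qed.

Lemma dV f x v a : f x != 0 -> is_derive x v f a ->
  is_derive x v (fun t => (f t)^-1) (- a / f x ^+ 2).
Proof.
move=> fx0 [df <-]; split; first exact: derivableV.
by rewrite deriveV// /GRing.scale /= mulrC mulrN mulNr.
Qed.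

(** Only directional derivatives are assumed, so the composition is restricted to the line through
    [x] along [v], where the one-variable chain rule applies. *)
Lemma d_comp (h : R -> R) f x v a b : is_derive (f x) 1 h b -> is_derive x v f a ->
  is_derive x v (fun t => h (f t)) (b * a).
Proof.
move=> hb fa.
have [df dfa] := fa.
have hb' : is_derive (f (0 *: v + x)) 1 h b by rewrite scale0r add0r.
have fa' : is_derive (0 : R) 1 (fun s : R => f (s *: v + x)) a.
  split; first exact: (derivable1P f x v).1.
  rewrite -dfa /derive; f_equal; f_equal; apply/funext => s /=.
  by rewrite scale0r !add0r addr0 [s *: (1 : R)]mulr1.
have [d1 d2] := @is_derive1_comp R h (fun s : R => f (s *: v + x)) 0 b a hb' fa'.
split; first exact: (derivable1P (fun t => h (f t)) x v).2.
rewrite -d2 /derive; f_equal; f_equal; apply/funext => s /=.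
by rewrite scale0r !add0r addr0 [s *: (1 : R)]mulr1.
Qed.

End derive_rules.

Lemma dfst (R : realType) (z v : R * R) : is_derive z v (fun z => z.1) v.1.
Proof.
have E : (fun h : R => h^-1 *: ((h *: v + z).1 - z.1)) @ 0^' --> v.1.
  apply: cvg_near_cst; near=> h.
  have h0 : h != 0 by near: h; exact: nbhs_dnbhs_neq.
  by rewrite /= addrK /GRing.scale /= mulKf.
by split; [apply/cvg_ex; exists v.1|exact/cvg_lim].
Unshelve. all: end_near. Qed.

Lemma dsnd (R : realType) (z v : R * R) : is_derive z v (fun z => z.2) v.2.
Proof.
have E : (fun h : R => h^-1 *: ((h *: v + z).2 - z.2)) @ 0^' --> v.2.
  apply: cvg_near_cst; near=> h.
  have h0 : h != 0 by near: h; exact: nbhs_dnbhs_neq.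
  by rewrite /= addrK /GRing.scale /= mulKf.
by split; [apply/cvg_ex; exists v.2|exact/cvg_lim].
Unshelve. all: end_near. Qed.

(** The rules above are stated for pointwise expressions so that a derivative can be assembled from
    the syntax of the function; [derive_eq] then leaves one algebraic identity. *)
Ltac der :=
  lazymatch goal with
  | |- is_derive _ _ (fun t => @GRing.add _ (@?f t) (@GRing.opp _ (@?g t))) _ => eapply dB; der
  | |- is_derive _ _ (fun t => @GRing.add _ (@?f t) (@?g t)) _ => eapply dD; der
  | |- is_derive _ _ (fun t => @GRing.opp _ (@?f t)) _ => eapply dN; der
  | |- is_derive _ _ (fun t => @GRing.mul _ (@?f t) (@?g t)) _ => eapply dM; der
  | |- is_derive _ _ (fun t => @GRing.exp _ (@?f t) ?n) _ => eapply dX; der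
  | |- is_derive _ _ (@GRing.mul _ ?c) _ => eapply (@dM _ _ (fun=> c) (fun t => t)); der
  | |- is_derive _ _ (@GRing.add _ ?c) _ => eapply (@dD _ _ (fun=> c) (fun t => t)); der
  | |- _ => first [exact: dC | exact: is_derive_id | exact: dfst | exact: dsnd |
                   match goal with H : _ |- _ => solve [eapply H; eauto] end | idtac]
  end.

Ltac derive_eq := eapply d_eq; [der .. | idtac].

Section continuity_rules.
Context {R : realType} {T : topologicalType}.
Implicit Types f g : T -> R.

Lemma cD f g : continuous f -> continuous g -> continuous (fun t => f t + g t).
Proof. by move=> cf cg t; apply: cvgD; [exact: cf|exact: cg]. Qed.

Lemma cN f : continuous f -> continuous (fun t => - f t).
Proof. by move=> cf t; apply: cvgN; exact: cf. Qed.

Lemma cM f g : continuous f -> continuous g -> continuous (fun t => f t * g t).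
Proof. by move=> cf cg t; apply: cvgM; [exact: cf|exact: cg]. Qed.

Lemma cC (k : R) : continuous (fun _ : T => k).
Proof. by move=> t; exact: cvg_cst. Qed.

Lemma cX f n : continuous f -> continuous (fun t => f t ^+ n).
Proof.
move=> cf; elim: n => [|n IH]; first exact: cC.
by under eq_fun do rewrite exprS; exact: cM.
Qed.

End continuity_rules.

Lemma cfst (R : realType) : continuous (fun z : R * R => z.1).
Proof. by move=> z; exact: cvg_fst. Qed.

Lemma csnd (R : realType) : continuous (fun z : R * R => z.2).
Proof. by move=> z; exact: cvg_snd. Qed.

Lemma cid (R : realType) : continuous (fun t : R => t).
Proof. by move=> t; exact: cvg_id. Qed.

Lemma cV (R : realType) (T : topologicalType) (f : T -> R) : continuous f ->
  (forall t, f t != 0) -> continuous (fun t => (f t)^-1).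
Proof. by move=> cf f0 t; apply: cvgV; [exact: f0|exact: cf]. Qed.

Lemma cabs (R : realType) (T : topologicalType) (f : T -> R) : continuous f ->
  continuous (fun t => `|f t|).
Proof. by move=> cf t; apply: cvg_norm; exact: cf. Qed.

Lemma wcV (R : realType) (A : set R) (f : R -> R) : {within A, continuous f} ->
  (forall t, A t -> f t != 0) -> {within A, continuous (fun t => (f t)^-1)}.
Proof.
move=> /subspace_continuousP cf f0; apply/subspace_continuousP => t At.
by apply: cvgV; [exact: f0|exact: cf].
Qed.

Ltac cont :=
  lazymatch goal with
  | |- forall x, continuous_at x (from_subspace _ _) =>
      rewrite /from_subspace; cont
  | |- forall x, continuous_at x (fun t => @GRing.add _ (@?f t) (@?g t)) =>
      apply: cD; cont
  | |- forall x, continuous_at x (fun t => @GRing.mul _ (@?f t) (@?g t)) =>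
      apply: cM; cont
  | |- forall x, continuous_at x (fun t => @GRing.opp _ (@?f t)) =>
      apply: cN; cont
  | |- forall x, continuous_at x (@GRing.mul _ ?c) =>
      apply: (@cM _ _ (fun=> c) (fun t => t)); cont
  | |- forall x, continuous_at x (@GRing.add _ ?c) =>
      apply: (@cD _ _ (fun=> c) (fun t => t)); cont
  | |- forall x, continuous_at x (fun t => @GRing.exp _ (@?f t) ?n) =>
      apply: cX; cont
  | |- _ => first [assumption | exact: cC | exact: cid | exact: cfst | exact: csnd | idtac]
  end.

Section one_dimensional_integral.
Context {R : realType}.
Notation mu := (@lebesgue_measure R).
Implicit Types (f g : R -> R) (a b c k t : R).

Definition J a b f : R := \int[mu]_(t in `[a, b]) f t.

Lemma J_integrable a b f : {within `[a, b], continuous f} ->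
  mu.-integrable `[a, b] (EFin \o f).
Proof. by apply: continuous_compact_integrable; exact: segment_compact. Qed.

Lemma JD a b f g : {within `[a, b], continuous f} -> {within `[a, b], continuous g} ->
  J a b (fun t => f t + g t) = J a b f + J a b g.
Proof. by move=> cf cg; apply: RintegralD => //; exact: J_integrable. Qed.

Lemma JB a b f g : {within `[a, b], continuous f} -> {within `[a, b], continuous g} ->
  J a b (fun t => f t - g t) = J a b f - J a b g.
Proof. by move=> cf cg; apply: RintegralB => //; exact: J_integrable. Qed.

Lemma JZ a b k f : {within `[a, b], continuous f} ->
  J a b (fun t => k * f t) = k * J a b f.
Proof. by move=> cf; apply: RintegralZl => //; exact: J_integrable. Qed.

Lemma eq_J a b f g : (forall t, a <= t <= b -> f t = g t) -> J a b f = J a b g.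
Proof. by move=> fg; apply: eq_Rintegral => t; rewrite inE /= in_itv /=; exact: fg. Qed.

Lemma J_le a b f g : {within `[a, b], continuous f} -> {within `[a, b], continuous g} ->
  (forall t, a <= t <= b -> f t <= g t) -> J a b f <= J a b g.
Proof.
by move=> cf cg fg; apply: le_Rintegral => //; try exact: J_integrable.
Qed.

Lemma J_ge0 a b f : (forall t, a <= t <= b -> 0 <= f t) -> 0 <= J a b f.
Proof. by move=> f0; apply: Rintegral_ge0 => t /=; rewrite in_itv /=; exact: f0. Qed.

Lemma J_cst a b k : a <= b -> J a b (fun=> k) = k * (b - a).
Proof.
move=> ab; rewrite /J Rintegral_cst//.
congr (_ * _); rewrite (_ : (b - a) = fine (b - a)%:E)//; congr fine.
have := @lebesgue_measure_itv R `[a, b]; rewrite /= lte_fin => ->.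
by case: ltgtP ab => // -> _; rewrite subrr.
Qed.

Lemma J_split a c b f : a <= c -> c <= b -> {within `[a, b], continuous f} ->
  J a b f = J a c f + J c b f.
Proof.
move=> ac cb cf; rewrite /J.
have i : mu.-integrable `[a, b] (EFin \o f) by exact: J_integrable.
rewrite -(@Rintegral_itv_obnd_cbnd _ c (BRight b) f).
  by rewrite -(@Rintegral_itvB _ f (BLeft a) (BRight b) c) ?bnd_simp // addrC subrK.
by apply: integrableS i => //; apply: subset_itv; rewrite bnd_simp.
Qed.

Lemma J_FTC a b f g : a <= b ->
  (forall t, a <= t <= b -> is_derive t 1 f (g t)) ->
  {within `[a, b], continuous g} -> J a b g = f b - f a.
Proof.
rewrite le_eqVlt => /predU1P[->|ab] df cg.
  by rewrite subrr /J set_itv1 Rintegral_set1.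
have cf t : a <= t <= b -> {for t, continuous f}.
  move=> /df dft; apply: differentiable_continuous; apply/derivable1_diffP.
  by case: dft.
rewrite /J /Rintegral (@continuous_FTC2 _ g f)//.
  split.
  - by move=> t; rewrite in_itv /= => /andP[/ltW ? /ltW ?]; case: (df t) => //; apply/andP.
  - by apply: cvg_at_right_filter; apply: cf; rewrite lexx ltW.
  - by apply: cvg_at_left_filter; apply: cf; rewrite lexx ltW.
move=> t; rewrite in_itv /= => /andP[? ?].
by have [|_ <-] := df t; [apply/andP; split; exact: ltW|rewrite derive1E].
Qed.

(* The quotient g/phi absorbs the weight: g'^2 + g^2 phi''/phi is the square of g' - g phi'/phi
  plus an exact derivative. *)
Lemma picone a b (g g' phi phi' phi'' w : R -> R) : a <= b ->
  (forall t, a <= t <= b -> is_derive t 1 g (g' t)) ->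
  (forall t, a <= t <= b -> is_derive t 1 phi (phi' t)) ->
  (forall t, a <= t <= b -> is_derive t 1 phi' (phi'' t)) ->
  {within `[a, b], continuous g'} -> {within `[a, b], continuous phi''} ->
  {within `[a, b], continuous w} ->
  (forall t, a <= t <= b -> 0 < phi t) ->
  (forall t, a <= t <= b -> phi'' t <= - w t * phi t) ->
  g a ^+ 2 * phi' a <= 0 -> 0 <= g b ^+ 2 * phi' b ->
  J a b (fun t => w t * g t ^+ 2) <= J a b (fun t => g' t ^+ 2).
Proof.
move=> ab dg dphi dphi' cg' cphi'' cw phi0 sup ga gb.
have wc f f' : (forall t, a <= t <= b -> is_derive t 1 f (f' t)) ->
    {within `[a, b], continuous f}.
  move=> df; apply: derivable_within_continuous => t; rewrite in_itv /=.
  by move/df => [].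
have cg := wc _ _ dg; have cphi := wc _ _ dphi; have cphi' := wc _ _ dphi'.
pose F t := g t ^+ 2 * phi' t / phi t.
pose F' t := 2 * g t * g' t * phi' t / phi t + g t ^+ 2 * (phi'' t * phi t - phi' t ^+ 2) / phi t ^+ 2.
have dF t : a <= t <= b -> is_derive t 1 F (F' t).
  move=> abt; have p0 := phi0 _ abt.
  have pn0 : phi t != 0 by rewrite gt_eqF.
  apply: d_eq; first by apply: dM; [apply: dM; [apply: dX; exact: dg|exact: dphi']|apply: dV => //;
    exact: dphi].
  by rewrite /F' /=; field.
have cF' : {within `[a, b], continuous F'}.
  have ci (k : nat) : {within `[a, b], continuous (fun t => (phi t ^+ k)^-1)}.
    apply: wcV; first exact: cX.
    by move=> t; rewrite /= in_itv /= => /phi0 p0; rewrite expf_neq0// gt_eqF.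
  rewrite /F'; cont; first exact: (ci 1%N).
  exact: (ci 2%N).
(* The two sign conditions give [F a <= 0 <= F b]; an end is harmless if [g] vanishes there or if
   [phi'] vanishes or has the right sign. *)
have Fab : 0 <= J a b F'.
  rewrite (J_FTC ab dF cF') /F subr_ge0 (@le_trans _ _ 0)//.
    by rewrite ler_pdivrMr ?mul0r// phi0 ?lexx.
  by rewrite divr_ge0// ltW// phi0 ?lexx ?ab.
rewrite -subr_ge0 -JB; [|cont..].
apply: (le_trans Fab); apply: J_le => // [|t abt]; first cont.
have p0 := phi0 _ abt; have := sup _ abt => spt.
have pn0 : phi t != 0 by rewrite gt_eqF.
rewrite -subr_ge0.
have -> : g' t ^+ 2 - w t * g t ^+ 2 - F' t = (g' t - g t * phi' t / phi t) ^+ 2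
   + g t ^+ 2 * ((- w t * phi t - phi'' t) / phi t).
  by rewrite /F'; field.
by rewrite addr_ge0 ?sqr_ge0// mulr_ge0 ?sqr_ge0// divr_ge0 ?subr_ge0// ltW.
Qed.

End one_dimensional_integral.

(** * Integration over the unit disk *)

Lemma continuous_bounded_integrable (R : realType) (D : set (R * R)) (F : R * R -> R) :
  measurable (D : set (measurableTypeR R * measurableTypeR R)) -> continuous F ->
  (exists M, D `<=` `[-M, M] `*` `[-M, M]) ->
  (lebesgue2 R).-integrable D (EFin \o F).
Proof.
move=> mD cF [M DM].
have mBox : measurable (`[-M, M] `*` `[-M, M] : set (measurableTypeR R * measurableTypeR R)).
  by apply: measurableX; exact: measurable_itv.
have cBox : compact (`[-M, M] `*` `[-M, M] : set (R * R)).
  by apply: compact_setX; exact: segment_compact.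
apply: (integrableS mBox mD DM).
apply: measurable_bounded_integrable => //.
- pose Q : set R := [set` `[-M, M]].
  have E : (lebesgue2 R) (Q `*` Q) = (@lebesgue_measure R Q * @lebesgue_measure R Q)%E.
    by apply: product_measure1E; exact: measurable_itv.
  apply: (eq_ind_r (fun x => (x < +oo)%E) _ E); rewrite /Q.
  have := @lebesgue_measure_itv R `[-M, M]; rewrite /= => ->.
  by case: ifP => _; rewrite ?mul0e ?mule0 -?EFinD -?EFinM ltry.
- exact: continuous_measurable_prod.
- have /compact_bounded[N [_ hN]] := continuous_compact (@continuous_subspaceT _ _ _ _ cF) cBox.
  by exists N; split; rewrite ?num_real// => x Nx z Bz /=; apply: (hN _ Nx); exists z.
Qed.

Section disk_integral.
Context {R : realType}.
Notation mu := (@lebesgue_measure R).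
Notation mT := (measurableTypeR R * measurableTypeR R)%type.
Implicit Types (F G : R * R -> R) (k : R).

Definition udisk : set (R * R) := [set z | z.1 ^+ 2 + z.2 ^+ 2 < 1].

Lemma open_udisk : open udisk.
Proof.
rewrite (_ : udisk = (fun z : R * R => z.1 ^+ 2 + z.2 ^+ 2) @^-1` `]-oo, 1[).
  apply: open_comp; last exact: interval_open.
  by move=> z _; move: z; cont.
by apply/seteqP; split => z /=; rewrite in_itv.
Qed.

Lemma measurable_udisk : measurable (udisk : set mT).
Proof. exact: open_measurable_prod open_udisk. Qed.

Lemma udisk_box : udisk `<=` `[-1, 1] `*` `[-1, 1].
Proof.
move=> [x y]; rewrite /udisk /= => xy; split => /=; rewrite in_itv /=; apply/andP; split; nra.
Qed.

Definition I F : R := \int[lebesgue2 R]_(z in udisk) F z.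

Lemma I_integrable F : continuous F -> (lebesgue2 R).-integrable udisk (EFin \o F).
Proof.
move=> cF; apply: continuous_bounded_integrable => //; first exact: measurable_udisk.
by exists 1; exact: udisk_box.
Qed.

Lemma ID F G : continuous F -> continuous G ->
  I (fun z => F z + G z) = I F + I G.
Proof. by move=> cF cG; apply: RintegralD; [exact: measurable_udisk|exact: I_integrable..]. Qed.

Lemma IB F G : continuous F -> continuous G ->
  I (fun z => F z - G z) = I F - I G.
Proof. by move=> cF cG; apply: RintegralB; [exact: measurable_udisk|exact: I_integrable..]. Qed.

Lemma IZ k F : continuous F -> I (fun z => k * F z) = k * I F.
Proof. by move=> cF; apply: RintegralZl; [exact: measurable_udisk|exact: I_integrable]. Qed.

Lemma eq_I F G : (forall z, udisk z -> F z = G z) -> I F = I G.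
Proof. by move=> FG; apply: eq_Rintegral => z; rewrite inE; exact: FG. Qed.

Lemma I_le F G : continuous F -> continuous G ->
  (forall z, udisk z -> F z <= G z) -> I F <= I G.
Proof. by move=> cF cG FG; apply: le_Rintegral; [exact: measurable_udisk|exact: I_integrable..|]. Qed.

Lemma I_ge0 F : (forall z, udisk z -> 0 <= F z) -> 0 <= I F.
Proof. by move=> F0; exact: Rintegral_ge0. Qed.

Definition halfchord (x : R) : R := Num.sqrt (1 - x ^+ 2).

Lemma cslice2 F x : continuous F -> continuous (fun y : R => F (x, y)).
Proof.
move=> cF y; apply: (@continuous_comp _ _ _ (fun y : R => (x, y)) F); last exact: cF.
by apply: (@cvg_pair _ _ _ _ (nbhs x) (nbhs y) _ _ _ (cst x) id); [exact: cvg_cst|exact: cvg_id].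
Qed.

Lemma cslice1 F y : continuous F -> continuous (fun x : R => F (x, y)).
Proof.
move=> cF x; apply: (@continuous_comp _ _ _ (fun x : R => (x, y)) F); last exact: cF.
by apply: (@cvg_pair _ _ _ _ (nbhs x) (nbhs y) _ _ _ id (cst y)); [exact: cvg_id|exact: cvg_cst].
Qed.

Lemma halfchordP x y : x ^+ 2 < 1 -> (x ^+ 2 + y ^+ 2 < 1) = (- halfchord x < y < halfchord x).
Proof.
move=> x1; rewrite -ltr_norml -[RHS]ltr_sqr ?nnegrE ?sqrtr_ge0//.
by rewrite sqr_sqrtr ?subr_ge0 ?ltW// real_normK ?num_real// ltrBrDl.
Qed.

Lemma J0 a b (f : R -> R) : (forall t, a <= t <= b -> f t = 0) -> J a b f = 0.
Proof.
by move=> f0; rewrite /J /Rintegral integral0_eq// => t; rewrite /= in_itv /= => /f0 ->.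
Qed.

Lemma I_slices_cut F x : continuous F ->
  (\int[mu]_y ((F \_ udisk) (x, y))%:E)%E = (J (- halfchord x) (halfchord x) (fun y => F (x, y)))%:E.
Proof.
move=> cF; have cFx : continuous (fun y : R => F (x, y)) by exact: cslice2.
have [x1|x1] := ltP (x ^+ 2) 1.
  set h := halfchord x.
  have i2 : mu.-integrable `[-h, h] (EFin \o (fun y => F (x, y))).
    exact/J_integrable/continuous_subspaceT.
  have i1 : mu.-integrable `]-h, h] (EFin \o (fun y => F (x, y))).
    by apply: integrableS i2 => //; apply: subset_itv; rewrite bnd_simp.
  have i0 : mu.-integrable `]-h, h[ (EFin \o (fun y => F (x, y))).
    by apply: integrableS i1 => //; apply: subset_itv; rewrite bnd_simp.
  rewrite /J -Rintegral_itv_obnd_cbnd// -Rintegral_itv_bndo_bndc// fineK; last exact: integrable_fin_num.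
  rewrite [RHS]integral_mkcond; apply: eq_integral => y _.
  rewrite restrict_EFin /= !patchE; congr (if _ then _ else _)%:E.
  by apply/idP/idP; rewrite !inE /udisk /= in_itv /= halfchordP.
(* For [1 <= x ^+ 2] the square root of a nonpositive number is 0 by convention, so the chord is a
   single point and both sides vanish. *)
rewrite /halfchord ler0_sqrtr ?subr_le0// oppr0 /J set_itv1 Rintegral_set1.
apply: integral0_eq => y _; rewrite patchE ifF//; apply/negbTE/negP; rewrite inE /udisk /=.
by apply/negP; rewrite -leNgt (le_trans x1)// lerDl sqr_ge0.
Qed.

Lemma I_slices F : continuous F ->
  mu.-integrable setT (EFin \o (fun x => J (- halfchord x) (halfchord x) (fun y => F (x, y)))) /\
  I F = \int[mu]_x J (- halfchord x) (halfchord x) (fun y => F (x, y)).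
Proof.
move=> cF.
have iF : (lebesgue2 R).-integrable setT (EFin \o (F \_ udisk)).
  rewrite -restrict_EFin.
  by apply/(integrable_mkcond _ measurable_udisk); exact: I_integrable.
have E x : (fubini_F mu (EFin \o (F \_ udisk))) x = (J (- halfchord x) (halfchord x) (fun y => F (x, y)))%:E.
  exact: I_slices_cut.
split.
  rewrite (_ : EFin \o _ = fubini_F mu (EFin \o (F \_ udisk))); last by apply/funext => x; exact/esym/E.
  exact: integrable_fubini_F.
rewrite /I Rintegral_mkcond /Rintegral -(integral12_prod_meas1 iF).
by congr fine; apply: eq_integral => x _; exact: E.
Qed.

Lemma I_le_slices F G : continuous F -> continuous G ->
  (forall x, x ^+ 2 < 1 ->
    J (- halfchord x) (halfchord x) (fun y => F (x, y)) <=
    J (- halfchord x) (halfchord x) (fun y => G (x, y))) ->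
  I F <= I G.
Proof.
move=> cF cG FG; have [iF ->] := I_slices cF; have [iG ->] := I_slices cG.
apply: le_Rintegral => // x _; have [/FG //|x1] := ltP (x ^+ 2) 1.
by rewrite /halfchord ler0_sqrtr ?subr_le0// oppr0 /J set_itv1 !Rintegral_set1.
Qed.

Lemma I_eq0_slices F : continuous F ->
  (forall x, x ^+ 2 < 1 -> J (- halfchord x) (halfchord x) (fun y => F (x, y)) = 0) ->
  I F = 0.
Proof.
move=> cF F0; have [iF ->] := I_slices cF.
rewrite /Rintegral integral0_eq// => x _; have [/F0 ->//|x1] := ltP (x ^+ 2) 1.
by rewrite /halfchord ler0_sqrtr ?subr_le0// oppr0 /J set_itv1 !Rintegral_set1.
Qed.

Lemma J_support a b c d (f : R -> R) : a <= c -> c <= d -> d <= b -> continuous f ->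
  (forall t, t <= c \/ d <= t -> f t = 0) -> J a b f = J c d f.
Proof.
move=> ac cd db cf f0.
have w u v : {within `[u, v], continuous f} by exact: continuous_subspaceT.
have z u v : u <= v -> (v <= c \/ d <= u) -> J u v f = 0.
  move=> uv H; rewrite (@eq_J _ _ _ _ (fun=> 0)) ?J_cst ?mul0r// => t /andP[ut tv].
  by apply: f0; case: H => H; [left; exact: le_trans H|right; exact: le_trans ut].
rewrite (@J_split _ _ c) ?(le_trans cd db)// (@J_split _ c d b)// (z a c)//; last by left.
by rewrite (z d b)// ?addr0 ?add0r//; right.
Qed.

Lemma halfchord_le1 x : halfchord x <= 1.
Proof. by rewrite -[leRHS]sqrtr1 ler_sqrt// lerBlDr lerDl sqr_ge0. Qed.

Lemma udisk_slice_out x y : x ^+ 2 < 1 -> y <= - halfchord x \/ halfchord x <= y -> ~ udisk (x, y).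
Proof. by move=> x1 H; rewrite /udisk /= halfchordP// => /andP[]; case: H; rewrite leNgt => /negbTE ->. Qed.

Lemma J_chord F x : x ^+ 2 < 1 -> continuous F -> (forall z, ~ udisk z -> F z = 0) ->
  J (-1) 1 (fun y => F (x, y)) = J (- halfchord x) (halfchord x) (fun y => F (x, y)).
Proof.
move=> x1 cF F0; have h0 : 0 <= halfchord x := sqrtr_ge0 _; have h1 := halfchord_le1 x.
apply: J_support; rewrite ?lerN2//; first by rewrite (le_trans _ h0)// oppr_le0.
  exact: cslice2.
by move=> t H; apply: F0; exact: udisk_slice_out.
Qed.

(** Support in the disk lets every chord be extended to the fixed interval from -1 to 1, so that
    slice inequalities with subdivision points independent of the chord can be integrated. *)
Lemma I_nested F : continuous F -> (forall z, ~ udisk z -> F z = 0) ->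
  mu.-integrable `[-1, 1] (EFin \o (fun x => J (-1) 1 (fun y => F (x, y)))) /\
  I F = J (-1) 1 (fun x => J (-1) 1 (fun y => F (x, y))).
Proof.
move=> cF F0; have [iF E] := I_slices cF.
have e x : J (- halfchord x) (halfchord x) (fun y => F (x, y)) = J (-1) 1 (fun y => F (x, y)).
  have [x1|x1] := ltP (x ^+ 2) 1; first by rewrite J_chord.
  rewrite /halfchord ler0_sqrtr ?subr_le0// oppr0 {1}/J set_itv1 Rintegral_set1.
  rewrite J0// => y _; rewrite F0// /udisk /=; apply/negP; rewrite -leNgt.
  by rewrite (le_trans x1)// lerDl sqr_ge0.
have e0 x : ~ `[-1, 1]%classic x -> J (-1) 1 (fun y => F (x, y)) = 0.
  move=> x1; rewrite J0// => y _; rewrite F0// => /udisk_box [/=].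
  by move=> H _; apply: x1.
split.
  rewrite (_ : (fun x => _) = (fun x => J (- halfchord x) (halfchord x) (fun y => F (x, y)))).
    exact: integrableS iF.
  by apply/funext => x; rewrite e.
rewrite E; transitivity (\int[mu]_x ((fun x => J (-1) 1 (fun y => F (x, y))) \_ `[-1, 1]) x).
  2: exact/esym/Rintegral_mkcond.
apply: eq_Rintegral => x _; rewrite patchE e.
by case: ifPn => //; rewrite notin_setE => /e0.
Qed.

End disk_integral.

(** * Change of variables for a map that scales the measure *)

Section change_of_variables.
Context d (T : measurableType d) (R : realType) (m : {measure set T -> \bar R}).
Context (phi : T -> T) (mphi : measurable_fun [set: T] phi) (k : R).
Context (k0 : 0 < k).
Context (phiE : forall A : set T, measurable A ->
  m A = (k%:E * m (phi @^-1` A))%E).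

Let nu := mscale (NngNum (ltW k0)) (image_measure m mphi).

Lemma measurable_cov (D : set T) : measurable D -> measurable (phi @^-1` D).
Proof. by move=> mD; rewrite -[_ @^-1` _]setTI; exact: mphi. Qed.

(** By [phiE] the measure is [k] times its own pushforward under [phi], so this is the integral
    against a scaled pushforward. *)
Lemma ge0_integral_cov (D : set T) (f : T -> \bar R) : measurable D ->
  measurable_fun D f -> (forall z, D z -> (0 <= f z)%E) ->
  (\int[m]_(z in D) f z = k%:E * \int[m]_(z in phi @^-1` D) f (phi z))%E.
Proof.
move=> mD mf f0.
rewrite (eq_measure_integral nu) => [|A mA _]; last by rewrite /nu /mscale /=; exact: phiE.
rewrite /nu ge0_integral_mscale//; congr (_ * _)%E.
rewrite [LHS](ge0_integral_pushforward mphi m mD mf)//.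
by move=> z; rewrite inE; exact: f0.
Qed.

Lemma integrable_cov (D : set T) (F : T -> R) : measurable D ->
  m.-integrable D (EFin \o F) -> m.-integrable (phi @^-1` D) (EFin \o (F \o phi)).
Proof.
move=> mD /integrableP[mF iF]; apply/integrableP; split.
  apply: (@measurable_comp _ _ _ _ _ _ D (EFin \o F)) => //.
    by move=> _ [z Dz <-].
  by apply: measurable_funS mphi.
move: iF; rewrite (ge0_integral_cov mD (f := fun x => `|(EFin \o F) x|%E)) //; last exact: measurableT_comp.
rewrite ltey => H; rewrite ltey; apply: contra H => /eqP ->.
by rewrite gt0_muley// lte_fin.
Qed.

Lemma Rintegral_cov (D : set T) (F : T -> R) : measurable D ->
  m.-integrable D (EFin \o F) ->
  \int[m]_(z in D) F z = k * \int[m]_(z in phi @^-1` D) F (phi z).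
Proof.
move=> mD iF; have [mF _] := integrableP _ _ _ iF.
have iFp := integrable_cov mD iF.
have ip := integrable_fin_num (measurable_cov mD) (integrable_funepos (measurable_cov mD) iFp).
have ine := integrable_fin_num (measurable_cov mD) (integrable_funeneg (measurable_cov mD) iFp).
have mpos : measurable_fun D ((EFin \o F)^\+)%E by exact: measurable_funepos.
have mneg : measurable_fun D ((EFin \o F)^\-)%E by exact: measurable_funeneg.
rewrite /Rintegral -[k]/(fine k%:E) -fineM//; last exact: (integrable_fin_num (measurable_cov mD) iFp).
congr fine.
rewrite integralE [in RHS]integralE (ge0_integral_cov mD mpos)// (ge0_integral_cov mD mneg)//.
have Ep : (\int[m]_(z in phi @^-1` D) (EFin \o F)^\+ (phi z) =
    \int[m]_(z in phi @^-1` D) (EFin \o (F \o phi))^\+ z)%E.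
  have -> : ((EFin \o (F \o phi))^\+ = (EFin \o F)^\+ \o phi)%E by rewrite -funepos_comp.
  by [].
have En : (\int[m]_(z in phi @^-1` D) (EFin \o F)^\- (phi z) =
    \int[m]_(z in phi @^-1` D) (EFin \o (F \o phi))^\- z)%E.
  have -> : ((EFin \o (F \o phi))^\- = (EFin \o F)^\- \o phi)%E by rewrite -funeneg_comp.
  by [].
by rewrite Ep En -muleBr// fin_num_adde_defr.
Qed.

End change_of_variables.

(** * Symmetries of the disk, integration by parts and parameter integrals *)

Section disk_symmetries.
Context {R : realType}.
Notation mT := (measurableTypeR R * measurableTypeR R)%type.
Implicit Types (F G : R * R -> R).

Lemma Rintegral_swap (D : set mT) (F : mT -> R) : measurable D ->
  (lebesgue2 R).-integrable D (EFin \o F) ->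
  \int[lebesgue2 R]_(z in D) F z =
  \int[lebesgue2 R]_(z in (@unstable.swap R R) @^-1` D) F (unstable.swap z).
Proof.
move=> mD iF.
have ms : measurable_fun [set: mT] (@unstable.swap R R : mT -> mT) by exact: measurable_swap.
rewrite (Rintegral_cov ms (@ltr01 R) _ mD iF) ?mul1r// => A mA.
by rewrite mul1e; exact: lebesgue2_swap.
Qed.

Lemma Rintegral_aff (c : R * R) (a b : R) (D : set mT) (F : mT -> R) :
  a != 0 -> b != 0 -> measurable D ->
  (lebesgue2 R).-integrable D (EFin \o F) ->
  \int[lebesgue2 R]_(z in D) F z =
  `|a| * `|b| * \int[lebesgue2 R]_(z in (aff c a b) @^-1` D) F (aff c a b z).
Proof.
move=> a0 b0 mD iF.
have ab0 : 0 < `|a| * `|b| by rewrite mulr_gt0 ?normr_gt0.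
rewrite (Rintegral_cov (measurable_aff c a b) ab0 _ mD iF)// => A mA.
exact: lebesgue2_aff.
Qed.

Lemma I_swap F : continuous F -> I (fun z => F (z.2, z.1)) = I F.
Proof.
move=> cF; rewrite [RHS]Rintegral_swap; [|exact: measurable_udisk|exact: I_integrable].
rewrite (_ : _ @^-1` _ = udisk)//.
by apply/seteqP; split => z; rewrite /udisk /= addrC.
Qed.

Lemma I_reflx F : continuous F -> I (fun z => F (- z.1, z.2)) = I F.
Proof.
move=> cF; rewrite [RHS](@Rintegral_aff (0, 0) (-1) 1);
  [|by rewrite ?oppr_eq0 oner_eq0..|exact: measurable_udisk|exact: I_integrable].
rewrite normrN !normr1 !mul1r (_ : _ @^-1` _ = udisk).
  by apply: eq_I => z _; rewrite /aff /= !add0r mulN1r mul1r.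
by apply/seteqP; split => z; rewrite /udisk /aff /= !add0r mulN1r mul1r sqrrN.
Qed.

Lemma I_refly F : continuous F -> I (fun z => F (z.1, - z.2)) = I F.
Proof.
move=> cF; rewrite [RHS](@Rintegral_aff (0, 0) 1 (-1));
  [|by rewrite ?oppr_eq0 oner_eq0..|exact: measurable_udisk|exact: I_integrable].
rewrite normrN !normr1 !mul1r (_ : _ @^-1` _ = udisk).
  by apply: eq_I => z _; rewrite /aff /= !add0r mulN1r mul1r.
by apply/seteqP; split => z; rewrite /udisk /aff /= !add0r mulN1r mul1r sqrrN.
Qed.

Lemma cont_swap F : continuous F -> continuous (fun z => F (z.2, z.1)).
Proof.
move=> cF z; apply: (@continuous_comp _ _ _ (fun z : R * R => (z.2, z.1)) F); last exact: cF.
by apply: (@cvg_pair _ _ _ _ (nbhs z.2) (nbhs z.1) _ _ _ snd fst); [exact: cvg_snd|exact: cvg_fst].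
Qed.

Lemma d_slice2 F x y a : is_derive (x, y) ((0, 1) : R * R) F a ->
  is_derive y 1 (fun t : R => F (x, t)) a.
Proof.
have E : (fun h : R => h^-1 *: (F (x, h *: (1 : R) + y) - F (x, y))) =
  (fun h : R => h^-1 *: (F (h *: ((0, 1) : R * R) + (x, y)) - F (x, y))).
  apply/funext => h; congr (_ *: (F _ - _)).
  by rewrite -[RHS]/(h * _ + x, h * _ + y) /= mulr0 ?add0r.
by move=> [d dE]; split; [rewrite /derivable E|rewrite /derive E].
Qed.

Lemma d_slice1 F x y a : is_derive (x, y) ((1, 0) : R * R) F a ->
  is_derive x 1 (fun t : R => F (t, y)) a.
Proof.
have E : (fun h : R => h^-1 *: (F (h *: (1 : R) + x, y) - F (x, y))) =
  (fun h : R => h^-1 *: (F (h *: ((1, 0) : R * R) + (x, y)) - F (x, y))).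
  apply/funext => h; congr (_ *: (F _ - _)).
  by rewrite -[RHS]/(h * _ + x, h * _ + y) /= mulr0 ?add0r.
by move=> [d dE]; split; [rewrite /derivable E|rewrite /derive E].
Qed.

(** On each vertical chord the fundamental theorem of calculus leaves only the two end values, and
    these lie on the circle. *)
Lemma I_dy0 F F' : continuous F' -> (forall z, is_derive z ((0, 1) : R * R) F (F' z)) ->
  (forall z, z.1 ^+ 2 + z.2 ^+ 2 = 1 -> F z = 0) -> I F' = 0.
Proof.
move=> cF' dF F0; apply: I_eq0_slices => // x x1.
have h0 : - halfchord x <= halfchord x by rewrite ge0_cp ?sqrtr_ge0.
have dFx t : - halfchord x <= t <= halfchord x -> is_derive t 1 (fun y => F (x, y)) (F' (x, t)).
  by move=> _; exact: d_slice2.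
rewrite (J_FTC h0 dFx); last exact/continuous_subspaceT/cslice2.
by rewrite !F0 ?subrr//= ?sqrrN sqr_sqrtr ?subr_ge0 1?ltW// addrC subrK.
Qed.

Lemma d_swap F z a : is_derive z ((1, 0) : R * R) F a ->
  is_derive (z.2, z.1) ((0, 1) : R * R) (fun w => F (w.2, w.1)) a.
Proof.
have E : (fun h : R => h^-1 *: (F ((h *: ((0, 1) : R * R) + (z.2, z.1)).2, (h *: ((0, 1) : R * R)
  + (z.2, z.1)).1) - F (z.1, z.2))) =
  (fun h : R => h^-1 *: (F (h *: ((1, 0) : R * R) + z) - F z)).
  by apply/funext => h; case: z.
by move=> [d dE]; split; [rewrite /derivable E|rewrite /derive E].
Qed.

Lemma d_swap2 F z a : is_derive z ((0, 1) : R * R) F a ->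
  is_derive (z.2, z.1) ((1, 0) : R * R) (fun w => F (w.2, w.1)) a.
Proof.
have E : (fun h : R => h^-1 *: (F ((h *: ((1, 0) : R * R) + (z.2, z.1)).2, (h *: ((1, 0) : R * R)
  + (z.2, z.1)).1) - F (z.1, z.2))) =
  (fun h : R => h^-1 *: (F (h *: ((0, 1) : R * R) + z) - F z)).
  by apply/funext => h; case: z.
by move=> [d dE]; split; [rewrite /derivable E|rewrite /derive E].
Qed.

Lemma I_dx0 F F' : continuous F' -> (forall z, is_derive z ((1, 0) : R * R) F (F' z)) ->
  (forall z, z.1 ^+ 2 + z.2 ^+ 2 = 1 -> F z = 0) -> I F' = 0.
Proof.
move=> cF' dF F0; rewrite -I_swap//.
apply: (@I_dy0 (fun w => F (w.2, w.1))).
- exact: cont_swap.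
- by move=> [x y]; exact: (@d_swap F (y, x)).
- by move=> z z1; apply: F0; rewrite /= addrC.
Qed.

Lemma bounded_on_box F a b c d : continuous F ->
  exists M, forall x y, a <= x <= b -> c <= y <= d -> `|F (x, y)| <= M.
Proof.
move=> cF; have cBox : compact (`[a, b] `*` `[c, d] : set (R * R)).
  by apply: compact_setX; exact: segment_compact.
have /compact_bounded[N [_ hN]] := continuous_compact (@continuous_subspaceT _ _ _ _ cF) cBox.
exists (N + 1) => x y abx cdy; apply: hN; first by rewrite ltrDl.
by exists (x, y) => //; split; rewrite /= in_itv.
Qed.

Lemma continuous_J F a b : continuous F -> continuous (fun y => J a b (fun x => F (x, y))).
Proof.
move=> cF y.
have [M MP] := @bounded_on_box F a b (y - 1) (y + 1) cF.
pose f (y' : R) (x : R) := F (x, y').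
have := @continuity_under_integral R _ _ (@lebesgue_measure R) f `[a, b]%classic (measurable_itv _) (y
  - 1) (y + 1) _ _ (cst M) _ _ y.
move=> H; apply: H.
- move=> y' _; apply: J_integrable; apply: continuous_subspaceT; exact: cslice1.
- by apply: aeW => x _ y' _; exact: cslice2.
- by apply: J_integrable; apply: continuous_subspaceT; exact: cC.
- move=> y' /= Iy'; apply: aeW => x; rewrite /= in_itv /= => abx; apply: MP => //.
  by move: Iy'; rewrite in_itv /= => /andP[? ?]; rewrite !ltW.
- by rewrite inE /= in_itv /=; apply/andP; split; lra.
Qed.

Lemma derive_J F F' a b (y : R) : continuous F -> continuous F' ->
  (forall z, is_derive z ((0, 1) : R * R) F (F' z)) ->
  is_derive y 1 (fun y : R => J a b (fun x => F (x, y))) (J a b (fun x => F' (x, y))).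
Proof.
move=> cF cF' dF.
(* Compactness bounds [F'] for parameters within distance 1 of [y]; this constant dominates the
   derivative under the integral sign. *)
have [M MP] := @bounded_on_box F' a b (y - 1) (y + 1) cF'.
pose f (y' : R) (x : R) := F (x, y').
have df (y' x : R) : is_derive y' 1 (f^~ x) (F' (x, y')) by exact: d_slice2.
have d1 (y' x : R) : partial1of2 f y' x = F' (x, y').
  by rewrite partial1of2E; have [_ <-] := df y' x.
have yI : `]y - 1, y + 1[%classic y by rewrite /= in_itv /=; apply/andP; split; lra.
have intf x : `]y - 1, y + 1[%classic x ->
    (@lebesgue_measure R).-integrable `[a, b] (EFin \o f x).
  by move=> _; apply: J_integrable; apply: continuous_subspaceT; exact: cslice1.
have derf (x t : R) : `]y - 1, y + 1[%classic x -> `[a, b]%classic t -> derivable (f ^~ t) x 1.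
  by move=> _ _; case: (df x t).
have G0 (t : R) : 0 <= cst `|M| t by [].
have iG : (@lebesgue_measure R).-integrable `[a, b] (EFin \o cst `|M|).
  by apply: J_integrable; apply: continuous_subspaceT; exact: cC.
have Gub (x t : R) : `]y - 1, y + 1[%classic x -> `[a, b]%classic t -> `|partial1of2 f x t| <= cst `|M| t.
  rewrite /= !in_itv /= d1 => /andP[? ?] abt; rewrite (le_trans (MP _ _ abt _)) ?ler_norm//.
  by rewrite !ltW.
have mab : measurable (`[a, b] : set (measurableTypeR R)) by exact: measurable_itv.
have H1 := derivable_under_integral mab yI intf derf.
have H2 := H1 (cst `|M|) G0 iG Gub.
split; first exact: H2.
rewrite -derive1E (differentiation_under_integral mab yI intf derf G0 iG Gub).
by apply: eq_Rintegral => x _; rewrite d1.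
Qed.

End disk_symmetries.

(** * Odd-odd and even-even functions *)

Section slices.
Context {R : realType}.
Implicit Types (g f : R -> R) (F G Fx Fy : R * R -> R) (a b k t : R).

Lemma derive_continuous (f f' : R -> R) : (forall t, is_derive t 1 f (f' t)) -> continuous f.
Proof.
move=> df t; apply: differentiable_continuous; apply/derivable1_diffP.
by case: (df t).
Qed.

Lemma Jw a b (f : R -> R) : continuous f -> {within `[a, b], continuous f}.
Proof. exact: continuous_subspaceT. Qed.

(* The comparison function is a truncated cosine, whose first zero lies slightly beyond the end
  of the interval. *)
Lemma quarter a b e (g g' : R -> R) : a < b ->
  (forall t, is_derive t 1 g (g' t)) -> continuous g' ->
  (e = a /\ g b = 0) \/ (e = b /\ g a = 0) ->
  49 / 20 / (b - a) ^+ 2 * J a b (fun t => g t ^+ 2) <= J a b (fun t => g' t ^+ 2).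
Proof.
move=> ab dg cg' H.
have L0 : 0 < b - a by rewrite subr_gt0.
set k := 49 / 20 / (b - a) ^+ 2.
have k0 : 0 < k by rewrite divr_gt0 ?exprn_gt0//; lra.
have cg := derive_continuous dg.
rewrite -JZ; last by apply: Jw; cont.
pose phi t := 1 - k / 2 * (t - e) ^+ 2 + k ^+ 2 / 24 * (t - e) ^+ 4 - k ^+ 3 / 720 * (t - e) ^+ 6.
pose phi' t := - k * (t - e) + k ^+ 2 / 6 * (t - e) ^+ 3 - k ^+ 3 / 120 * (t - e) ^+ 5.
pose phi'' t := - k + k ^+ 2 / 2 * (t - e) ^+ 2 - k ^+ 3 / 24 * (t - e) ^+ 4.
have did t : is_derive t 1 (fun t : R => t - e) (1 - 0) by der.
have dphi t : is_derive t 1 phi (phi' t).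
  rewrite /phi; derive_eq.
  by rewrite /phi' /=; field.
have dphi' t : is_derive t 1 phi' (phi'' t).
  rewrite /phi'; derive_eq.
  by rewrite /phi'' /=; field.
have bound t : a <= t <= b -> 0 <= k * (t - e) ^+ 2 <= 49 / 20.
  move=> /andP[at_ tb]; rewrite mulr_ge0 ?sqr_ge0 ?(ltW k0)//=.
  rewrite /k mulrAC ler_pdivrMr ?exprn_gt0// ler_pM2l; last by lra.
  by case: H => -[-> _]; nra.
apply: (@picone R a b g g' phi phi' phi'' (fun=> k)) => //; try exact: Jw.
- exact: ltW.
- apply: Jw; rewrite /phi''; cont.
- by apply: Jw; exact: cC.
- move=> t /bound; set w := k * (t - e) ^+ 2 => /andP[w0 w1].
  have -> : phi t = 1 - w / 2 + w ^+ 2 / 24 - w ^+ 3 / 720 by rewrite /phi /w; field.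
  nra.
(* Stopping the cosine series at the sixth power leaves a remainder of favourable sign, so [phi] is
   a supersolution for [k] itself and no error term appears. *)
- move=> t /bound /andP[w0 _].
  rewrite -subr_ge0; have -> : - k * phi t - phi'' t = k * (k * (t - e) ^+ 2) ^+ 3 / 720.
    by rewrite /phi /phi''; field.
  have w3 := exprn_ge0 3 w0; have := mulr_ge0 (ltW k0) w3.
  lra.
- by case: H => -[eE gE]; rewrite /phi' eE ?gE ?subrr; rewrite !expr0n /= ?mulr0 ?mul0r ?subr0 ?addr0 ?mulr0.
- by case: H => -[eE gE]; rewrite /phi' eE ?gE ?subrr; rewrite !expr0n /= ?mulr0 ?mul0r ?subr0 ?addr0 ?mulr0.
Qed.

Lemma sqr_J_le a b f : a < b -> continuous f ->
  (J a b f) ^+ 2 <= (b - a) * J a b (fun t => f t ^+ 2).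
Proof.
move=> ab cf; set m := J a b f / (b - a); have L0 : 0 < b - a by rewrite subr_gt0.
have := @J_ge0 R a b (fun t => (f t - m) ^+ 2) (fun t _ => sqr_ge0 _).
have -> : J a b (fun t => (f t - m) ^+ 2) =
  J a b (fun t => f t ^+ 2) - 2 * m * J a b f + m ^+ 2 * (b - a).
  rewrite -(J_cst (m ^+ 2) (ltW ab)) -JZ -?JB -?JD; try by apply: Jw; cont.
  by apply: eq_J => t _; ring.
move=> H; have Lm : (b - a) * m = J a b f by rewrite /m mulrC divfK ?gt_eqF.
by rewrite -subr_ge0; move: (mulr_ge0 (ltW L0) H); rewrite -Lm; congr (0 <= _); ring.
Qed.

(** The zeros -1, 0, 1 and the cuts at -1/2 and 1/2 give four intervals of length 1/2, each with a
    zero at one end; 49/5 is 49/20 divided by (1/2)^2, slightly below pi^2. *)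
Lemma slice_odd g g' : (forall t, is_derive t 1 g (g' t)) -> continuous g' ->
  g 0 = 0 -> g 1 = 0 -> g (-1) = 0 ->
  49 / 5 * J (-1) 1 (fun t => g t ^+ 2) <= J (-1) 1 (fun t => g' t ^+ 2).
Proof.
move=> dg cg' g0 g1 gN1; have cg := derive_continuous dg.
have s f : continuous f -> J (-1) 1 f = J (-1) (- (1/2)) f + J (- (1/2)) 0 f + J 0 (1/2) f + J (1/2) 1 f.
  move=> cf; rewrite (@J_split _ _ 0); [|lra|lra|exact: Jw].
  by rewrite (@J_split _ (-1) (- (1/2)) 0) ?(@J_split _ 0 (1/2) 1) ?addrA//; try lra; exact: Jw.
rewrite !s; try by cont.
have q a b e : a < b -> b - a = 1 / 2 -> (e = a /\ g b = 0) \/ (e = b /\ g a = 0) ->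
    49 / 5 * J a b (fun t => g t ^+ 2) <= J a b (fun t => g' t ^+ 2).
  move=> ab L H; have := quarter ab dg cg' H; rewrite L.
  by rewrite (_ : 49 / 20 / (1 / 2) ^+ 2 = 49 / 5 :> R)//; field.
have q1 := @q (-1) (- (1/2)) (- (1/2)); have q2 := @q (- (1/2)) 0 (- (1/2)).
have q3 := @q 0 (1/2) (1/2); have q4 := @q (1/2) 1 (1/2).
rewrite !mulrDr !lerD//.
- by apply: q1; [lra|lra|right].
- by apply: q2; [lra|lra|left].
- by apply: q3; [lra|lra|right].
- by apply: q4; [lra|lra|left].
Qed.

(** All six intervals have length 1/3, whence 441/20 = 9 * 49/20. The outer two have a zero of [g]
    at an end; the inner four have a zero of [g - m], where [m] is the common value at -1/3 and 1/3.
    Replacing [m] by the mean of [g] over the inner interval, of length 4/3, only lowers the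
    integral of the square, and costs the rank-one term. *)
Lemma slice_even g g' : (forall t, is_derive t 1 g (g' t)) -> continuous g' ->
  g (- (1/3)) = g (1/3) -> g 1 = 0 -> g (-1) = 0 ->
  441 / 20 * (J (-1) 1 (fun t => g t ^+ 2) - 3 / 4 * (J (- (2/3)) (2/3) g) ^+ 2)
    <= J (-1) 1 (fun t => g' t ^+ 2).
Proof.
move=> dg cg' ge g1 gN1; have cg := derive_continuous dg.
set m := g (1/3) in ge.
have s f : continuous f -> J (-1) 1 f = J (-1) (- (2/3)) f + J (- (2/3)) (2/3) f + J (2/3) 1 f.
  move=> cf; rewrite (@J_split _ _ (- (2/3))); [|lra|lra|exact: Jw].
  by rewrite (@J_split _ (- (2/3)) (2/3) 1) ?addrA//; try lra; exact: Jw.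
have s' f : continuous f -> J (- (2/3)) (2/3) f =
   J (- (2/3)) (- (1/3)) f + J (- (1/3)) 0 f + J 0 (1/3) f + J (1/3) (2/3) f.
  move=> cf; rewrite (@J_split _ _ 0); [|lra|lra|exact: Jw].
  by rewrite (@J_split _ (- (2/3)) (- (1/3)) 0) ?(@J_split _ 0 (1/3) (2/3)) ?addrA//; try lra; exact: Jw.
have q h a b e : (forall t, is_derive t 1 h (g' t)) -> a < b -> b - a = 1 / 3 ->
    (e = a /\ h b = 0) \/ (e = b /\ h a = 0) ->
    441 / 20 * J a b (fun t => h t ^+ 2) <= J a b (fun t => g' t ^+ 2).
  move=> dh ab L H; have := quarter ab dh cg' H; rewrite L.
  by rewrite (_ : 49 / 20 / (1 / 3) ^+ 2 = 441 / 20 :> R)//; field.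
pose h t := g t - m.
have dh t : is_derive t 1 h (g' t).
  by rewrite /h; derive_eq; rewrite subr0.
have ch := derive_continuous dh.
have inner : 441 / 20 * J (- (2/3)) (2/3) (fun t => h t ^+ 2) <= J (- (2/3)) (2/3) (fun t => g' t ^+ 2).
  rewrite !s'; try by cont.
  rewrite !mulrDr !lerD//.
  - by apply: (q h _ _ (- (2/3)) dh); [lra|lra|left; rewrite /h ge subrr].
  - by apply: (q h _ _ 0 dh); [lra|lra|right; rewrite /h ge subrr].
  - by apply: (q h _ _ 0 dh); [lra|lra|left; rewrite /h subrr].
  - by apply: (q h _ _ (2/3) dh); [lra|lra|right; rewrite /h subrr].
have mean : J (- (2/3)) (2/3) (fun t => g t ^+ 2) - 3 / 4 * (J (- (2/3)) (2/3) g) ^+ 2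
   <= J (- (2/3)) (2/3) (fun t => h t ^+ 2).
  have -> : J (- (2/3)) (2/3) (fun t => h t ^+ 2) =
    J (- (2/3)) (2/3) (fun t => g t ^+ 2) - 2 * m * J (- (2/3)) (2/3) g + m ^+ 2 * (2/3 - - (2/3)).
    rewrite -J_cst; last by lra.
    rewrite -JZ -?JB -?JD; try by apply: Jw; cont.
    by apply: eq_J => t _; rewrite /h; ring.
  by rewrite -subr_ge0; set u := J _ _ g; have := sqr_ge0 (2 * m - 3 / 2 * u); lra.
have o1 : 441 / 20 * J (-1) (- (2/3)) (fun t => g t ^+ 2) <= J (-1) (- (2/3)) (fun t => g' t ^+ 2).
  by apply: (q g _ _ (- (2/3)) dg); [lra|lra|right].
have o2 : 441 / 20 * J (2/3) 1 (fun t => g t ^+ 2) <= J (2/3) 1 (fun t => g' t ^+ 2).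
  by apply: (q g _ _ (2/3) dg); [lra|lra|left].
rewrite !s; try by cont.
lra.
Qed.

Definition C1 F Fx Fy := [/\ continuous F, continuous Fx, continuous Fy,
  forall z, is_derive z ((1, 0) : R * R) F (Fx z) &
  forall z, is_derive z ((0, 1) : R * R) F (Fy z)].

Definition supported F := forall z, ~ udisk z -> F z = 0.

(** What is kept of a test function after it has been transported to the unit disk: the partial
    derivatives vanish outside as well, so they too can be integrated over the fixed square. *)
Definition C1c F Fx Fy := [/\ C1 F Fx Fy, supported F, supported Fx & supported Fy].

Lemma C1c_swap F Fx Fy : C1c F Fx Fy ->
  C1c (fun z => F (z.2, z.1)) (fun z => Fy (z.2, z.1)) (fun z => Fx (z.2, z.1)).
Proof.
move=> [[cF cFx cFy dx dy] s sx sy].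
have ss G : supported G -> supported (fun z => G (z.2, z.1)).
  by move=> sG z nz; apply: sG; rewrite /udisk /= addrC.
split; [split|exact: ss..]; try exact: cont_swap.
- by move=> [x y]; exact: (@d_swap2 _ F (y, x)).
- by move=> [x y]; exact: (@d_swap _ F (y, x)).
Qed.

Lemma udisk_axis (F : R * R -> R) x : supported F -> F (x, 1) = 0 /\ F (x, -1) = 0.
Proof.
by move=> s; split; apply: s; rewrite /udisk /= ?sqrrN expr1n; apply/negP; rewrite -leNgt lerDr sqr_ge0.
Qed.

Lemma I_le_box F G : continuous F -> continuous G -> supported F -> supported G ->
  (forall x, J (-1) 1 (fun y => F (x, y)) <= J (-1) 1 (fun y => G (x, y))) -> I F <= I G.
Proof.
move=> cF cG sF sG FG; have [iF ->] := I_nested cF sF; have [iG ->] := I_nested cG sG.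
by apply: le_Rintegral.
Qed.

Lemma supported_sqr F : supported F -> supported (fun z => F z ^+ 2).
Proof. by move=> s z /s ->; rewrite expr0n. Qed.

Lemma odd_y F Fx Fy : C1c F Fx Fy -> (forall x, F (x, 0) = 0) ->
  49 / 5 * I (fun z => F z ^+ 2) <= I (fun z => Fy z ^+ 2).
Proof.
move=> [[cF cFx cFy dx dy] s sx sy] F0.
rewrite -IZ; last by cont.
apply: I_le_box; try by cont.
- by move=> z /s ->; rewrite expr0n mulr0.
- exact: supported_sqr.
move=> x; have cs : continuous (fun y => F (x, y)) by exact: cslice2.
rewrite JZ; last by apply: Jw; cont.
have [h1 h2] := udisk_axis x s.
apply: (@slice_odd (fun y => F (x, y)) (fun y => Fy (x, y))) => //.
- by move=> t; exact: d_slice2.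
- exact: cslice2.
Qed.

(** Adding the slice bounds in both directions gives 98/5, slightly below 2 pi^2, the odd-odd
    Dirichlet eigenvalue of the square that circumscribes the disk. *)
Lemma odd_odd F Fx Fy : C1c F Fx Fy -> (forall x, F (x, 0) = 0) -> (forall y, F (0, y) = 0) ->
  98 / 5 * I (fun z => F z ^+ 2) <= I (fun z => Fx z ^+ 2) + I (fun z => Fy z ^+ 2).
Proof.
move=> C F0x F0y; have h1 := odd_y C F0x.
have h2 := odd_y (C1c_swap C) F0y.
have [[cF cFx cFy _ _] _ _ _] := C.
move: h2; rewrite (I_swap (F := fun z => F z ^+ 2)) ?(I_swap (F := fun z => Fx z ^+ 2)); try by cont.
lra.
Qed.

Definition box_mean F : R := J (- (2/3)) (2/3) (fun y => J (- (2/3)) (2/3) (fun x => F (x, y))).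

(** [slice_even] is tensorised: on horizontal slices it leaves a correction in the partial means
    [A], and applied again to [A] it turns this into a correction in the mean over the square of
    half-side 2/3. The factor 9/16 is (3/4)^2. *)
Lemma even_even F Fx Fy : C1c F Fx Fy ->
  (forall x y, F (- x, y) = F (x, y)) -> (forall x y, F (x, - y) = F (x, y)) ->
  441 / 20 * (I (fun z => F z ^+ 2) - 9 / 16 * box_mean F ^+ 2)
    <= I (fun z => Fx z ^+ 2) + I (fun z => Fy z ^+ 2).
Proof.
move=> C ex ey; have [[cF cFx cFy dx dy] s sx sy] := C.
pose A y := J (- (2/3)) (2/3) (fun x => F (x, y)).
pose A' y := J (- (2/3)) (2/3) (fun x => Fy (x, y)).
have dA (y : R) : is_derive y 1 A (A' y) by exact: derive_J.
have cA : continuous A by exact: derive_continuous dA.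
have cA' : continuous A' by exact: continuous_J.
have A1 : A 1 = 0 by apply: J0 => x _; case: (udisk_axis x s).
have AN1 : A (-1) = 0 by apply: J0 => x _; case: (udisk_axis x s).
have Ae : A (- (1/3)) = A (1/3) by apply: eq_J => x _; exact: ey.
have hA := slice_even dA cA' Ae A1 AN1.
have nest G : continuous G -> supported G ->
    (@lebesgue_measure R).-integrable `[-1, 1] (EFin \o (fun y => J (-1) 1 (fun x => G (x, y)))) /\
    I G = J (-1) 1 (fun y => J (-1) 1 (fun x => G (x, y))).
  move=> cG sG; rewrite -I_swap//; apply: (@I_nested _ (fun z => G (z.2, z.1))); first exact: cont_swap.
  by move=> z nz; apply: sG; rewrite /udisk /= addrC.
have sq G : continuous G -> continuous (fun z => G z ^+ 2) by move=> cG; cont.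
have h1 : 441 / 20 * (I (fun z => F z ^+ 2) - 3 / 4 * J (-1) 1 (fun y => A y ^+ 2)) <= I (fun z => Fx z ^+ 2).
  have [_ ->] := nest _ (sq _ cF) (supported_sqr s).
  have [_ ->] := nest _ (sq _ cFx) (supported_sqr sx).
  rewrite -JZ -?JB -?JZ; try by apply: Jw; have := @continuous_J _ _ (-1) 1 (sq _ cF) => ?; cont.
  apply: J_le; try by apply: Jw; have := @continuous_J _ _ (-1) 1 (sq _ cF) => ?; cont.
    by apply: Jw; apply: (@continuous_J _ (fun z => Fx z ^+ 2)); cont.
  move=> y _; apply: (@slice_even (fun x => F (x, y)) (fun x => Fx (x, y))) => //.
  - by move=> t; exact: d_slice1.
  - exact: cslice1.
  - by apply: s; rewrite /udisk /= expr1n; apply/negP; rewrite -leNgt lerDl sqr_ge0.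
  - by apply: s; rewrite /udisk /= sqrrN expr1n; apply/negP; rewrite -leNgt lerDl sqr_ge0.
(* Cauchy-Schwarz on the inner interval, of length 4/3. *)
have h2 : 3 / 4 * J (-1) 1 (fun y => A' y ^+ 2) <= I (fun z => Fy z ^+ 2).
  have [_ ->] := nest _ (sq _ cFy) (supported_sqr sy).
  rewrite -JZ; last by apply: Jw; cont.
  apply: J_le; try by apply: Jw; cont.
    by apply: Jw; apply: (@continuous_J _ (fun z => Fy z ^+ 2)); cont.
  move=> y _; have cs : continuous (fun x => Fy (x, y)) by exact: cslice1.
  have L : - (2 / 3) < 2 / 3 :> R by clear; lra.
  have := sqr_J_le L cs.
  have : J (- (2/3)) (2/3) (fun x => Fy (x, y) ^+ 2) <= J (-1) 1 (fun x => Fy (x, y) ^+ 2).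
    rewrite (@J_split _ (-1) (- (2/3)) 1); [|by clear; lra|by clear; lra|by apply: Jw; cont].
    rewrite (@J_split _ (- (2/3)) (2/3) 1); [|by clear; lra|by clear; lra|by apply: Jw; cont].
    have p u v : 0 <= J u v (fun x => Fy (x, y) ^+ 2) by apply: J_ge0 => t _; exact: sqr_ge0.
    by have := p (-1) (- (2/3)); have := p (2/3) 1; lra.
  by rewrite /A'; lra.
move: h1 h2 hA; rewrite /box_mean -/A.
lra.
Qed.

End slices.

(** * Functions odd in one variable *)

Section odd_eigenvalue.
Context {R : realType}.
Implicit Types (F G Fx Fy : R * R -> R) (t : R).

(* Truncated power series of J_1(sqrt(M t)) / sqrt t with M = 356/25, slightly below the square
  of the first zero of J_1. *)
Definition bessel (t : R) : R := let m := 89 / 25 in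
  1 - m / 2 * t * (1 - m / 6 * t * (1 - m / 12 * t * (1 - m / 20 * t * (1 - m / 30 * t)))).

Definition bessel1 (t : R) : R := let m := 89 / 25 in
  - (m / 2) * (1 - m / 3 * t * (1 - m / 8 * t * (1 - m / 15 * t * (1 - m / 24 * t)))).

Definition bessel2 (t : R) : R := let m := 89 / 25 in
  m ^+ 2 / 6 * (1 - m / 4 * t * (1 - m / 10 * t * (1 - m / 18 * t))).

Lemma dbessel t : is_derive t 1 bessel (bessel1 t).
Proof. by rewrite /bessel /=; derive_eq; rewrite /bessel1 /=; field. Qed.

Lemma dbessel1 t : is_derive t 1 bessel1 (bessel2 t).
Proof. by rewrite /bessel1 /=; derive_eq; rewrite /bessel2 /=; field. Qed.

Lemma bessel_ge t : 0 <= t <= 1 -> 1 / 100 <= bessel t.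
Proof.
move=> /andP[t0 t1]; rewrite /bessel /=.
have s0 : 0 <= 1 - t by rewrite subr_ge0.
have h2 := exprn_ge0 2 s0; have h3 := exprn_ge0 3 s0; have h4 := exprn_ge0 4 s0.
have h5 := exprn_ge0 5 s0.
lra.
Qed.

Lemma bessel1_le t : 0 <= t <= 1 -> `|bessel1 t| <= 5.
Proof.
move=> /andP[t0 t1]; rewrite /bessel1 ler_norml /=.
have s0 : 0 <= 1 - t by rewrite subr_ge0.
have b k : 0 <= t ^+ k <= 1 by rewrite exprn_ge0//= exprn_ile1.
have := b 2; have := b 3; have := b 4 => /andP[? ?] /andP[? ?] /andP[? ?].
by apply/andP; split; lra.
Qed.

(** The Laplacian of y B(x^2 + y^2) is y (8 B' + 4 t B'') at t = x^2 + y^2, so y times [bessel] is a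
    supersolution for 356/25 where y is positive; the truncation contributes a t^5 term of the right
    sign. *)
Lemma bessel_ode t : 0 <= t ->
  8 * bessel1 t + 4 * t * bessel2 t <= - (356 / 25) * bessel t.
Proof.
move=> t0; rewrite -subr_ge0.
have -> : - (356 / 25) * bessel t - (8 * bessel1 t + 4 * t * bessel2 t) =
  let m := 89 / 25 in 4 * (m / 2 * (m / 6) * (m / 12) * (m / 20) * (m / 30) * m) * t ^+ 5
    by rewrite /bessel /bessel1 /bessel2; field.
have h := exprn_ge0 5 t0; rewrite /=.
lra.
Qed.

(* Equal to bessel on the unit disk, but positive everywhere. *)
Definition besselD (z : R * R) : R := let p := bessel (z.1 ^+ 2 + z.2 ^+ 2) in
  (p + 1 / 100 + `|p - 1 / 100|) / 2.

Lemma besselD_gt0 z : 0 < besselD z.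
Proof.
rewrite /besselD /=; set p := bessel _.
by have := ler_norm (p - 1 / 100); have := ler_norm (- (p - 1 / 100)); rewrite normrN; lra.
Qed.

Lemma besselDE z : z.1 ^+ 2 + z.2 ^+ 2 <= 1 -> besselD z = bessel (z.1 ^+ 2 + z.2 ^+ 2).
Proof.
move=> z1; rewrite /besselD /= ger0_norm; first by field.
by rewrite subr_ge0 bessel_ge// addr_ge0 ?sqr_ge0.
Qed.

Lemma cbessel : continuous bessel. Proof. exact: derive_continuous dbessel. Qed.
Lemma cbessel1 : continuous bessel1. Proof. exact: derive_continuous dbessel1. Qed.
Lemma cbessel2 : continuous bessel2. Proof. by rewrite /bessel2 /=; cont. Qed.

Lemma ccomp (T : topologicalType) (h : R -> R) (f : T -> R) : continuous h -> continuous f ->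
  continuous (fun x => h (f x)).
Proof. by move=> ch cf x; apply: (@continuous_comp _ _ _ f h); [exact: cf|exact: ch]. Qed.

Lemma cbesselD : continuous besselD.
Proof.
have c : continuous (fun z : R * R => bessel (z.1 ^+ 2 + z.2 ^+ 2)).
  by apply: (ccomp cbessel); cont.
rewrite /besselD /=; cont; apply: cabs; cont.
Qed.

Definition weight1 (z : R * R) : R :=
  - (2 * bessel1 (z.1 ^+ 2 + z.2 ^+ 2) + 4 * z.1 ^+ 2 * bessel2 (z.1 ^+ 2 + z.2 ^+ 2)) / besselD z.

(** A lower bound for - phi_yy / phi with phi = (e + |y|) [bessel](x^2 + y^2), where [e] keeps phi
    positive on the axis. The first term is the exact value for [e = 0]; the second pays for [e],
    and 2000 = 4 * 5 * 100 comes from [bessel1_le] and [bessel_ge]. *)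
Definition weight2 (e : R) (z : R * R) : R :=
  - (6 * bessel1 (z.1 ^+ 2 + z.2 ^+ 2) + 4 * z.2 ^+ 2 * bessel2 (z.1 ^+ 2 + z.2 ^+ 2)) / besselD z
  - 2000 * (e / (e + `|z.2|)).

Lemma cweight1 : continuous weight1.
Proof.
have c1 : continuous (fun z : R * R => bessel1 (z.1 ^+ 2 + z.2 ^+ 2)) by apply: (ccomp cbessel1); cont.
have c2 : continuous (fun z : R * R => bessel2 (z.1 ^+ 2 + z.2 ^+ 2)) by apply: (ccomp cbessel2); cont.
have cD := cV cbesselD (fun z => lt0r_neq0 (besselD_gt0 z)).
rewrite /weight1; cont.
Qed.

Lemma cweight2 e : 0 < e -> continuous (weight2 e).
Proof.
move=> e0.
have c1 : continuous (fun z : R * R => bessel1 (z.1 ^+ 2 + z.2 ^+ 2)) by apply: (ccomp cbessel1); cont.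
have c2 : continuous (fun z : R * R => bessel2 (z.1 ^+ 2 + z.2 ^+ 2)) by apply: (ccomp cbessel2); cont.
have cD := cV cbesselD (fun z => lt0r_neq0 (besselD_gt0 z)).
have cE : continuous (fun z : R * R => (e + `|z.2|)^-1).
  by apply: cV => [|z]; [cont; apply: cabs; exact: csnd|rewrite gt_eqF// ltr_pwDl].
rewrite /weight2; cont.
Qed.

Lemma weights e z : 0 < e -> udisk z ->
  356 / 25 - 2000 * (e / (e + `|z.2|)) <= weight1 z + weight2 e z.
Proof.
move=> e0 zd; rewrite /weight1 /weight2 addrA lerD2r -mulrDl ler_pdivlMr ?besselD_gt0// besselDE;
  last exact: ltW.
have r0 : 0 <= z.1 ^+ 2 + z.2 ^+ 2 by rewrite addr_ge0 ?sqr_ge0.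
by have := bessel_ode r0; lra.
Qed.

Lemma dsq (t q : R) : is_derive t 1 (fun t : R => t ^+ 2 + q) (2 * t).
Proof. by derive_eq => /=; ring. Qed.

Lemma dbessel_sq (q t : R) : is_derive t 1 (fun t => bessel (t ^+ 2 + q)) (bessel1 (t ^+ 2 + q) * (2 * t)).
Proof. exact: (d_comp (dbessel _) (dsq t q)). Qed.

Lemma dbessel1_sq (q t : R) : is_derive t 1 (fun t => bessel1 (t ^+ 2 + q)) (bessel2 (t ^+ 2 + q) * (2 * t)).
Proof. exact: (d_comp (dbessel1 _) (dsq t q)). Qed.

Lemma daffine (u v t : R) : is_derive t 1 (fun t => u + v * t) v.
Proof. by derive_eq; ring. Qed.

Lemma dlinear (v t : R) : is_derive t 1 (fun t => v * t) v.
Proof. by refine (d_eq (dM (@dC _ _ _ _ v) (is_derive_id _ _)) _); ring. Qed.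

Lemma halfchord_le x t : x ^+ 2 < 1 -> - halfchord x <= t <= halfchord x -> x ^+ 2 + t ^+ 2 <= 1.
Proof.
move=> x1; rewrite -ler_norml -ler_sqr ?nnegrE ?sqrtr_ge0//.
by rewrite sqr_sqrtr ?subr_ge0 ?(ltW x1)// real_normK ?num_real// lerBrDl.
Qed.

Lemma odd_slice_x F Fx Fy (y : R) : C1c F Fx Fy -> y ^+ 2 < 1 ->
  J (- halfchord y) (halfchord y) (fun x => weight1 (x, y) * F (x, y) ^+ 2)
  <= J (- halfchord y) (halfchord y) (fun x => Fx (x, y) ^+ 2).
Proof.
move=> [[cF cFx cFy dx dy] s sx sy] y1.
have h0 : - halfchord y <= halfchord y by rewrite ge0_cp ?sqrtr_ge0.
pose q := y ^+ 2.
have E : F (halfchord y, y) = 0 /\ F (- halfchord y, y) = 0.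
  have H : halfchord y ^+ 2 + y ^+ 2 = 1 by rewrite sqr_sqrtr ?subrK// subr_ge0 ltW.
  by split; apply: s; rewrite /udisk /= ?sqrrN H ltxx.
have [E1 E2] := E.
apply: (@picone R _ _ (fun x => F (x, y)) (fun x => Fx (x, y)) (fun x => bessel (x ^+ 2 + q))
  (fun x => bessel1 (x ^+ 2 + q) * (2 * x))
  (fun x => 2 * bessel1 (x ^+ 2 + q) + 4 * x ^+ 2 * bessel2 (x ^+ 2 + q)) (fun x => weight1 (x, y))) => //.
- by move=> t _; exact: d_slice1.
- by move=> t _; exact: dbessel_sq.
- by move=> t _; refine (d_eq (dM (dbessel1_sq _ t) (dlinear _ t)) _); ring.
- exact/Jw/cslice1.
- have cs : continuous (fun x : R => x ^+ 2 + q) by cont.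
  have := ccomp cbessel1 cs; have := ccomp cbessel2 cs => c2 c1.
  by apply: Jw; cont.
- by apply: Jw; exact: (@cslice1 _ _ y cweight1).
- move=> t /(halfchord_le y1); rewrite addrC => ht.
  by apply: lt_le_trans (bessel_ge _); [lra|rewrite ht addr_ge0 ?sqr_ge0].
- move=> t /(halfchord_le y1); rewrite addrC => ht.
  have p0 : 0 < bessel (t ^+ 2 + q) by apply: lt_le_trans (bessel_ge _); [lra|rewrite ht addr_ge0 ?sqr_ge0].
  by rewrite /weight1 besselDE//= !mulNr opprK divfK ?gt_eqF.
- by rewrite E2 expr0n mul0r.
- by rewrite E1 expr0n mul0r.
Qed.

Lemma odd_slice_y F Fx Fy (e x : R) : 0 < e -> C1c F Fx Fy -> F (x, 0) = 0 -> x ^+ 2 < 1 ->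
  J (- halfchord x) (halfchord x) (fun y => weight2 e (x, y) * F (x, y) ^+ 2)
  <= J (- halfchord x) (halfchord x) (fun y => Fy (x, y) ^+ 2).
Proof.
move=> e0 [[cF cFx cFy dx dy] s sx sy] F0 x1.
have h0 : 0 <= halfchord x by rewrite sqrtr_ge0.
have cw : continuous (fun y : R => weight2 e (x, y)) := @cslice2 _ _ x (cweight2 e0).
have cf : continuous (fun y : R => F (x, y)) := @cslice2 _ _ x cF.
have cfy : continuous (fun y : R => Fy (x, y)) := @cslice2 _ _ x cFy.
pose q := x ^+ 2.
have E : F (x, halfchord x) = 0 /\ F (x, - halfchord x) = 0.
  have H : x ^+ 2 + halfchord x ^+ 2 = 1 by rewrite sqr_sqrtr ?subr_ge0 1?ltW// addrC subrK.
  by split; apply: s; rewrite /udisk /= ?sqrrN H ltxx.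
have [E1 E2] := E.
(* The comparison function has a corner on the axis, so the chord is cut at 0 and [sg] is the sign
   of y on each half; [F] vanishes at all three ends, which removes the boundary terms. *)
have half (sg u v : R) : u <= v -> (forall t, u <= t <= v -> sg * t = `|t|) ->
    F (x, u) = 0 -> F (x, v) = 0 -> - halfchord x <= u -> v <= halfchord x -> sg ^+ 2 = 1 ->
    J u v (fun y => weight2 e (x, y) * F (x, y) ^+ 2) <= J u v (fun y => Fy (x, y) ^+ 2).
  move=> uv sgE Fu Fv hu hv sg2.
  have hb t : u <= t <= v -> x ^+ 2 + t ^+ 2 <= 1.
    by move=> /andP[ut tv]; apply: (halfchord_le x1); rewrite (le_trans hu)//= (le_trans tv).
  apply: (@picone R _ _ (fun y => F (x, y)) (fun y => Fy (x, y))
    (fun y => (e + sg * y) * bessel (y ^+ 2 + q))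
    (fun y => sg * bessel (y ^+ 2 + q) + (e + sg * y) * (bessel1 (y ^+ 2 + q) * (2 * y)))
    (fun y => 4 * sg * y * bessel1 (y ^+ 2 + q)
       + (e + sg * y) * (2 * bessel1 (y ^+ 2 + q) + 4 * y ^+ 2 * bessel2 (y ^+ 2 + q)))
    (fun y => weight2 e (x, y))) => //.
  - by move=> t _; exact: d_slice2.
  - by move=> t _; exact: (dM (daffine e sg t) (dbessel_sq q t)).
  - move=> t _.
    refine (d_eq (dD (dM (@dC _ _ _ _ _) (dbessel_sq q t))
      (dM (daffine e sg t) (dM (dbessel1_sq q t) (dlinear 2 t)))) _).
    by ring.
  - exact/Jw.
  - have cs : continuous (fun x : R => x ^+ 2 + q) by cont.
    have := ccomp cbessel1 cs; have := ccomp cbessel2 cs => c2 c1.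
    by apply: Jw; cont.
  - exact: Jw.
  - move=> t /[dup] /sgE -> /hb; rewrite addrC => ht.
    rewrite mulr_gt0//; first by rewrite ltr_pwDl.
    by apply: lt_le_trans (bessel_ge _); [lra|rewrite ht addr_ge0 ?sqr_ge0].
  - move=> t /[dup] tuv /hb ht.
    have tE := sgE _ tuv; have ht' : t ^+ 2 + q <= 1 by rewrite addrC.
    have hr : 0 <= t ^+ 2 + q <= 1 by rewrite ht' addr_ge0 ?sqr_ge0.
    have p0 := bessel_ge hr; have := bessel1_le hr; rewrite ler_norml => /andP[b1 b2].
    rewrite /weight2 besselDE//= (addrC (x ^+ 2)) -/q -tE.
    have d0 : 0 < e + sg * t by rewrite tE ltr_pwDl.
    set p := bessel _ in p0 *; set p1 := bessel1 _ in b1 b2 *; set p2 := bessel2 _.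
    have pp : 0 < p by apply: lt_le_trans p0; rewrite divr_gt0.
    rewrite -subr_ge0.
    have -> : - (- (6 * p1 + 4 * t ^+ 2 * p2) / p - 2000 * (e / (e + sg * t))) * ((e + sg * t) * p) -
       (4 * sg * t * p1 + (e + sg * t) * (2 * p1 + 4 * t ^+ 2 * p2)) = e * (4 * p1 + 2000 * p).
      by field; rewrite !gt_eqF.
    by apply: mulr_ge0; [exact: ltW|clear -p0 b1; lra].
  - by rewrite Fu expr0n mul0r.
  - by rewrite Fv expr0n mul0r.
rewrite !(@J_split _ (- halfchord x) 0 (halfchord x)) ?oppr_le0//; try by apply: Jw; cont.
apply: lerD; [apply: (half (-1))|apply: (half 1)]; rewrite ?oppr_le0 ?sqrrN ?expr1n//.
- by move=> t /andP[_ t0]; rewrite mulN1r ler0_norm.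
- by move=> t /andP[t0 _]; rewrite mul1r ger0_norm.
Qed.

Lemma supported_bounded F : continuous F -> supported F -> exists2 L, 0 <= L & forall z, `|F z| <= L.
Proof.
move=> cF s; have [M MP] := @bounded_on_box R F (-1) 1 (-1) 1 cF.
exists `|M| => // z; have [zd|/s ->] := pselect (udisk z); last by rewrite normr0.
have [/= h1 h2] := udisk_box zd; move: h1 h2 MP; rewrite !in_itv /=; case: z {zd} => u v /= h1 h2 MP.
by rewrite (le_trans (MP _ _ h1 h2))// ler_norm.
Qed.

Lemma odd_Lipschitz F Fx Fy : C1c F Fx Fy -> (forall x, F (x, 0) = 0) ->
  exists2 L, 0 <= L & forall z, F z ^+ 2 <= L * z.2 ^+ 2.
Proof.
move=> [[cF cFx cFy dx dy] s sx sy] F0; have [L L0 LP] := supported_bounded cFy sy.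
exists (L ^+ 2); first exact: sqr_ge0.
move=> [x y] /=; rewrite -exprMn -[leLHS]real_normK ?num_real// -[leRHS]real_normK ?num_real//.
rewrite ler_sqr ?nnegrE// normrM (ger0_norm L0).
have df t : is_derive t 1 (fun y => F (x, y)) (Fy (x, t)) by exact: d_slice2.
have wc (u v : R) : {within `[u, v], continuous (fun y => F (x, y))} by exact/Jw/cslice2.
have [y0|y0] := leP 0 y.
  have [c _ E] := @MVT_segment R (fun y => F (x, y)) (fun y => Fy (x, y)) 0 y y0 (fun t _ => df t) (wc _ _).
  by move: E; rewrite F0 !subr0 => ->; rewrite normrM ler_wpM2r.
have [c _ E] := @MVT_segment R (fun y => F (x, y)) (fun y => Fy (x,
  y)) y 0 (ltW y0) (fun t _ => df t) (wc _ _).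
have -> : F (x, y) = Fy (x, c) * y by move: E; rewrite F0; lra.
by rewrite normrM ler_wpM2r.
Qed.

Lemma I_le_slices_x F G : continuous F -> continuous G ->
  (forall y, y ^+ 2 < 1 ->
    J (- halfchord y) (halfchord y) (fun x => F (x, y)) <=
    J (- halfchord y) (halfchord y) (fun x => G (x, y))) ->
  I F <= I G.
Proof.
move=> cF cG FG; rewrite -(I_swap cF) -(I_swap cG); apply: I_le_slices; try exact: cont_swap.
exact: FG.
Qed.

(** The error weight e / (e + |y|) does not tend to 0 uniformly near the axis, but there F^2 <= L
    y^2; since |y| <= 1 on the disk, the product is at most L e, and [e] can be sent to 0. *)
Lemma odd_lower F Fx Fy : C1c F Fx Fy -> (forall x, F (x, 0) = 0) ->
  356 / 25 * I (fun z => F z ^+ 2) <= I (fun z => Fx z ^+ 2) + I (fun z => Fy z ^+ 2).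
Proof.
move=> C F0; have [[cF cFx cFy dx dy] s sx sy] := C.
have [L L0 LP] := odd_Lipschitz C F0.
have cF2 : continuous (fun z => F z ^+ 2) by cont.
have main e : 0 < e -> 356 / 25 * I (fun z => F z ^+ 2) <=
    I (fun z => Fx z ^+ 2) + I (fun z => Fy z ^+ 2) + 2000 * L * I (fun=> 1) * e.
  move=> e0.
  have cw1 := cweight1; have cw2 := cweight2 e0.
  have h1 : I (fun z => weight1 z * F z ^+ 2) <= I (fun z => Fx z ^+ 2).
    by apply: I_le_slices_x; [cont|cont|move=> y; exact: (odd_slice_x C)].
  have h2 : I (fun z => weight2 e z * F z ^+ 2) <= I (fun z => Fy z ^+ 2).
    by apply: I_le_slices; [cont|cont|move=> x; exact: (odd_slice_y e0 C (F0 x))].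
  have h3 : I (fun z => 356 / 25 * F z ^+ 2 - 2000 * L * e * 1) <=
      I (fun z => weight1 z * F z ^+ 2 + weight2 e z * F z ^+ 2).
    apply: I_le; [by cont|by cont|move=> z zd].
    rewrite -mulrDl mulr1; apply: le_trans (ler_wpM2r (sqr_ge0 _) (weights e0 zd)).
    have d0 : 0 < e + `|z.2| by rewrite ltr_pwDl.
    have [_ /=] := udisk_box zd; rewrite in_itv /= => zb.
    have n1 : `|z.2| <= 1 by rewrite ler_norml.
    have sq : z.2 ^+ 2 <= e + `|z.2|.
      by rewrite -[leLHS]real_normK ?num_real//; have := normr_ge0 z.2; nra.
    have b := le_trans (LP z) (ler_wpM2l L0 sq).
    have : e / (e + `|z.2|) * F z ^+ 2 <= L * e.
      rewrite mulrAC ler_pdivrMr// (le_trans (ler_wpM2l (ltW e0) b))//.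
      by rewrite mulrA (mulrC e).
    set r := e / _; set f2 := F z ^+ 2.
    clear; lra.
  move: h3; rewrite IB; [|by cont|by cont]; rewrite ID; [|by cont|by cont]; rewrite !IZ; [|by cont|by cont].
  lra.
apply/ler_addgt0Pr => e e0.
have I1 : 0 <= I (fun=> 1 : R) by apply: I_ge0.
set K := 2000 * L * I (fun=> 1).
have K0 : 0 <= K by have := mulr_ge0 L0 I1; rewrite /K; clear; lra.
have d0 : 0 < e / (K + 1) by rewrite divr_gt0// ltr_wpDl.
apply: (le_trans (main _ d0)); rewrite lerD2l -/K mulrA ler_pdivrMr ?ltr_wpDl//.
by rewrite mulrC ler_pM2l// lerDl.
Qed.

End odd_eigenvalue.

(** * Limits of the even-even bound along smoothings *)

Section limits.
Context {R : realType}.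
Implicit Types (F G Fx Fy : R * R -> R) (t k : R).

Lemma Rintegral_cvg d (T : measurableType d) (m : {measure set T -> \bar R}) (D : set T)
    (f_ : nat -> T -> R) (f : T -> R) (M : R) : measurable D -> (m D < +oo)%E ->
  (forall n, measurable_fun D (f_ n)) -> m.-integrable D (EFin \o f) ->
  (forall n x, D x -> `|f_ n x| <= M) -> (forall x, D x -> f_ n x @[n --> \oo] --> f x) ->
  \int[m]_(x in D) f_ n x @[n --> \oo] --> \int[m]_(x in D) f x.
Proof.
move=> mD fD mf_ intf fM ff.
have mf : measurable_fun D (EFin \o f) by case/integrableP: intf.
have mE n : measurable_fun D (EFin \o f_ n) by exact/measurable_EFinP.
have cE : forall x, D x -> (EFin \o f_ n) x @[n --> \oo] --> (EFin \o f) x.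
  by move=> x Dx; apply: cvg_EFin; [exact: nearW|exact: ff].
have iM : m.-integrable D (EFin \o cst M).
  by apply: measurable_bounded_integrable => //; exact: bounded_cst.
have bM : {ae m, forall x n, D x -> (`|(EFin \o f_ n) x| <= (EFin \o cst M) x)%E}.
  by apply: aeW => x n Dx /=; rewrite lee_fin; exact: fM.
have [_ _ H] := @dominated_convergence _ _ _ m D mD (fun n => EFin \o f_ n) (EFin \o f)
  (EFin \o cst M) mE mf (aeW _ cE) iM bM.
apply: fine_cvg; rewrite fineK//; exact: integrable_fin_num.
Qed.

Lemma udisk_lty : (lebesgue2 R (udisk : set (measurableTypeR R * measurableTypeR R)) < +oo)%E.
Proof.
have := @I_integrable R (fun=> 1) (@cC _ _ 1).
move=> /integrableP[_]; rewrite (eq_integral (cst 1%E)) ?integral_cst ?mul1e//; first exact: measurable_udisk.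
by move=> z _ /=; rewrite normr1.
Qed.

Lemma I_cvg (F_ : nat -> R * R -> R) F M : (forall n, continuous (F_ n)) -> continuous F ->
  (forall n z, udisk z -> `|F_ n z| <= M) -> (forall z, udisk z -> F_ n z @[n --> \oo] --> F z) ->
  I (F_ n) @[n --> \oo] --> I F.
Proof.
move=> cF_ cF FM FF; apply: (@Rintegral_cvg _ _ _ _ _ _ M) => //.
- exact: measurable_udisk.
- exact: udisk_lty.
- by move=> n; apply: continuous_measurable_prod; [exact: measurable_udisk|].
- exact: I_integrable.
Qed.

Lemma J_cvg (f_ : nat -> R -> R) (f : R -> R) a b M : (forall n, continuous (f_ n)) -> continuous f ->
  (forall n t, a <= t <= b -> `|f_ n t| <= M) ->
  (forall t, a <= t <= b -> f_ n t @[n --> \oo] --> f t) ->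
  J a b (f_ n) @[n --> \oo] --> J a b f.
Proof.
move=> cF_ cF FM FF; apply: (@Rintegral_cvg _ _ _ _ _ _ M) => //.
- have := @lebesgue_measure_itv R `[a, b]; rewrite /= => ->.
  by case: ifP => _; rewrite ?ltry// -EFinD ltry.
- by move=> n; apply: measurable_funTS; exact: continuous_measurable_fun.
- exact/J_integrable/Jw.
Qed.

(** Bounded pointwise convergence of functions and gradients, as dominated convergence requires. The
    evenness of [phi] keeps [even_even] applicable after a multiple of it is subtracted. *)
Definition approximates (phi phix phiy : nat -> R * R -> R) F Fx Fy :=
  [/\ forall n, C1c (phi n) (phix n) (phiy n),
      forall n x y, phi n (- x, y) = phi n (x, y) /\ phi n (x, - y) = phi n (x, y),
      exists M, forall n z, udisk z -> [/\ `|phi n z| <= M, `|phix n z| <= M & `|phiy n z| <= M] &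
      forall z, udisk z -> [/\ phi n z @[n --> \oo] --> F z, phix n z @[n --> \oo] --> Fx z &
                               phiy n z @[n --> \oo] --> Fy z]].

Lemma box_udisk (x y : R) : - (2/3) <= x <= 2/3 -> - (2/3) <= y <= 2/3 -> udisk (x, y).
Proof. by move=> /andP[? ?] /andP[? ?]; rewrite /udisk /=; nra. Qed.

Lemma C1c_lin k F Fx Fy G Gx Gy : C1c F Fx Fy -> C1c G Gx Gy ->
  C1c (fun z => F z - k * G z) (fun z => Fx z - k * Gx z) (fun z => Fy z - k * Gy z).
Proof.
move=> [[cF cFx cFy dx dy] s sx sy] [[cG cGx cGy ex ey] r rx ry].
split; [split|..]; try by cont.
- move=> z; refine (d_eq (dB (dx z) (dM (@dC _ _ _ _ k) (ex z))) _); ring.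
- move=> z; refine (d_eq (dB (dy z) (dM (@dC _ _ _ _ k) (ey z))) _); ring.
- by move=> z nz; rewrite s// r// mulr0 subr0.
- by move=> z nz; rewrite sx// rx// mulr0 subr0.
- by move=> z nz; rewrite sy// ry// mulr0 subr0.
Qed.

Lemma cvg_lin (u v : nat -> R) a b k : u n @[n --> \oo] --> a -> v n @[n --> \oo] --> b ->
  u n - k * v n @[n --> \oo] --> a - k * b.
Proof. by move=> ua vb; apply: cvgB => //; apply: cvgM => //; exact: cvg_cst. Qed.

Lemma box_mean_cvg (F_ : nat -> R * R -> R) F M : (forall n, continuous (F_ n)) -> continuous F ->
  (forall n z, udisk z -> `|F_ n z| <= M) -> (forall z, udisk z -> F_ n z @[n --> \oo] --> F z) ->
  box_mean (F_ n) @[n --> \oo] --> box_mean F.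
Proof.
move=> cF_ cF FM FF; apply: (@J_cvg _ _ _ _ (M * (4 / 3))).
- by move=> n; exact: continuous_J.
- exact: continuous_J.
- move=> n y yb.
  have cs : continuous (fun x => F_ n (x, y)) by exact: cslice1.
  have ab : - (2/3) <= 2/3 :> R by lra.
  have E k : k * (4 / 3) = J (- (2/3)) (2/3) (fun=> k) by rewrite J_cst//; field.
  rewrite ler_norml -mulNr !E; apply/andP; split; apply: J_le; try (by apply: Jw; cont);
    move=> x xb; have := FM n _ (box_udisk xb yb); rewrite ler_norml => /andP[]//.
- move=> y yb; apply: (@J_cvg _ _ _ _ M) => //.
  + by move=> n; exact: cslice1.
  + exact: cslice1.
  + by move=> n x xb; apply: FM; exact: box_udisk.
  + by move=> x xb; apply: FF; exact: box_udisk.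
Qed.

Lemma box_mean_lin F G k : continuous F -> continuous G ->
  box_mean (fun z => F z - k * G z) = box_mean F - k * box_mean G.
Proof.
move=> cF cG; rewrite /box_mean.
have c1 (y : R) : continuous (fun x : R => F (x, y)) by exact: cslice1.
have c2 (y : R) : continuous (fun x : R => G (x, y)) by exact: cslice1.
have d1 := @continuous_J _ F (- (2/3)) (2/3) cF.
have d2 := @continuous_J _ G (- (2/3)) (2/3) cG.
rewrite -JZ; last exact: Jw.
rewrite -JB; [|exact: Jw|by apply: Jw; cont].
apply: eq_J => y _; rewrite -JZ; last exact: Jw.
by rewrite -JB//; [exact: Jw|by apply: Jw; have := c2 y => ?; cont].
Qed.

(* The rank-one corrected inequality even_even survives subtraction of a multiple of the limit of
  the phi_n, although that limit does not vanish with its gradient on the circle. *)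
Lemma even_even_sub phi phix phiy f fx fy v vx vy k :
  approximates phi phix phiy f fx fy -> continuous f -> continuous fx -> continuous fy ->
  C1c v vx vy -> (forall x y, v (- x, y) = v (x, y)) -> (forall x y, v (x, - y) = v (x, y)) ->
  box_mean v = k * box_mean f ->
  441 / 20 * I (fun z => (v z - k * f z) ^+ 2)
   <= I (fun z => (vx z - k * fx z) ^+ 2) + I (fun z => (vy z - k * fy z) ^+ 2).
Proof.
move=> [Cphi ephi [M MP] cphi] cf cfx cfy Cv vex vey bm.
have [[cv cvx cvy dvx dvy] sv svx svy] := Cv.
have [L1 _ L1P] := supported_bounded cv sv.
have [L2 _ L2P] := supported_bounded cvx svx.
have [L3 _ L3P] := supported_bounded cvy svy.
have H n : 441 / 20 * (I (fun z => (v z - k * phi n z) ^+ 2) - 9 / 16 * box_mean (fun z => v z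
  - k * phi n z) ^+ 2)
    <= I (fun z => (vx z - k * phix n z) ^+ 2) + I (fun z => (vy z - k * phiy n z) ^+ 2).
  have C := C1c_lin k Cv (Cphi n); apply: even_even C _ _ => x y.
    by rewrite vex (ephi n x y).1.
  by rewrite vey (ephi n x y).2.
have sqlim (u : R * R -> R) (p_ : nat -> R * R -> R) (p : R * R -> R) (L : R) : continuous u ->
  (forall n, continuous (p_ n)) ->
   continuous p -> (forall z, `|u z| <= L) -> (forall n z, udisk z -> `|p_ n z| <= M) ->
   (forall z, udisk z -> p_ n z @[n --> \oo] --> p z) ->
   I (fun z => (u z - k * p_ n z) ^+ 2) @[n --> \oo] --> I (fun z => (u z - k * p z) ^+ 2).
  move=> cu cp_ cp uL pM pp; apply: (@I_cvg _ _ ((L + `|k| * M) ^+ 2)).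
  - by move=> n; have := cp_ n => ?; cont.
  - by cont.
  - move=> n z zd; rewrite normrX.
    have b : `|u z - k * p_ n z| <= L + `|k| * M.
      by rewrite (le_trans (ler_normB _ _))// lerD// normrM ler_wpM2l// pM.
    by rewrite ler_sqr ?nnegrE ?normr_ge0// (le_trans _ b).
  - by move=> z zd; apply: cvgM; apply: cvg_lin; try exact: cvg_cst; exact: pp.
have cP n : [/\ continuous (phi n), continuous (phix n) & continuous (phiy n)] by have [[]] := Cphi n.
have l1 := sqlim v phi f L1 cv (fun n => let: And3 a _ _ := cP n in a) cf L1P
   (fun n z zd => let: And3 a _ _ := MP n z zd in a) (fun z zd => let: And3 a _ _ := cphi z zd in a).
have l2 := sqlim vx phix fx L2 cvx (fun n => let: And3 _ a _ := cP n in a) cfx L2P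
   (fun n z zd => let: And3 _ a _ := MP n z zd in a) (fun z zd => let: And3 _ a _ := cphi z zd in a).
have l3 := sqlim vy phiy fy L3 cvy (fun n => let: And3 _ _ a := cP n in a) cfy L3P
   (fun n z zd => let: And3 _ _ a := MP n z zd in a) (fun z zd => let: And3 _ _ a := cphi z zd in a).
(* The multiple [k] is chosen to match the means, so the rank-one correction disappears in the
   limit. *)
have l4 : box_mean (fun z => v z - k * phi n z) @[n --> \oo] --> (0 : R).
  rewrite -[0](subrr (box_mean v)) {2}bm.
  rewrite (_ : (fun n => _) = fun n => box_mean v - k * box_mean (phi n)).
    apply: cvg_lin; first exact: cvg_cst.
    apply: (@box_mean_cvg _ _ M) => //.
    + by move=> n; have [] := cP n.
    + by move=> n z zd; have [] := MP n z zd.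
    + by move=> z zd; have [] := cphi z zd.
  by apply/funext => n; rewrite box_mean_lin//; have [] := cP n.
have c1 : 441 / 20 * (I (fun z => (v z - k * phi n z) ^+ 2) - 9 / 16 * box_mean (fun z => v z
  - k * phi n z) ^+ 2) @[n --> \oo]
   --> 441 / 20 * (I (fun z => (v z - k * f z) ^+ 2) - 9 / 16 * (0 * 0)).
  by apply: cvgM; [exact: cvg_cst|apply: cvg_lin => //; exact: cvgM].
have c2 : I (fun z => (vx z - k * phix n z) ^+ 2) + I (fun z => (vy z - k * phiy n z) ^+ 2) @[n --> \oo]
   --> I (fun z => (vx z - k * fx z) ^+ 2) + I (fun z => (vy z - k * fy z) ^+ 2).
  exact: cvgD l2 l3.
rewrite mulr0 mulr0 subr0 in c1.
have Hle := ler_cvg_to c1 c2.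
by apply: Hle; apply: nearW => n; exact: H.
Qed.

End limits.

(** * Moments of the disk and the profile f0 *)

Section disk_moments.
Context {R : realType}.
Implicit Types (F G Fx Fy : R * R -> R).

Definition rho (z : R * R) : R := 1 - z.1 ^+ 2 - z.2 ^+ 2.

Lemma crho : continuous rho. Proof. by rewrite /rho; cont. Qed.

Lemma drho1 z : is_derive z ((1, 0) : R * R) rho (- (2 * z.1)).
Proof. by rewrite /rho; derive_eq; rewrite /=; ring. Qed.

Lemma drho2 z : is_derive z ((0, 1) : R * R) rho (- (2 * z.2)).
Proof. by rewrite /rho; derive_eq; rewrite /=; ring. Qed.

Lemma rho_circle z : z.1 ^+ 2 + z.2 ^+ 2 = 1 -> rho z = 0.
Proof. by rewrite /rho => <-; ring. Qed.

Definition moment (i j k : nat) : R := I (fun z => z.1 ^+ i * z.2 ^+ j * rho z ^+ k).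

Lemma moment_swap i j k : moment i j k = moment j i k.
Proof.
have c := crho; rewrite /moment -(I_swap (F := fun z => z.1 ^+ i * z.2 ^+ j * rho z ^+ k)); last by cont.
have rs z : rho (z.2, z.1) = rho z by rewrite /rho /=; ring.
by apply: eq_I => z _; rewrite rs /= [z.2 ^+ i * _]mulrC.
Qed.

(* The divergence theorem applied to x^(i+1) y^j rho^(k+1), which vanishes on the circle. *)
Lemma moment_rec i j k :
  i.+1%:R * moment i j k.+1 = 2 * k.+1%:R * moment i.+2 j k.
Proof.
have c := crho; apply/eqP; rewrite -subr_eq0; apply/eqP.
rewrite /moment -!IZ; [|by cont|by cont].
rewrite -IB; [|by cont|by cont].
apply: (@I_dx0 _ (fun z => z.1 ^+ i.+1 * z.2 ^+ j * rho z ^+ k.+1)).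
- by cont.
- move=> z.
  refine (d_eq (dM (dM (dX i.+1 (dfst z (1, 0))) (dX j (dsnd z (1, 0)))) (dX k.+1 (drho1 z))) _).
  by rewrite /= !exprS; ring.
- by move=> z /rho_circle ->; rewrite expr0n mulr0.
Qed.

Lemma moment_rho i j k : moment i j k.+1 = moment i j k - moment i.+2 j k - moment i j.+2 k.
Proof.
have c := crho; rewrite /moment -IB; [|by cont|by cont]; rewrite -IB; [|by cont|by cont].
by apply: eq_I => z _; rewrite !exprS /rho; ring.
Qed.

(** Expanding one factor [rho] and integrating by parts give two linear relations between
    [moment 0 0 k.+1], [moment 0 0 k] and [moment 2 0 k]. They determine all moments as multiples of
    the area [m], which never needs to be evaluated. *)
Lemma moments : let m := moment 0 0 0 in
  [/\ moment 0 0 1 = m / 2, moment 0 0 2 = m / 3, moment 0 0 3 = m / 4 & moment 0 0 4 = m / 5] /\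
  [/\ moment 2 0 0 = m / 4, moment 2 0 1 = m / 12, moment 2 0 2 = m / 24,
      moment 4 0 0 = m / 8 & moment 2 2 0 = m / 24].
Proof.
move=> m.
have step k : moment 0 0 k.+1 = moment 0 0 k - 2 * moment 2 0 k by rewrite moment_rho (moment_swap 0 2); ring.
have byparts k : moment 0 0 k.+1 = 2 * k.+1%:R * moment 2 0 k by rewrite -moment_rec mul1r.
have h1 : moment 0 0 1 = m / 2 by have := step 0%N; have := byparts 0%N; rewrite -/m; lra.
have h2 : moment 0 0 2 = m / 3 by have := step 1%N; have := byparts 1%N; lra.
have h3 : moment 0 0 3 = m / 4 by have := step 2; have := byparts 2; lra.
have h4 : moment 0 0 4 = m / 5 by have := step 3; have := byparts 3; lra.
have x0 : moment 2 0 0 = m / 4 by have := byparts 0%N; lra.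
have x1 : moment 2 0 1 = m / 12 by have := byparts 1%N; lra.
have x2 : moment 2 0 2 = m / 24 by have := byparts 2; lra.
have x4 : moment 4 0 0 = m / 8 by have := moment_rec 2 0 0; lra.
have y1 : moment 0 2 1 = m / 12 by rewrite moment_swap.
have xy : moment 2 2 0 = m / 24 by have := moment_rec 0 2 0; lra.
by split.
Qed.

Lemma moment0_ge0 : 0 <= moment 0 0 0.
Proof. by apply: I_ge0 => z _; rewrite !expr0 !mulr1. Qed.

(** One step of inverse iteration: f0 vanishes on the circle and its Laplacian is -8 rho, where rho
    is a multiple of the torsion function. This brings the Dirichlet quotient to 5.789..., against
    5.783... for the ground state. *)
Definition f0 (z : R * R) : R := rho z + rho z ^+ 2 / 2.
Definition f0x (z : R * R) : R := - (2 * z.1 * (1 + rho z)).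
Definition f0y (z : R * R) : R := - (2 * z.2 * (1 + rho z)).
Definition f0xx (z : R * R) : R := 4 * z.1 ^+ 2 - 2 * (1 + rho z).
Definition f0yy (z : R * R) : R := 4 * z.2 ^+ 2 - 2 * (1 + rho z).
Definition f0xy (z : R * R) : R := 4 * z.1 * z.2.

Lemma cf0 : [/\ continuous f0, continuous f0x & continuous f0y].
Proof. by have c := crho; split; rewrite /f0 /f0x /f0y; cont. Qed.

Lemma cf02 : [/\ continuous f0xx, continuous f0yy & continuous f0xy].
Proof. by have c := crho; split; rewrite /f0xx /f0yy /f0xy; cont. Qed.

Lemma df0xx z : is_derive z ((1, 0) : R * R) f0x (f0xx z).
Proof.
refine (d_eq (dN (dM (dM (@dC _ _ _ _ _) (dfst _ _)) (dD (@dC _ _ _ _ _) (drho1 z)))) _).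
by rewrite /f0xx /=; ring.
Qed.

Lemma df0xy z : is_derive z ((0, 1) : R * R) f0x (f0xy z).
Proof.
refine (d_eq (dN (dM (dM (@dC _ _ _ _ _) (dfst _ _)) (dD (@dC _ _ _ _ _) (drho2 z)))) _).
by rewrite /f0xy /=; ring.
Qed.

Lemma df0yy z : is_derive z ((0, 1) : R * R) f0y (f0yy z).
Proof.
refine (d_eq (dN (dM (dM (@dC _ _ _ _ _) (dsnd _ _)) (dD (@dC _ _ _ _ _) (drho2 z)))) _).
by rewrite /f0yy /=; ring.
Qed.

Ltac ilin := repeat first [rewrite IZ; [|by cont] | rewrite ID; [|by cont|by cont]].

Lemma f0_moments : let m := moment 0 0 0 in
  [/\ I (fun z => f0 z ^+ 2) = 19 / 30 * m, I (fun z => f0x z ^+ 2) = 11 / 6 * m,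
      I (fun z => f0y z ^+ 2) = 11 / 6 * m & I (fun z => f0xy z ^+ 2) = 2 / 3 * m].
Proof.
move=> m; have [[h1 h2 h3 h4] [x0 x1 x2 x4 xy]] := moments.
have c := crho.
split.
- rewrite (@eq_I _ _ (fun z => (z.1 ^+ 0 * z.2 ^+ 0 * rho z ^+ 2) + (z.1 ^+ 0 * z.2 ^+ 0 * rho z ^+ 3)
     + (1 / 4) * (z.1 ^+ 0 * z.2 ^+ 0 * rho z ^+ 4))); last by move=> z _; rewrite /f0; field.
  by ilin; rewrite -!/(moment _ _ _) h2 h3 h4 /m; field.
- rewrite (@eq_I _ _ (fun z => 4 * (z.1 ^+ 2 * z.2 ^+ 0 * rho z ^+ 0) + 8 * (z.1 ^+ 2 * z.2 ^+ 0 * rho z ^+ 1)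
     + 4 * (z.1 ^+ 2 * z.2 ^+ 0 * rho z ^+ 2))); last by move=> z _; rewrite /f0x; ring.
  by ilin; rewrite -!/(moment _ _ _) x0 x1 x2 /m; field.
- rewrite (@eq_I _ _ (fun z => 4 * (z.1 ^+ 0 * z.2 ^+ 2 * rho z ^+ 0) + 8 * (z.1 ^+ 0 * z.2 ^+ 2 * rho z ^+ 1)
     + 4 * (z.1 ^+ 0 * z.2 ^+ 2 * rho z ^+ 2))); last by move=> z _; rewrite /f0y; ring.
  by ilin; rewrite -!/(moment _ _ _) !(moment_swap 0 2) x0 x1 x2 /m; field.
- rewrite (@eq_I _ _ (fun z => 16 * (z.1 ^+ 2 * z.2 ^+ 2 * rho z ^+ 0))); last by move=> z _;
  rewrite /f0xy; ring.
  by ilin; rewrite -!/(moment _ _ _) xy /m; field.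
Qed.

Lemma quadratic_moment (r0 r1 r2 r3 : R) : let m := moment 0 0 0 in
  I (fun z => (r0 + r1 * rho z + r2 * rho z ^+ 2 + r3 * z.1 ^+ 2) ^+ 2) =
  m * (r0 ^+ 2 + r1 ^+ 2 / 3 + r2 ^+ 2 / 5 + r3 ^+ 2 / 8 + r0 * r1 + 2 * r0 * r2 / 3 + r1 * r2 / 2
       + 2 * r3 * (r0 / 4 + r1 / 12 + r2 / 24)).
Proof.
move=> m; have [[h1 h2 h3 h4] [x0 x1 x2 x4 xy]] := moments.
have c := crho.
have cm i j k : continuous (fun z : R * R => z.1 ^+ i * z.2 ^+ j * rho z ^+ k) by cont.
(* Peels off one monomial and passes continuity on, so that nine monomials can be integrated without
   reproving continuity of the partial sums. *)
have lin (a : R) i j k F : continuous F ->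
    continuous (fun z : R * R => a * (z.1 ^+ i * z.2 ^+ j * rho z ^+ k) + F z) /\
    I (fun z => a * (z.1 ^+ i * z.2 ^+ j * rho z ^+ k) + F z) = a * moment i j k + I F.
  move=> cF; have ca : continuous (fun z : R * R => a * (z.1 ^+ i * z.2 ^+ j * rho z ^+ k)).
    by cont.
  by split; [cont|rewrite ID// IZ//].
have [k0 e0] := lin (r0 ^+ 2) 0%N 0%N 0%N (fun=> 0) (@cC _ _ 0).
have [k1 e1] := lin (2 * r0 * r1) 0%N 0%N 1%N _ k0.
have [k2 e2] := lin (r1 ^+ 2 + 2 * r0 * r2) 0%N 0%N 2%N _ k1.
have [k3 e3] := lin (2 * r1 * r2) 0%N 0%N 3%N _ k2.
have [k4 e4] := lin (r2 ^+ 2) 0%N 0%N 4%N _ k3.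
have [k5 e5] := lin (2 * r3 * r0) 2%N 0%N 0%N _ k4.
have [k6 e6] := lin (2 * r3 * r1) 2%N 0%N 1%N _ k5.
have [k7 e7] := lin (2 * r3 * r2) 2%N 0%N 2%N _ k6.
have [k8 e8] := lin (r3 ^+ 2) 4%N 0%N 0%N _ k7.
have I0 : I (fun _ : R * R => 0 : R) = 0.
  rewrite (@eq_I _ _ (fun z : R * R => 0 * rho z)); last by move=> z _; rewrite mul0r.
  by rewrite IZ// mul0r.
transitivity (I (fun z => r3 ^+ 2 * (z.1 ^+ 4 * z.2 ^+ 0 * rho z ^+ 0)
  + (2 * r3 * r2 * (z.1 ^+ 2 * z.2 ^+ 0 * rho z ^+ 2) + (2 * r3 * r1 * (z.1 ^+ 2 * z.2 ^+ 0 * rho z ^+ 1)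
 + (2 * r3 * r0 * (z.1 ^+ 2 * z.2 ^+ 0 * rho z ^+ 0) + (r2 ^+ 2 * (z.1 ^+ 0 * z.2 ^+ 0 * rho z ^+ 4)
   + (2 * r1 * r2 * (z.1 ^+ 0 * z.2 ^+ 0 * rho z ^+ 3)
 + ((r1 ^+ 2 + 2 * r0 * r2) * (z.1 ^+ 0 * z.2 ^+ 0 * rho z ^+ 2)
   + (2 * r0 * r1 * (z.1 ^+ 0 * z.2 ^+ 0 * rho z ^+ 1) + (r0 ^+ 2 * (z.1 ^+ 0 * z.2 ^+ 0 * rho z ^+ 0)
     + 0)))))))))).
  by apply: eq_I => z _; move: (rho z) => w; ring.
rewrite e8 e7 e6 e5 e4 e3 e2 e1 e0 I0 h1 h2 h3 h4 x0 x1 x2 x4 -/m.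
by move: m; clear => m; field.
Qed.

Lemma box_mean_f0 : 0 < box_mean f0.
Proof.
have [c _ _] := cf0.
have ab : - (2/3) <= 2/3 :> R by lra.
have h y : - (2/3) <= y <= 2/3 -> 4 / 27 <= J (- (2/3)) (2/3) (fun x => f0 (x, y)).
  move=> yb; rewrite (_ : 4 / 27 = J (- (2/3)) (2/3) (fun=> 1 / 9)); last by rewrite J_cst//; field.
  apply: J_le; [by apply: Jw; cont|by apply: Jw; exact: cslice1|move=> x xb].
  rewrite /f0; have r : 1 / 9 <= rho (x, y) by move: xb yb => /andP[? ?] /andP[? ?]; rewrite /rho /=; nra.
  by have := sqr_ge0 (rho (x, y)); lra.
apply: (@lt_le_trans _ _ (J (- (2/3)) (2/3) (fun=> 4 / 27))).
  by rewrite J_cst//; lra.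
by apply: J_le; [by apply: Jw; cont|by apply: Jw; exact: continuous_J|exact: h].
Qed.

(** The mean of the square of [residual s] over the disk, by [quadratic_moment]; [r0], ..., [r3] are
    its coefficients. *)
Definition residual_square (s : R) : R :=
  let r0 := - 4 * (s - 1) in let r1 := 361 / 20 - 4 * s in let r2 := 441 / 40 in let r3 := 8 * (s - 1) in
  r0 ^+ 2 + r1 ^+ 2 / 3 + r2 ^+ 2 / 5 + r3 ^+ 2 / 8 + r0 * r1 + 2 * r0 * r2 / 3 + r1 * r2 / 2
       + 2 * r3 * (r0 / 4 + r1 / 12 + r2 / 24).

(* The polynomial is positive by the positivity of its Bernstein coefficients. *)
Lemma final_polynomial (s : R) : 23 / 20 <= s <= 49 / 20 ->
  0 <= ((441 / 20 * 19 / 30 - 11 / 3) * (s + 1) - 22 / 3 * (s - 1)) * (441 / 20 - 29 / 5 * s) * (98 / 5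
    - 29 / 5 * s)
   - (s + 1) * (98 / 5 - 29 / 5 * s) * residual_square s
   - (s + 1) * (441 / 20 - 29 / 5 * s) * (2 * (s - 1)) ^+ 2 * (2 / 3).
Proof.
move=> /andP[s1 s2]; rewrite /residual_square.
have u0 : 0 <= s - 23 / 20 by rewrite subr_ge0.
have v0 : 0 <= 49 / 20 - s by rewrite subr_ge0.
have p i j := mulr_ge0 (exprn_ge0 i u0) (exprn_ge0 j v0).
have := p 0%N 4; have := p 1%N 3; have := p 2 2; have := p 3 1%N; have := p 4 0%N.
clear; lra.
Qed.

End disk_moments.

(** * Pairs coupled through the divergence *)

Section class_A.
Context {R : realType}.
Implicit Types (F G Fx Fy : R * R -> R).

Lemma I_sqrB F G k : continuous F -> continuous G ->
  I (fun z => (F z - k * G z) ^+ 2) =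
  I (fun z => F z ^+ 2) - 2 * k * I (fun z => F z * G z) + k ^+ 2 * I (fun z => G z ^+ 2).
Proof.
move=> cF cG; rewrite -!IZ; [|by cont|by cont].
rewrite -IB; [|by cont|by cont]; rewrite -ID; [|by cont|by cont].
by apply: eq_I => z _; ring.
Qed.

Lemma I_parts_x F F' G G' : continuous F -> continuous F' -> continuous G -> continuous G' ->
  (forall z, is_derive z ((1, 0) : R * R) F (F' z)) -> (forall z, is_derive z ((1, 0) : R * R) G (G' z)) ->
  supported F -> I (fun z => F' z * G z) = - I (fun z => F z * G' z).
Proof.
move=> cF cF' cG cG' dF dG s; apply/eqP; rewrite -addr_eq0; apply/eqP.
rewrite -ID; [|by cont|by cont]; apply: (@I_dx0 _ (fun z => F z * G z)); first by cont.
  by move=> z; refine (d_eq (dM (dF z) (dG z)) _); ring.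
by move=> z z1; rewrite s ?mul0r// /udisk /= z1 ltxx.
Qed.

Lemma I_parts_y F F' G G' : continuous F -> continuous F' -> continuous G -> continuous G' ->
  (forall z, is_derive z ((0, 1) : R * R) F (F' z)) -> (forall z, is_derive z ((0, 1) : R * R) G (G' z)) ->
  supported F -> I (fun z => F' z * G z) = - I (fun z => F z * G' z).
Proof.
move=> cF cF' cG cG' dF dG s; apply/eqP; rewrite -addr_eq0; apply/eqP.
rewrite -ID; [|by cont|by cont]; apply: (@I_dy0 _ (fun z => F z * G z)); first by cont.
  by move=> z; refine (d_eq (dM (dF z) (dG z)) _); ring.
by move=> z z1; rewrite s ?mul0r// /udisk /= z1 ltxx.
Qed.

(** Collects everything that multiplies -2 c v once c f0 is subtracted from v and the derivatives of
    v are moved onto f0: the Laplacian of f0, the term 441/20 f0, and 2 (s - 1) f0xx from the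
    divergence. In this form z.2 is eliminated, so its square reduces to the moments above. *)
Definition residual (s : R) (z : R * R) : R :=
  - 4 * (s - 1) + (361 / 20 - 4 * s) * rho z + 441 / 40 * rho z ^+ 2 + 8 * (s - 1) * z.1 ^+ 2.

Lemma residualE s z : residual s z =
  f0xx z + f0yy z + 441 / 20 * f0 z + 2 * (s - 1) * f0xx z.
Proof.
rewrite /residual /f0xx /f0yy /f0.
have -> : z.2 ^+ 2 = 1 - z.1 ^+ 2 - rho z by rewrite /rho; ring.
by move: (rho z) => w; field.
Qed.

(* V, W, Gvx, ..., D stand for the integrals of v^2, w^2, vx^2, ..., (vx + wy)^2
   in class_A, and P, Q1, Q2, S for those of v f0, v f0xx, v f0yy, w f0xy. *)
Lemma class_A_algebra (s c m V W Gvx Gvy Gwx Gwy D P Q1 Q2 S : R) :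
  let K := 29 / 5 * s in let M1 := 441 / 20 in let M2 := 98 / 5 in let A := 2 * (s - 1) in
  let t := 2 / (s + 1) in
  23 / 20 <= s <= 49 / 20 -> 0 <= m ->
  M1 * (V - 2 * c * P + c ^+ 2 * (19 / 30 * m)) <=
    (Gvx - 2 * c * (- Q1) + c ^+ 2 * (11 / 6 * m)) + (Gvy - 2 * c * (- Q2) + c ^+ 2 * (11 / 6 * m)) ->
  M2 * W <= Gwx + Gwy ->
  0 <= D - 2 * (c * t) * (- Q1 - S) + (c * t) ^+ 2 * (11 / 6 * m) ->
  0 <= (M1 - K) ^+ 2 * V - 2 * c * ((M1 - K) * (Q1 + Q2 + M1 * P + A * Q1))
    + c ^+ 2 * (m * residual_square s) ->
  0 <= (M2 - K) ^+ 2 * W - 2 * (A * c) * ((M2 - K) * S) + (A * c) ^+ 2 * (2 / 3 * m) ->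
  K * (V + W) <= Gvx + Gvy + Gwx + Gwy + (s ^+ 2 - 1) * D.
Proof.
move=> K M1 M2 A t sb m0 h1 h2 h3 h5 h6.
have [s1 s2] := andP sb.
have p := final_polynomial sb.
have sp : 0 < s + 1 by lra.
have sp0 : s + 1 != 0 by apply: lt0r_neq0; lra.
have p1 : 0 < M1 - K by rewrite /M1 /K; lra.
have p2 : 0 < M2 - K by rewrite /M2 /K; lra.
have n1 := lt0r_neq0 p1; have n2 := lt0r_neq0 p2.
(* A completed square divided by [M1 - K]: it absorbs the part of the form that is quadratic and
   linear in v at the price of a multiple of c^2. The next inequality does the same for w. *)
have h5' : 0 <= (M1 - K) * V - 2 * c * (Q1 + Q2 + M1 * P + A * Q1)
  + c ^+ 2 * m * (residual_square s / (M1 - K)).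
  rewrite -(pmulr_rge0 _ p1).
  move: h5; congr (0 <= _); field; exact: n1.
have h6' : 0 <= (M2 - K) * W - 2 * A * c * S + (A * c) ^+ 2 * (2 / 3 * m) / (M2 - K).
  rewrite -(pmulr_rge0 _ p2).
  move: h6; congr (0 <= _); field; exact: n2.
(* With [t = 2 / (s + 1)] the product [(s ^+ 2 - 1) * t] is the polynomial [A = 2 * (s - 1)]. *)
have h3' : 0 <= (s ^+ 2 - 1) * D - 2 * c * A * (- Q1 - S) + c ^+ 2 * m * (4 * (s - 1) / (s + 1) * (11 / 6)).
  have a0 : 0 <= s ^+ 2 - 1 by nra.
  have := mulr_ge0 a0 h3; congr (0 <= _); rewrite /t /A; field; exact: sp0.
have cm : 0 <= c ^+ 2 * m by rewrite mulr_ge0// sqr_ge0.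
(* The coefficient of [c ^+ 2 * m] left after all squares are completed; multiplied by its positive
   denominators it is the expression of [final_polynomial]. *)
pose N := 441 / 20 * 19 / 30 - 11 / 3 - 4 * (s - 1) / (s + 1) * (11 / 6) - residual_square s / (M1 - K)
  - A ^+ 2 * (2 / 3) / (M2 - K).
have N0 : 0 <= N.
  have q : 0 < (s + 1) * (M1 - K) * (M2 - K) by rewrite !mulr_gt0//; lra.
  rewrite -(pmulr_rge0 _ q).
  move: p; congr (0 <= _); rewrite /N /A -/M1 -/M2 -/K.
  by move: n1 n2 sp0; clear; move: (residual_square s) K => Z K n1 n2 sp0; field; rewrite n1 n2 sp0.
have := mulr_ge0 cm N0.
have -> : c ^+ 2 * m * N = c ^+ 2 * m * (441 / 20 * 19 / 30 - 11 / 3) - c ^+ 2 * m * (4 * (s - 1) / (s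
  + 1) * (11 / 6))
  - c ^+ 2 * m * (residual_square s / (M1 - K)) - (A * c) ^+ 2 * (2 / 3 * m) / (M2 - K) by rewrite /N;
    field; rewrite ?n1 ?n2 ?sp0.
move: h1 h2 h3' h5' h6'.
move: (c ^+ 2 * m * (4 * (s - 1) / (s + 1) * (11 / 6))) (c ^+ 2 * m * (residual_square s / (M1
  - K))) ((A * c) ^+ 2 * (2 / 3 * m) / (M2 - K)).
move: (residual_square s) => Z.
rewrite /M1 /M2; clear; move: K A => K A x1 x2 x3; lra.
Qed.

(** The form on (v, w) is bounded below by a diagonal one plus terms linear in v and w with factor
    c: the gradient of v is treated after subtraction of c f0, the square of the divergence by its
    tangent at a multiple of f0x. Integration by parts puts the linear terms on v and w themselves,
    and completing squares leaves the inequality to [class_A_algebra]. *)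
Lemma class_A (phi phix phiy : nat -> R * R -> R) v vx vy w wx wy (s : R) :
  approximates phi phix phiy f0 f0x f0y ->
  C1c v vx vy -> (forall x y, v (- x, y) = v (x, y)) -> (forall x y, v (x, - y) = v (x, y)) ->
  C1c w wx wy -> (forall x, w (x, 0) = 0) -> (forall y, w (0, y) = 0) ->
  23 / 20 <= s <= 49 / 20 ->
  29 / 5 * s * (I (fun z => v z ^+ 2) + I (fun z => w z ^+ 2)) <=
  I (fun z => vx z ^+ 2) + I (fun z => vy z ^+ 2) + I (fun z => wx z ^+ 2) + I (fun z => wy z ^+ 2)
  + (s ^+ 2 - 1) * I (fun z => (vx z + wy z) ^+ 2).
Proof.
move=> ap Cv v1 v2 Cw w1 w2 sb.
have [cf cfx cfy] := @cf0 R; have [cfxx cfyy cfxy] := @cf02 R; have cr := @crho R.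
have [[cv cvx cvy dvx dvy] sv svx svy] := Cv.
have [[cw cwx cwy dwx dwy] sw swx swy] := Cw.
have [mf mfx mfy mfxy] := @f0_moments R.
set c := box_mean v / box_mean f0.
have hc : box_mean v = c * box_mean f0 by rewrite /c mulfVK// lt0r_neq0// box_mean_f0.
have h1 := even_even_sub ap cf cfx cfy Cv v1 v2 hc.
have h2 := odd_odd Cw w1 w2.
(* Derivatives of f0 do not vanish on the circle; the boundary terms disappear because v and w
   do. *)
have P1 : I (fun z => vx z * f0x z) = - I (fun z => v z * f0xx z).
  by apply: I_parts_x => //; exact: df0xx.
have P2 : I (fun z => vy z * f0y z) = - I (fun z => v z * f0yy z).
  by apply: I_parts_y => //; exact: df0yy.
have P3 : I (fun z => wy z * f0x z) = - I (fun z => w z * f0xy z).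
  by apply: I_parts_y => //; exact: df0xy.
have cR : continuous (residual s) by rewrite /residual; cont.
have PR : I (fun z => v z * residual s z) = I (fun z => v z * f0xx z) + I (fun z => v z * f0yy z)
   + 441 / 20 * I (fun z => v z * f0 z) + 2 * (s - 1) * I (fun z => v z * f0xx z).
  rewrite -!IZ; [|by cont|by cont].
  rewrite -ID; [|by cont|by cont]; rewrite -ID; [|by cont|by cont]; rewrite -ID; [|by cont|by cont].
  by apply: eq_I => z _; rewrite residualE; ring.
rewrite I_sqrB// I_sqrB// I_sqrB// mf mfx mfy P1 P2 in h1.
have cd : continuous (fun z => vx z + wy z) by cont.
have h3 : 0 <= I (fun z => (vx z + wy z - c * (2 / (s + 1)) * f0x z) ^+ 2) by apply: I_ge0 => z _;
  exact: sqr_ge0.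
rewrite I_sqrB// mfx in h3.
have P4 : I (fun z => (vx z + wy z) * f0x z) = - I (fun z => v z * f0xx z) - I (fun z => w z * f0xy z).
  rewrite -P1 -P3 -ID; [|by cont|by cont].
  by apply: eq_I => z _; ring.
rewrite P4 in h3.
(* The optimal v for given [c] is a multiple of [residual s], and the optimal w below a multiple of
   [f0xy]; these squares measure the distance to them. *)
have h5 : 0 <= I (fun z => ((441 / 20 - 29 / 5 * s) * v z - c * residual s z) ^+ 2)
  by apply: I_ge0 => z _; exact: sqr_ge0.
rewrite I_sqrB// in h5; last by cont.
have h6 : 0 <= I (fun z => ((98 / 5 - 29 / 5 * s) * w z - (2 * (s - 1) * c) * f0xy z) ^+ 2)
  by apply: I_ge0 => z _; exact: sqr_ge0.
rewrite I_sqrB// in h6; last by cont.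
rewrite mfxy in h6.
have sq k F : continuous F -> I (fun z => (k * F z) ^+ 2) = k ^+ 2 * I (fun z => F z ^+ 2).
  by move=> cF; rewrite -IZ; [apply: eq_I => z _; ring|cont].
have ml k F G : continuous F -> continuous G -> I (fun z => k * F z * G z) = k * I (fun z => F z * G z).
  by move=> cF cG; rewrite -IZ; [apply: eq_I => z _; ring|cont].
rewrite !sq// !ml// in h5 h6; rewrite PR in h5.
have mR : I (fun z => residual s z ^+ 2) = moment 0 0 0 * residual_square s by exact: quadratic_moment.
rewrite mR in h5.
exact: class_A_algebra sb (@moment0_ge0 R) h1 h2 h3 h5 h6.
Qed.

End class_A.

(** * Lower bound on the unit disk *)

Section affine_maps.
Context {R : realType}.
Implicit Types (F G : R * R -> R) (c z : R * R) (a b l : R).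

Lemma d_unslice1 F (x y l : R) : is_derive x 1 (fun t : R => F (t, y)) l ->
  is_derive (x, y) ((1, 0) : R * R) F l.
Proof.
have E : (fun h : R => h^-1 *: (F (h *: (1 : R) + x, y) - F (x, y))) =
  (fun h : R => h^-1 *: (F (h *: ((1, 0) : R * R) + (x, y)) - F (x, y))).
  apply/funext => h; congr (_ *: (F _ - _)).
  by rewrite -[RHS]/(h * _ + x, h * _ + y) /= mulr0 ?add0r.
by move=> [d dE]; split; [rewrite /derivable -E|rewrite /derive -E].
Qed.

Lemma d_unslice2 F (x y l : R) : is_derive y 1 (fun t : R => F (x, t)) l ->
  is_derive (x, y) ((0, 1) : R * R) F l.
Proof.
have E : (fun h : R => h^-1 *: (F (x, h *: (1 : R) + y) - F (x, y))) =
  (fun h : R => h^-1 *: (F (h *: ((0, 1) : R * R) + (x, y)) - F (x, y))).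
  apply/funext => h; congr (_ *: (F _ - _)).
  by rewrite -[RHS]/(h * _ + x, h * _ + y) /= mulr0 ?add0r.
by move=> [d dE]; split; [rewrite /derivable -E|rewrite /derive -E].
Qed.

Lemma d_aff1 c a b F z l : is_derive (aff c a b z) ((1, 0) : R * R) F l ->
  is_derive z ((1, 0) : R * R) (F \o aff c a b) (a * l).
Proof.
case: z => x y /d_slice1 /= dF; apply: d_unslice1.
by apply: (d_eq (@d_comp _ _ (fun t => F (t, c.2 + b * y)) (fun t => c.1
  + a * t) x 1 a l dF (daffine _ _ _))); rewrite mulrC.
Qed.

Lemma d_aff2 c a b F z l : is_derive (aff c a b z) ((0, 1) : R * R) F l ->
  is_derive z ((0, 1) : R * R) (F \o aff c a b) (b * l).
Proof.
case: z => x y /d_slice2 /= dF; apply: d_unslice2.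
by apply: (d_eq (@d_comp _ _ (fun t => F (c.1 + a * x, t)) (fun t => c.2
  + b * t) y 1 b l dF (daffine _ _ _))); rewrite mulrC.
Qed.

Lemma caff c a b : continuous (aff c a b).
Proof.
move=> z; have c1 : continuous (fun z : R * R => c.1 + a * z.1) by cont.
have c2 : continuous (fun z : R * R => c.2 + b * z.2) by cont.
by apply: (@cvg_pair _ _ _ _ (nbhs _) (nbhs _) _ _ _ (fun z => c.1 + a * z.1) (fun z => c.2 + b * z.2));
  [exact: c1|exact: c2].
Qed.

Lemma caff_comp c a b F : continuous F -> continuous (F \o aff c a b).
Proof. by move=> cF z; apply: continuous_comp; [exact: caff|exact: cF]. Qed.

Lemma aff_reflx z : aff (0, 0) (-1) 1 z = (- z.1, z.2).
Proof. by rewrite /aff /= !add0r mulN1r mul1r. Qed.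

Lemma aff_refly z : aff (0, 0) 1 (-1) z = (z.1, - z.2).
Proof. by rewrite /aff /= !add0r mulN1r mul1r. Qed.

End affine_maps.

Ltac gen_I := repeat match goal with |- context [I ?f] => generalize (I f) end; intros.

(** * Decomposition of both components by parity *)

Section parity.
Context {R : realType}.
Implicit Types (F G Fx Fy : R * R -> R) (b : bool).

Lemma C1c_reflx F Fx Fy : C1c F Fx Fy ->
  C1c (fun z => F (- z.1, z.2)) (fun z => - Fx (- z.1, z.2)) (fun z => Fy (- z.1, z.2)).
Proof.
move=> [[cF cFx cFy dx dy] s sx sy].
have E G : (fun z => G (- z.1, z.2)) = G \o aff (0, 0) (-1) 1.
  by apply/funext => z; rewrite /comp aff_reflx.
have cc G : continuous G -> continuous (fun z => G (- z.1, z.2)) by rewrite E; exact: caff_comp.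
have ss G : supported G -> supported (fun z => G (- z.1, z.2)).
  by move=> sG z nz; apply: sG; rewrite /udisk /= sqrrN.
split; [split|exact: ss|by move=> z nz; rewrite (ss _ sx)// oppr0|exact: ss].
- exact: cc.
- by apply: cN; exact: cc.
- exact: cc.
- by move=> z; rewrite E; have := d_aff1 (dx (aff (0, 0) (-1) 1 z)); rewrite aff_reflx mulN1r.
- by move=> z; rewrite E; have := d_aff2 (dy (aff (0, 0) (-1) 1 z)); rewrite aff_reflx mul1r.
Qed.

Lemma C1c_refly F Fx Fy : C1c F Fx Fy ->
  C1c (fun z => F (z.1, - z.2)) (fun z => Fx (z.1, - z.2)) (fun z => - Fy (z.1, - z.2)).
Proof. by move=> /C1c_swap/C1c_reflx/C1c_swap. Qed.

Lemma C1c_half (k : R) F Fx Fy G Gx Gy : C1c F Fx Fy -> C1c G Gx Gy ->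
  C1c (fun z => (F z + k * G z) / 2) (fun z => (Fx z + k * Gx z) / 2) (fun z => (Fy z + k * Gy z) / 2).
Proof.
move=> [[cF cFx cFy dx dy] s sx sy] [[cG cGx cGy ex ey] r rx ry].
split; [split|..]; try by cont.
- by move=> z; refine (d_eq (dM (dD (dx z) (dM (@dC _ _ _ _ _) (ex z))) (@dC _ _ _ _ _)) _); ring.
- by move=> z; refine (d_eq (dM (dD (dy z) (dM (@dC _ _ _ _ _) (ey z))) (@dC _ _ _ _ _)) _); ring.
- by move=> z nz; rewrite s// r// mulr0 addr0 mul0r.
- by move=> z nz; rewrite sx// rx// mulr0 addr0 mul0r.
- by move=> z nz; rewrite sy// ry// mulr0 addr0 mul0r.
Qed.

(** [b = true] selects the odd part in the first variable, [b = false] the even part;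
    differentiation in that variable flips [b]. *)
Definition symx b F z : R := (F z + (-1) ^+ b * F (- z.1, z.2)) / 2.
Definition symy b F z : R := (F z + (-1) ^+ b * F (z.1, - z.2)) / 2.

Lemma C1c_symx b F Fx Fy : C1c F Fx Fy -> C1c (symx b F) (symx (~~ b) Fx) (symx b Fy).
Proof.
move=> C; have := C1c_half ((-1) ^+ b) C (C1c_reflx C).
rewrite (_ : (fun z => (Fx z + _ * - Fx _) / 2) = symx (~~ b) Fx)//.
by apply/funext => z; rewrite /symx; case: b => /=; ring.
Qed.

Lemma C1c_symy b F Fx Fy : C1c F Fx Fy -> C1c (symy b F) (symy b Fx) (symy (~~ b) Fy).
Proof.
move=> C; have := C1c_half ((-1) ^+ b) C (C1c_refly C).
rewrite (_ : (fun z => (Fy z + _ * - Fy _) / 2) = symy (~~ b) Fy)//.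
by apply/funext => z; rewrite /symy; case: b => /=; ring.
Qed.

Lemma csymx b F : continuous F -> continuous (symx b F).
Proof.
move=> cF; have c1 : continuous (fun z => F (- z.1, z.2)).
  rewrite (_ : (fun z => _) = F \o aff (0, 0) (-1) 1); first exact: caff_comp.
  by apply/funext => z; rewrite /comp aff_reflx.
by rewrite /symx; cont.
Qed.

Lemma csymy b F : continuous F -> continuous (symy b F).
Proof.
move=> cF; have c1 : continuous (fun z => F (z.1, - z.2)).
  rewrite (_ : (fun z => _) = F \o aff (0, 0) 1 (-1)); first exact: caff_comp.
  by apply/funext => z; rewrite /comp aff_refly.
by rewrite /symy; cont.
Qed.

Lemma I_symx F : continuous F ->
  I (fun z => F z ^+ 2) = I (fun z => symx false F z ^+ 2) + I (fun z => symx true F z ^+ 2).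
Proof.
move=> cF; have c1 := @csymx false _ cF; have c2 := @csymx true _ cF.
have cr : continuous (fun z => F (- z.1, z.2)).
  rewrite (_ : (fun z => _) = F \o aff (0, 0) (-1) 1); first exact: caff_comp.
  by apply/funext => z; rewrite /comp aff_reflx.
rewrite -ID; [|by cont|by cont].
rewrite (@eq_I _ (fun z => symx false F z ^+ 2 + symx true F z ^+ 2)
  (fun z => 2^-1 * (F z ^+ 2) + 2^-1 * (F (- z.1, z.2) ^+ 2))); last by move=> z _; rewrite /symx; field.
rewrite ID; [|by cont|by cont]; rewrite !IZ; [|by cont|by cont].
by rewrite (@I_reflx _ (fun z => F z ^+ 2)); [field|cont].
Qed.

Lemma I_symy F : continuous F ->
  I (fun z => F z ^+ 2) = I (fun z => symy false F z ^+ 2) + I (fun z => symy true F z ^+ 2).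
Proof.
move=> cF; have c1 := @csymy false _ cF; have c2 := @csymy true _ cF.
have cr : continuous (fun z => F (z.1, - z.2)).
  rewrite (_ : (fun z => _) = F \o aff (0, 0) 1 (-1)); first exact: caff_comp.
  by apply/funext => z; rewrite /comp aff_refly.
rewrite -ID; [|by cont|by cont].
rewrite (@eq_I _ (fun z => symy false F z ^+ 2 + symy true F z ^+ 2)
  (fun z => 2^-1 * (F z ^+ 2) + 2^-1 * (F (z.1, - z.2) ^+ 2))); last by move=> z _; rewrite /symy; field.
rewrite ID; [|by cont|by cont]; rewrite !IZ; [|by cont|by cont].
by rewrite (@I_refly _ (fun z => F z ^+ 2)); [field|cont].
Qed.

Definition par b c F := symx b (symy c F).

Lemma C1c_par b c F Fx Fy : C1c F Fx Fy -> C1c (par b c F) (par (~~ b) c Fx) (par b (~~ c) Fy).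
Proof. by move=> C; apply: C1c_symx; exact: C1c_symy. Qed.

Lemma I_par F : continuous F ->
  I (fun z => F z ^+ 2) =
  I (fun z => par false false F z ^+ 2) + I (fun z => par false true F z ^+ 2)
  + I (fun z => par true false F z ^+ 2) + I (fun z => par true true F z ^+ 2).
Proof.
move=> cF; rewrite I_symy// [X in X + _]I_symx; last exact: csymy.
by rewrite [X in _ + X]I_symx; [rewrite /par; ring|exact: csymy].
Qed.

Lemma par_reflx b c F x y : par b c F (- x, y) = (-1) ^+ b * par b c F (x, y).
Proof. by rewrite /par /symx /= opprK; case: b; rewrite /= ?expr0 ?expr1; ring. Qed.

Lemma par_refly b c F x y : par b c F (x, - y) = (-1) ^+ c * par b c F (x, y).
Proof. by rewrite /par /symx /symy /= opprK; case: c; rewrite /= ?expr0 ?expr1; ring. Qed.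

Lemma par_y0 b F x : par b true F (x, 0) = 0.
Proof. by have := par_refly b true F x 0; rewrite oppr0 expr1 /=; lra. Qed.

Lemma par_x0 c F y : par true c F (0, y) = 0.
Proof. by have := par_reflx true c F 0 y; rewrite oppr0 expr1 /=; lra. Qed.

Lemma parD b c F G z : par b c (fun z => F z + G z) z = par b c F z + par b c G z.
Proof. by rewrite /par /symx /symy; ring. Qed.

Lemma I_sqr_swap F : continuous F -> I (fun z => F (z.2, z.1) ^+ 2) = I (fun z => F z ^+ 2).
Proof. by move=> cF; rewrite (I_swap (F := fun z => F z ^+ 2)); last by cont. Qed.

Lemma odd_lower_x F Fx Fy : C1c F Fx Fy -> (forall y, F (0, y) = 0) ->
  356 / 25 * I (fun z => F z ^+ 2) <= I (fun z => Fx z ^+ 2) + I (fun z => Fy z ^+ 2).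
Proof.
move=> C F0; have [[cF cFx cFy _ _] _ _ _] := C.
have /= := odd_lower (C1c_swap C) F0.
by rewrite !I_sqr_swap// [leRHS]addrC.
Qed.

Lemma class_A_swap (phi phix phiy : nat -> R * R -> R) v vx vy w wx wy (s : R) :
  approximates phi phix phiy f0 f0x f0y ->
  C1c v vx vy -> (forall x y, v (- x, y) = v (x, y)) -> (forall x y, v (x, - y) = v (x, y)) ->
  C1c w wx wy -> (forall x, w (x, 0) = 0) -> (forall y, w (0, y) = 0) ->
  23 / 20 <= s <= 49 / 20 ->
  29 / 5 * s * (I (fun z => v z ^+ 2) + I (fun z => w z ^+ 2)) <=
  I (fun z => vx z ^+ 2) + I (fun z => vy z ^+ 2) + I (fun z => wx z ^+ 2) + I (fun z => wy z ^+ 2)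
  + (s ^+ 2 - 1) * I (fun z => (wx z + vy z) ^+ 2).
Proof.
move=> ap Cv v1 v2 Cw w1 w2 sb.
have [[cv cvx cvy _ _] _ _ _] := Cv; have [[cw cwx cwy _ _] _ _ _] := Cw.
have := @class_A _ _ _ _ _ _ _ _ _ _ s ap (C1c_swap Cv) (fun x y => v2 y x) (fun x y => v1 y x)
  (C1c_swap Cw) w2 w1 sb.
rewrite !I_sqr_swap// (@I_sqr_swap (fun z => vy z + wx z)); last by cont.
rewrite (_ : (fun z => (vy z + wx z) ^+ 2) = (fun z => (wx z + vy z) ^+ 2)); last first.
  by apply/funext => z; rewrite addrC.
by clear; gen_I; lra.
Qed.

(** The divergence couples an even-even component only with an odd-odd one, which gives two copies
    of [class_A] exchanged by the swap of the axes. The remaining parts are each odd in exactly one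
    variable; for them the scalar bound suffices and their share of the divergence is discarded. *)
Lemma disk_lower (phi phix phiy : nat -> R * R -> R) u ux uy w wx wy (s : R) :
  approximates phi phix phiy f0 f0x f0y ->
  C1c u ux uy -> C1c w wx wy -> 23 / 20 <= s <= 49 / 20 ->
  29 / 5 * s * (I (fun z => u z ^+ 2) + I (fun z => w z ^+ 2)) <=
  I (fun z => ux z ^+ 2) + I (fun z => uy z ^+ 2) + I (fun z => wx z ^+ 2) + I (fun z => wy z ^+ 2)
  + (s ^+ 2 - 1) * I (fun z => (ux z + wy z) ^+ 2).
Proof.
move=> ap Cu Cw sb; have [s1 s2] := andP sb.
have [[cu cux cuy _ _] _ _ _] := Cu; have [[cw cwx cwy _ _] _ _ _] := Cw.
have cd : continuous (fun z => ux z + wy z) by cont.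
have a0 : 0 <= s ^+ 2 - 1 by rewrite subr_ge0 -[1](expr1n _ 2) ler_sqr ?nnegrE; lra.
have ev1 F x y : par false false F (- x, y) = par false false F (x, y) by rewrite par_reflx mul1r.
have ev2 F x y : par false false F (x, - y) = par false false F (x, y) by rewrite par_refly mul1r.
(* At [s = 49 / 20] this reads 14.21 <= 14.24; the upper bound on nu enters here with almost no
   slack. *)
have sK : 29 / 5 * s <= 356 / 25 by lra.
have hA := class_A ap (C1c_par false false Cu) (ev1 u) (ev2 u) (C1c_par true true Cw) (@par_y0 true w)
  (@par_x0 true w) sb.
have hB := class_A_swap ap (C1c_par false false Cw) (ev1 w) (ev2 w) (C1c_par true true Cu)
  (@par_y0 true u) (@par_x0 true u) sb.
have u1 := odd_lower (C1c_par false true Cu) (@par_y0 false u).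
have u2 := odd_lower_x (C1c_par true false Cu) (@par_x0 false u).
have w1 := odd_lower (C1c_par false true Cw) (@par_y0 false w).
have w2 := odd_lower_x (C1c_par true false Cw) (@par_x0 false w).
have n F : 0 <= I (fun z => F z ^+ 2) by apply: I_ge0 => z _; exact: sqr_ge0.
(* The x-derivative flips the first parity and the y-derivative the second, so these are the
   divergences of the two coupled pairs; the other two parity parts are dropped as nonnegative. *)
have hd : I (fun z => (par true false ux z + par true false wy z) ^+ 2)
   + I (fun z => (par false true ux z + par false true wy z) ^+ 2) <= I (fun z => (ux z + wy z) ^+ 2).
  have e b c : I (fun z => par b c (fun z => ux z + wy z) z ^+ 2) = I (fun z => (par b c ux z
    + par b c wy z) ^+ 2).
    by apply: eq_I => z _; rewrite parD.
  rewrite (I_par cd) !e.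
  have := n (fun z => par false false ux z + par false false wy z).
  have := n (fun z => par true true ux z + par true true wy z).
  by clear; gen_I; lra.
have := ler_wpM2l a0 hd.
have kk F : 29 / 5 * s * I (fun z => F z ^+ 2) <= 356 / 25 * I (fun z => F z ^+ 2).
  by apply: ler_wpM2r => //.
have k1 := kk (par false true u); have k2 := kk (par true false u).
have k3 := kk (par false true w); have k4 := kk (par true false w).
rewrite (I_par cu) (I_par cw) (I_par cux) (I_par cuy) (I_par cwx) (I_par cwy).
move: hA hB u1 u2 w1 w2 k1 k2 k3 k4 => /=; clear.
move: (s ^+ 2 - 1) => a.
move: (29 / 5 * s) => K.
gen_I; lra.
Qed.

End parity.

(** * Smooth trial functions *)

Section flat_functions.
Context {R : realType}.
Implicit Types (k n : nat) (z : R).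

(* The family is closed under differentiation, see dflat. *)
Definition flat k z : R := if 0 < z then z^-1 ^+ k * expR (- z^-1) else 0.

Lemma flat_pos k z : 0 < z -> flat k z = z^-1 ^+ k * expR (- z^-1).
Proof. by rewrite /flat => ->. Qed.

Lemma flat_neg k z : z <= 0 -> flat k z = 0.
Proof. by rewrite /flat leNgt => /negbTE ->. Qed.

Lemma flat_ge0 k z : 0 <= flat k z.
Proof.
rewrite /flat; case: ifP => // z0.
by rewrite mulr_ge0 ?expR_ge0// exprn_ge0// invr_ge0 ltW.
Qed.

Lemma flat_le k z : flat k z <= k`!%:R.
Proof.
rewrite /flat; case: ifP => [z0|_]; last by rewrite ler0n.
have y0 : 0 <= z^-1 by rewrite invr_ge0 ltW.
rewrite expRN ler_pdivrMr ?expR_gt0//.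
case: k => [|k]; first by rewrite mul1r expr0 -expR0 ler_expR.
rewrite mulrC -ler_pdivrMr ?ltr0n ?fact_gt0//.
by apply: le_trans (expR_ge1Dxn k y0); rewrite lerDr.
Qed.

Lemma flat_div k z : z != 0 -> z^-1 * flat k z = flat k.+1 z.
Proof.
by move=> z0; rewrite /flat; case: ifP => _; rewrite ?mulr0// exprS mulrA.
Qed.

Lemma flat_le_lin k z : 0 < z -> flat k z <= k.+1`!%:R * z.
Proof.
by move=> z0; rewrite -ler_pdivrMr// mulrC flat_div ?lt0r_neq0// flat_le.
Qed.

Lemma flat_cvg0 k : flat k h @[h --> 0^'] --> (0 : R).
Proof.
have h0 : `|h| * k.+1`!%:R @[h --> (0 : R)^'] --> (0 : R).
  rewrite -[X in _ --> X](mul0r k.+1`!%:R); apply: cvgM; last exact: cvg_cst.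
  have cn : continuous (fun h : R => `|h|) by apply: cabs; cont.
  by apply: cvg_within_filter; have := cn 0; rewrite /continuous_at normr0.
apply: (@squeeze_cvgr _ _ _ _ (fun=> 0) _ _ _ _ (cvg_cst 0) h0).
apply: nearW => h; rewrite flat_ge0 /=; have [hp|hn] := ltP 0 h.
  by rewrite gtr0_norm// mulrC; exact: flat_le_lin.
by rewrite flat_neg// mulr_ge0.
Qed.

Lemma dflat k z : is_derive z 1 (flat k) (flat k.+2 z - k%:R * flat k.+1 z).
Proof.
have [z0|z0|->] := ltgtP z 0.
- rewrite !(flat_neg _ (ltW z0)) mulr0 subr0.
  refine (@near_eq_is_derive _ _ _ _ _ _ _ _ _ (dC z 1 0)).
  by near=> h; rewrite flat_neg//; apply: ltW; near: h; exact: lt_nbhsl.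
- rewrite !flat_pos//.
  apply: (@near_eq_is_derive _ _ _ (fun z => z^-1 ^+ k * expR (- z^-1))).
    by near=> h; rewrite flat_pos//; near: h; exact: lt_nbhsr.
  have nz := lt0r_neq0 z0.
  have dI : is_derive z 1 (fun z : R => z^-1) (- 1 / z ^+ 2) by apply: (@dV _ _ id).
  refine (d_eq (dM (dX k dI) (d_comp (is_derive_expR _) (dN dI))) _).
  rewrite -!exprVn; move: (expR _) => e.
  by case: k => [|k] /=; rewrite ?exprS; ring.
- rewrite !flat_neg// mulr0 subr0.
  (* At 0 the difference quotient of [flat k] is [flat k.+1], which tends to 0. *)
  have E : (fun h : R => h^-1 *: (flat k (h *: (1 : R) + 0) - flat k 0)) @ 0^' --> (0 : R).
    apply: cvg_trans (flat_cvg0 k.+1); apply: near_eq_cvg; near=> h.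
    have h0 : h != 0 by near: h; exact: nbhs_dnbhs_neq.
    by rewrite -flat_div// (flat_neg _ (lexx 0)) subr0 addr0 /GRing.scale /= mulr1.
  by split; [apply/cvg_ex; exists 0|exact/cvg_lim].
Unshelve. all: end_near. Qed.

Lemma cflat k : continuous (flat k).
Proof. exact: derive_continuous (dflat k). Qed.

(** In the derivative of r [flat 0](N r - 1) the large factor N meets r, and N r is the argument
    plus 1. The identity turns it into bounded functions, so [cutoff1] is bounded uniformly in
    [n]. *)
Lemma flat2_lin z : (z + 1) * flat 2 z = flat 1 z + flat 2 z.
Proof.
have [z0|z0] := ltP 0 z; last by rewrite !flat_neg// mulr0 addr0.
rewrite mulrDl mul1r -(@flat_div 1) ?lt0r_neq0// mulVKf ?lt0r_neq0//.
Qed.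

End flat_functions.

Section smooth_expressions.
Context {R : realType}.

(** A syntax closed under both partial derivatives; smoothness to all orders then reduces to
    continuity and one derivative of an arbitrary expression. *)
Inductive expr := Ex | Ey | Ec of R | Ea of expr & expr | Em of expr & expr | Ef of nat & expr.

Fixpoint eval (e : expr) (z : R * R) : R :=
  match e with
  | Ex => z.1
  | Ey => z.2
  | Ec k => k
  | Ea e f => eval e z + eval f z
  | Em e f => eval e z * eval f z
  | Ef k e => flat k (eval e z)
  end.

Fixpoint dexpr (i : 'I_2) (e : expr) : expr :=
  match e with
  | Ex => Ec (basis_vec R i).1
  | Ey => Ec (basis_vec R i).2
  | Ec _ => Ec 0
  | Ea e f => Ea (dexpr i e) (dexpr i f)
  | Em e f => Ea (Em (dexpr i e) f) (Em e (dexpr i f))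
  | Ef k e => Em (Ea (Ef k.+2 e) (Em (Ec (- k%:R)) (Ef k.+1 e))) (dexpr i e)
  end.

Lemma d_eval i e z : is_derive z (basis_vec R i) (eval e) (eval (dexpr i e) z).
Proof.
elim: e => [||k|e IHe f IHf|e IHe f IHf|k e IHe] /=.
- exact: dfst.
- exact: dsnd.
- exact: dC.
- exact: dD.
- exact: dM.
- by refine (d_eq (d_comp (dflat k _) IHe) _); rewrite mulNr.
Qed.

Lemma c_eval e : continuous (eval e).
Proof.
elim: e => [||k|e IHe f IHf|e IHe f IHf|k e IHe] /=.
- exact: cfst.
- exact: csnd.
- exact: cC.
- exact: cD.
- exact: cM.
- by apply: ccomp => //; exact: cflat.
Qed.

Lemma partial_eval i e : partial i (eval e) = eval (dexpr i e).
Proof. by apply/funext => z; have [_] := d_eval i e z. Qed.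

Lemma smooth_eval e : smooth (eval e).
Proof.
move=> s; have -> : iter_partial s (eval e) = eval (foldr dexpr e s).
  by elim: s => //= i s ->; exact: partial_eval.
by split=> [|i z]; [exact: c_eval|have [] := d_eval i (foldr dexpr e s) z].
Qed.

Fixpoint esubst (c : R * R) (a b : R) (e : expr) : expr :=
  match e with
  | Ex => Ea (Ec c.1) (Em (Ec a) Ex)
  | Ey => Ea (Ec c.2) (Em (Ec b) Ey)
  | Ec k => Ec k
  | Ea e f => Ea (esubst c a b e) (esubst c a b f)
  | Em e f => Em (esubst c a b e) (esubst c a b f)
  | Ef k e => Ef k (esubst c a b e)
  end.

Lemma eval_subst c a b e : eval (esubst c a b e) = eval e \o aff c a b.
Proof.
apply/funext => z.
by elim: e => [||k|e IHe f IHf|e IHe f IHf|k e IHe] //=; rewrite ?IHe ?IHf.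
Qed.

Lemma smooth_eval_aff c a b e : smooth (eval e \o aff c a b).
Proof. by rewrite -eval_subst; exact: smooth_eval. Qed.

End smooth_expressions.

(** * Smoothings of the profile f0 *)

Section cutoff.
Context {R : realType}.
Implicit Types (n : nat) (r : R) (z : R * R).

(** The profile r + r^2/2 of f0, with r for rho, multiplied by a smooth factor that vanishes for r
    <= 1/(n+1) and tends to 1 for every r > 0. *)
Definition cutoff n r : R := r * flat 0 (n.+1%:R * r - 1) * (1 + r / 2).

Definition cutoff1 n r : R :=
  (flat 0 (n.+1%:R * r - 1) + flat 1 (n.+1%:R * r - 1) + flat 2 (n.+1%:R * r - 1)) * (1 + r / 2)
  + r * flat 0 (n.+1%:R * r - 1) / 2.

Lemma dcutoff n r : is_derive r 1 (cutoff n) (cutoff1 n r).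
Proof.
have dw : is_derive r 1 (fun r : R => n.+1%:R * r - 1) n.+1%:R.
  by refine (d_eq (dB (dM (@dC _ _ _ _ _) (is_derive_id _ _)) (@dC _ _ _ _ _)) _); ring.
refine (d_eq (dM (dM (is_derive_id r 1) (d_comp (dflat 0 _) dw)) (dD (@dC _ _ _ _ _) (dM
  (is_derive_id r 1) (@dC _ _ _ _ _)))) _).
have := flat2_lin (n.+1%:R * r - 1); rewrite subrK /cutoff1 => h.
rewrite -addrA -h; move: (flat _ _) (flat 2 _) => p q {h}.
by rewrite /=; field.
Qed.

Lemma ccutoff n : continuous (cutoff n).
Proof. exact: derive_continuous (dcutoff n). Qed.

Lemma ccutoff1 n : continuous (cutoff1 n).
Proof.
have c k : continuous (fun r : R => flat k (n.+1%:R * r - 1)) by apply: ccomp; [exact: cflat|cont].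
by have c0 := c 0%N; have c1 := c 1%N; have c2 := c 2%N; rewrite /cutoff1; cont.
Qed.

Lemma cutoff_flat n r : n.+1%:R * r <= 1 -> cutoff n r = 0 /\ cutoff1 n r = 0.
Proof.
by move=> r1; rewrite /cutoff /cutoff1 !flat_neg ?subr_le0// !(mulr0, mul0r, addr0).
Qed.

Definition trial n z : R := cutoff n (rho z).
Definition trialx n z : R := cutoff1 n (rho z) * - (2 * z.1).
Definition trialy n z : R := cutoff1 n (rho z) * - (2 * z.2).

Lemma trial_flat n z : n.+1%:R * rho z <= 1 -> [/\ trial n z = 0, trialx n z = 0 & trialy n z = 0].
Proof.
by move=> /cutoff_flat[h1 h2]; rewrite /trial /trialx /trialy h1 h2 !mul0r.
Qed.

Lemma rho_le0 z : ~ udisk z -> rho z <= 0.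
Proof. by move=> /negP; rewrite -leNgt /rho -addrA -opprD subr_le0. Qed.

Lemma rho_gt0 z : udisk z -> 0 < rho z <= 1.
Proof.
rewrite /udisk /rho /= => zd; apply/andP; split; first by rewrite -addrA -opprD subr_gt0.
by have := sqr_ge0 z.1; have := sqr_ge0 z.2; lra.
Qed.

Lemma C1c_trial n : C1c (trial n) (trialx n) (trialy n).
Proof.
have s z : ~ udisk z -> n.+1%:R * rho z <= 1.
  by move=> /rho_le0 r0; apply: (le_trans (y := 0)) => //; rewrite mulr_ge0_le0.
split; [split|by move=> z /s/trial_flat[]..].
- exact: ccomp (@ccutoff n) (@crho R).
- by rewrite /trialx; apply: cM; [exact: ccomp (@ccutoff1 n) (@crho R)|cont].
- by rewrite /trialy; apply: cM; [exact: ccomp (@ccutoff1 n) (@crho R)|cont].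
- by move=> z; exact: d_comp (dcutoff n _) (drho1 z).
- by move=> z; exact: d_comp (dcutoff n _) (drho2 z).
Qed.

Lemma cutoff_bound n r : 0 < r <= 1 -> `|cutoff n r| <= 2 /\ `|cutoff1 n r| <= 7.
Proof.
move=> /andP[r0 r1]; rewrite /cutoff /cutoff1; set w := n.+1%:R * r - 1.
have a0 := flat_ge0 0 w; have a1 := flat_ge0 1 w; have a2 := flat_ge0 2 w.
have b0 : flat 0 w <= 1 := flat_le 0 w.
have b1 : flat 1 w <= 1 := flat_le 1 w.
have b2 : flat 2 w <= 2 := flat_le 2 w.
move: a0 a1 a2 b0 b1 b2; move: (flat 0 w) (flat 1 w) (flat 2 w) => p q t a0 a1 a2 b0 b1 b2.
have rp : 0 <= r * p <= 1 by rewrite mulr_ge0 ?(ltW r0)// mulr_ile1// ltW.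
by split; rewrite ger0_norm; nra.
Qed.

Lemma near_large (r : R) : 0 < r ->
  \forall n \near \oo, 0 < n.+1%:R * r - 1 /\ (n.+1%:R * r - 1)^-1 <= 2 / r * n.+1%:R^-1.
Proof.
move=> r0; have r2 : 0 < r / 2 by rewrite divr_gt0.
near=> n.
have h : n.+1%:R^-1 < r / 2 by near: n; exact: (cvgr_lt _ (@cvg_harmonic R)).
have N0 : 0 < n.+1%:R :> R by rewrite ltr0n.
have h2 : 2 < n.+1%:R * r.
  by move: h; rewrite -[_^-1]mul1r ltr_pdivrMr// mulrAC ltr_pdivlMr// mul1r mulrC.
split; first by lra.
rewrite (_ : 2 / r * n.+1%:R^-1 = (n.+1%:R * r / 2)^-1); last by rewrite !invfM invrK; ring.
by rewrite lef_pV2 ?posrE; lra.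
Unshelve. all: end_near. Qed.

Lemma harmonic_cvg0 (k : R) : k * n.+1%:R^-1 @[n --> \oo] --> (0 : R).
Proof. by rewrite -[X in _ --> X](mulr0 k); apply: cvgM; [exact: cvg_cst|exact: cvg_harmonic]. Qed.

Lemma flat0_cvg (r : R) : 0 < r -> flat 0 (n.+1%:R * r - 1) @[n --> \oo] --> (1 : R).
Proof.
move=> r0.
have l1 : 1 - 2 / r * n.+1%:R^-1 @[n --> \oo] --> (1 : R).
  by rewrite -[X in _ --> X]subr0; apply: cvgB; [exact: cvg_cst|exact: harmonic_cvg0].
have l2 : (fun _ : nat => 1 : R) @ \oo --> (1 : R) by exact: cvg_cst.
apply: (squeeze_cvgr _ l1 l2).
near=> n.
have [w0 h] : 0 < n.+1%:R * r - 1 /\ (n.+1%:R * r - 1)^-1 <= 2 / r * n.+1%:R^-1 by near: n; exact: near_large.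
rewrite [_ <= 1](flat_le 0) andbT flat_pos// mul1r.
by apply: le_trans (expR_ge1Dx _); rewrite lerD2l lerN2.
Unshelve. all: end_near. Qed.

Lemma flatS_cvg (r : R) k : 0 < r -> flat k.+1 (n.+1%:R * r - 1) @[n --> \oo] --> (0 : R).
Proof.
move=> r0; apply: (squeeze_cvgr _ (cvg_cst 0) (harmonic_cvg0 (k`!%:R * (2 / r)))).
near=> n.
have [w0 h] : 0 < n.+1%:R * r - 1 /\ (n.+1%:R * r - 1)^-1 <= 2 / r * n.+1%:R^-1 by near: n; exact: near_large.
rewrite flat_ge0 /= -flat_div ?lt0r_neq0// mulrC -mulrA.
by apply: ler_pM => //; [exact: flat_ge0|rewrite invr_ge0 ltW|exact: flat_le].
Unshelve. all: end_near. Qed.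

Lemma trial_approximates : approximates trial trialx trialy f0 f0x f0y.
Proof.
split.
- exact: C1c_trial.
- by move=> n x y; rewrite /trial /rho /= !sqrrN.
(* 14 = 7 * 2: the bound of [cutoff1] times that of the derivatives of rho on the disk. *)
- exists 14 => n z zd; have [h1 h2] := cutoff_bound n (rho_gt0 zd).
  have [/= x1 y1] := udisk_box zd; rewrite !in_itv /= -!ler_norml in x1 y1.
  split; first by apply: le_trans h1 _; lra.
  + by rewrite /trialx normrM normrN normrM [`|2|]ger0_norm//;
    apply: (le_trans (ler_pM _ _ h2 (_ : _ <= 2))) => //; lra.
  + by rewrite /trialy normrM normrN normrM [`|2|]ger0_norm//;
    apply: (le_trans (ler_pM _ _ h2 (_ : _ <= 2))) => //; lra.
- move=> z zd; have /andP[r0 r1] := rho_gt0 zd.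
  have c0 := flat0_cvg r0; have c1 := flatS_cvg 0 r0; have c2 := flatS_cvg 1 r0.
  have k (x : R) : (fun=> x) @ \oo --> x by exact: cvg_cst.
  have cT : cutoff n (rho z) @[n --> \oo] --> f0 z.
    rewrite (_ : f0 z = rho z * 1 * (1 + rho z / 2)); last by rewrite /f0; field.
    by apply: cvgM; [apply: cvgM|].
  have cT1 : cutoff1 n (rho z) @[n --> \oo] --> 1 + rho z.
    rewrite (_ : 1 + rho z = (1 + 0 + 0) * (1 + rho z / 2) + rho z * 1 / 2); last by field.
    by apply: cvgD; apply: cvgM => //; [apply: cvgD => //; exact: cvgD|exact: cvgM].
  split => //.
  + rewrite (_ : f0x z = (1 + rho z) * - (2 * z.1)); last by rewrite /f0x; ring.
    by apply: cvgM.
  + rewrite (_ : f0y z = (1 + rho z) * - (2 * z.2)); last by rewrite /f0y; ring.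
    by apply: cvgM.
Qed.

Definition rho_expr : @expr R := Ea (Ea (Ec 1) (Em (Ec (-1)) (Em Ex Ex))) (Em (Ec (-1)) (Em Ey Ey)).

Lemma trial_eval n : exists e, trial n = eval e.
Proof.
exists (Em (Em rho_expr (Ef 0 (Ea (Em (Ec n.+1%:R) rho_expr) (Ec (-1))))) (Ea (Ec 1) (Em rho_expr
  (Ec 2^-1)))).
apply/funext => z /=; rewrite /trial /cutoff.
have -> : 1 + -1 * (z.1 * z.1) + -1 * (z.2 * z.2) = rho z by rewrite /rho; ring.
by [].
Qed.

End cutoff.

(** * Ellipses and test functions *)

Section ellipses.
Context {R : realType}.
Implicit Types (F G : R * R -> R) (c z : R * R) (a b : R).
Notation mT := (measurableTypeR R * measurableTypeR R)%type.

Definition ainv c a b : R * R -> R * R := aff (- (c.1 / a), - (c.2 / b)) a^-1 b^-1.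

Lemma ainvK c a b z : 0 < a -> 0 < b -> aff c a b (ainv c a b z) = z.
Proof.
move=> a0 b0; case: z => x y; rewrite /ainv /aff /=.
by congr (_, _); field; exact: lt0r_neq0.
Qed.

Lemma affK c a b z : 0 < a -> 0 < b -> ainv c a b (aff c a b z) = z.
Proof.
move=> a0 b0; case: z => x y; rewrite /ainv /aff /=.
by congr (_, _); field; exact: lt0r_neq0.
Qed.

(** For positive [a] and [b], the ellipse with centre [c] and semi-axes [a], [b]; the preimage form
    makes openness immediate and pulls it back to [udisk] under [aff c a b]. *)
Definition ell c a b : set (R * R) := ainv c a b @^-1` udisk.

Lemma disk_ell c r : 0 < r -> disk c r = ell c r r.
Proof.
move=> r0; apply/seteqP; rewrite /disk /ell /udisk /preimage /=.
have E (z : R * R) : (- (c.1 / r) + r^-1 * z.1) ^+ 2 + (- (c.2 / r) + r^-1 * z.2) ^+ 2 =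
  ((z.1 - c.1) ^+ 2 + (z.2 - c.2) ^+ 2) / r ^+ 2 by field; exact: lt0r_neq0.
by split => z /=; rewrite E ltr_pdivrMr ?exprn_gt0// mul1r.
Qed.

Lemma open_ell c a b : open (ell c a b).
Proof. by apply: open_comp => [z _|]; [exact: caff|exact: open_udisk]. Qed.

Lemma measurable_ell c a b : measurable (ell c a b : set mT).
Proof. by apply: open_measurable_prod; exact: open_ell. Qed.

Lemma aff_ell c a b : 0 < a -> 0 < b -> aff c a b @^-1` ell c a b = udisk.
Proof.
by move=> a0 b0; apply/seteqP; split => z; rewrite /ell /preimage /= affK.
Qed.

Lemma ell_box c a b : 0 < a -> 0 < b ->
  exists M, ell c a b `<=` `[- M, M] `*` `[- M, M].
Proof.
move=> a0 b0; exists (`|c.1| + a + (`|c.2| + b)) => z.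
move=> /udisk_box[]; rewrite -[X in (_ `*` _) X](@ainvK c a b z a0 b0); move: (ainv c a b z) => w.
rewrite /= !in_itv /= -!ler_norml => w1 w2.
have h (x t u : R) : 0 < t -> `|u| <= 1 -> `|x + t * u| <= `|x| + t.
  move=> t0 u1; apply: le_trans (ler_normD _ _) _; rewrite lerD2l normrM gtr0_norm//.
  by rewrite ler_piMr// ltW.
have := h c.1 a _ a0 w1; have := h c.2 b _ b0 w2.
by split; [apply: (le_trans (h c.1 a _ a0 w1))|apply: (le_trans (h c.2 b _ b0 w2))];
  rewrite ?lerDl ?lerDr addr_ge0// ltW.
Qed.

Lemma ell_integrable c a b F : 0 < a -> 0 < b -> continuous F ->
  (lebesgue2 R).-integrable (ell c a b) (EFin \o F).
Proof.
move=> a0 b0 cF; apply: continuous_bounded_integrable => //; first exact: measurable_ell.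
exact: ell_box.
Qed.

Lemma ell_Rintegral c a b F : 0 < a -> 0 < b -> continuous F ->
  \int[lebesgue2 R]_(z in ell c a b) F z = a * b * I (fun z => F (aff c a b z)).
Proof.
move=> a0 b0 cF; rewrite (@Rintegral_aff _ c a b) ?lt0r_neq0 ?gtr0_norm//; last exact: ell_integrable.
  by rewrite aff_ell.
exact: measurable_ell.
Qed.

Lemma bounded_ell c a b : 0 < a -> 0 < b -> bounded_set (ell c a b).
Proof.
move=> a0 b0; have [M h] := ell_box c a0 b0.
have cB : compact (`[- M, M] `*` `[- M, M] : set (R * R)).
  by apply: compact_setX; exact: segment_compact.
have := compact_bounded cB; rewrite /bounded_set => hb.
by apply: filterS hb => N hN z /h; exact: hN.
Qed.

Lemma lebesgue2_ell c a b : 0 < a -> 0 < b ->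
  ((lebesgue2 R) (ell c a b) = (a * b)%:E * (lebesgue2 R) (udisk : set mT))%E.
Proof.
move=> a0 b0; have -> := @lebesgue2_aff _ c a b _ (lt0r_neq0 a0) (lt0r_neq0 b0) (measurable_ell c a b).
by rewrite aff_ell// !gtr0_norm.
Qed.

End ellipses.

Section test_functions.
Context {R : realType}.
Implicit Types (f g : R * R -> R) (c z : R * R) (a b : R) (O : set (R * R)).

Lemma partial1 f z : derivable f z (basis_vec R ord0) -> is_derive z ((1, 0) : R * R) f (partial ord0 f z).
Proof. by move=> df; exact: DeriveDef. Qed.

Lemma partial2 f z : derivable f z (basis_vec R ord_max) ->
  is_derive z ((0, 1) : R * R) f (partial ord_max f z).
Proof. by move=> df; exact: DeriveDef. Qed.

Lemma test_continuous O f : test_function O f ->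
  continuous f /\ forall i, continuous (partial i f).
Proof. by move=> [sf _ _]; split=> [|i]; [have [] := sf [::]|have [] := sf [:: i]]. Qed.

Lemma test_derivable O f : test_function O f ->
  forall i z, derivable f z (basis_vec R i).
Proof. by move=> [sf _ _]; have [] := sf [::]. Qed.

(** A point outside [O] has a neighbourhood that misses the closed support, so [f] is locally zero
    there and its derivatives vanish too. *)
Lemma test_out O f z : test_function O f -> ~ O z ->
  f z = 0 /\ forall i, partial i f z = 0.
Proof.
move=> [_ _ cO] nz.
have nc : ~ closure [set x | f x != 0] z by move=> /cO.
have f0 : \near z, 0 = f z.
  have : \forall x \near z, ~ closure [set x | f x != 0] x.
    by apply: open_nbhs_nbhs; split => //; apply: closed_openC; exact: closed_closure.
  apply: filterS => x nx; apply/eqP; rewrite eq_sym; apply/negP => /negP fx.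
  by apply: nx; exact: subset_closure.
split; first by have := nbhs_singleton f0.
by move=> i; have [_] := near_eq_is_derive f0 (dC z (basis_vec R i) 0).
Qed.

Lemma test_C1c c a b f : 0 < a -> 0 < b -> test_function (ell c a b) f ->
  C1c (fun z => f (aff c a b z)) (fun z => a * partial ord0 f (aff c a b z))
      (fun z => b * partial ord_max f (aff c a b z)).
Proof.
move=> a0 b0 tf; have [cf cp] := test_continuous tf; have df := test_derivable tf.
have cA F : continuous F -> continuous (fun z => F (aff c a b z)) := @caff_comp _ c a b F.
have out z : ~ udisk z -> ~ ell c a b (aff c a b z) by rewrite /ell /preimage /= affK.
split; [split|..].
- exact: cA.
- by apply: cM; [exact: cC|exact: cA].
- by apply: cM; [exact: cC|exact: cA].
- by move=> z; apply: d_aff1; exact: partial1.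
- by move=> z; apply: d_aff2; exact: partial2.
- by move=> z /out /(test_out tf)[].
- by move=> z /out /(test_out tf)[_ ->]; rewrite mulr0.
- by move=> z /out /(test_out tf)[_ ->]; rewrite mulr0.
Qed.

Definition sqint O f : R := \int[lebesgue2 R]_(z in O) (f z ^+ 2).

Lemma test_lower c (r s : R) f g : 0 < r -> 23 / 20 <= s <= 49 / 20 ->
  test_function (ell c r r) f -> test_function (ell c r r) g ->
  29 / 5 * s * (sqint (ell c r r) f + sqint (ell c r r) g) <=
  r ^+ 2 * (sqint (ell c r r) (partial ord0 f) + sqint (ell c r r) (partial ord_max f)
    + sqint (ell c r r) (partial ord0 g) + sqint (ell c r r) (partial ord_max g)
    + (s ^+ 2 - 1) * sqint (ell c r r) (fun z => partial ord0 f z + partial ord_max g z)).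
Proof.
move=> r0 sb tf tg.
have [cf cp] := test_continuous tf; have [cg cq] := test_continuous tg.
have NE h : continuous h -> sqint (ell c r r) h = r * r * I (fun z => h (aff c r r z) ^+ 2).
  by move=> ch; rewrite /sqint ell_Rintegral//; cont.
have cA F : continuous F -> continuous (fun z => F (aff c r r z)) := @caff_comp _ c r r F.
have sq F : continuous F -> I (fun z => (r * F (aff c r r z)) ^+ 2) = r ^+ 2 * I (fun z => F
  (aff c r r z) ^+ 2).
  move=> cF; have cF' := cA _ cF; rewrite -IZ; last by cont.
  by apply: eq_I => z _; rewrite exprMn.
have cd : continuous (fun z => partial ord0 f z + partial ord_max g z) by apply: cD.
have := disk_lower trial_approximates (test_C1c r0 r0 tf) (test_C1c r0 r0 tg) sb.
rewrite !sq//; have -> : I (fun z => (r * partial ord0 f (aff c r r z)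
  + r * partial ord_max g (aff c r r z)) ^+ 2) =
   r ^+ 2 * I (fun z => (partial ord0 f (aff c r r z) + partial ord_max g (aff c r r z)) ^+ 2).
  have /= <- := sq _ cd; by apply: eq_I => z _; rewrite mulrDr.
rewrite !NE// => h.
have r2 : 0 <= r * r by rewrite mulr_ge0// ltW.
have := ler_wpM2l r2 h.
clear; gen_I; lra.
Qed.

Lemma test_weak_partial c a b f : 0 < a -> 0 < b -> test_function (ell c a b) f ->
  forall i, weak_partial (ell c a b) i f (partial i f).
Proof.
move=> a0 b0 tf i g tg.
have [cf cp] := test_continuous tf; have [cg cq] := test_continuous tg.
have cA F : continuous F -> continuous (fun z => F (aff c a b z)) := @caff_comp _ c a b F.
have cpi := cp i; have cqi := cq i.
rewrite !ell_Rintegral//; [|by cont|by cont].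
rewrite -mulrN; congr (_ * _).
have [[kf kfx kfy dfx dfy] sf _ _] := test_C1c a0 b0 tf.
have [[kg kgx kgy dgx dgy] sg _ _] := test_C1c a0 b0 tg.
have ml1 (k : R) (F G : R * R -> R) : continuous F -> continuous G ->
    I (fun z => k * F (aff c a b z) * G (aff c a b z)) = k * I (fun z => F (aff c a b z) * G (aff c a b z)).
  move=> cF cG; have cF' := cA _ cF; have cG' := cA _ cG.
  by rewrite -IZ; [apply: eq_I => z _; ring|cont].
have ml2 (k : R) (F G : R * R -> R) : continuous F -> continuous G ->
    I (fun z => F (aff c a b z) * (k * G (aff c a b z))) = k * I (fun z => F (aff c a b z) * G (aff c a b z)).
  move=> cF cG; have cF' := cA _ cF; have cG' := cA _ cG.
  by rewrite -IZ; [apply: eq_I => z _; ring|cont].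
have : i = ord0 \/ i = ord_max by case: i {cpi cqi} => [[|[|//]] p]; [left|right]; exact: val_inj.
case=> iE; subst i.
(* Multiplying both sides by the chain-rule factor produces the derivatives of the transported
   functions, which are integrated by parts on the unit disk. *)
- apply: (mulfI (lt0r_neq0 a0)); rewrite mulrN -ml2// -ml1//.
  by rewrite (I_parts_x kf kfx kg kgx dfx dgx sf) opprK.
- apply: (mulfI (lt0r_neq0 b0)); rewrite mulrN -ml2// -ml1//.
  by rewrite (I_parts_y kf kfy kg kgy dfy dgy sf) opprK.
Qed.

End test_functions.

(** * Square-integrable limits *)

Section square_integrable.
Context {R : realType}.
Notation mT := (measurableTypeR R * measurableTypeR R)%type.
Implicit Types (f g h : R * R -> R) (O : set (R * R)).

Lemma measurable_sqr O f : measurable (O : set mT) -> measurable_fun (O : set mT) (f : mT -> R) ->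
  measurable_fun (O : set mT) (EFin \o (fun z => f z ^+ 2) : mT -> \bar R).
Proof. by move=> mO mf; apply/measurable_EFinP; exact: measurable_funX. Qed.

Lemma abse_sqr f : (fun z : mT => `|(EFin \o (fun z => (f z ^+ 2)%R)) z|)%E = (fun z => (f z ^+ 2)%:E).
Proof. by apply/funext => z /=; rewrite ger0_norm ?sqr_ge0. Qed.

Lemma L2P O f : measurable (O : set mT) -> measurable_fun (O : set mT) (f : mT -> R) ->
  L2 O f <-> (lebesgue2 R).-integrable O (EFin \o (fun z => f z ^+ 2)).
Proof.
move=> mO mf; split=> [[_ fo]|/integrableP[_ fo]]; last by split=> //; move: fo; rewrite abse_sqr.
by apply/integrableP; split; [exact: measurable_sqr|rewrite abse_sqr].
Qed.

Lemma L2_integrable O f : measurable (O : set mT) -> L2 O f ->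
  (lebesgue2 R).-integrable O (EFin \o (fun z => f z ^+ 2)).
Proof. by move=> mO Lf; apply/L2P => //; case: Lf. Qed.

Lemma sqint_ge0 O f : 0 <= sqint O f.
Proof. by apply: Rintegral_ge0 => z _; exact: sqr_ge0. Qed.

Lemma integrable_scale O (k : R) f : measurable (O : set mT) ->
  (lebesgue2 R).-integrable O (EFin \o f) -> (lebesgue2 R).-integrable O (EFin \o (fun z => k * f z)).
Proof. by move=> mO; exact: integrableZl. Qed.

Lemma integrable_add O f g : measurable (O : set mT) ->
  (lebesgue2 R).-integrable O (EFin \o f) -> (lebesgue2 R).-integrable O (EFin \o g) ->
  (lebesgue2 R).-integrable O (EFin \o (fun z => f z + g z)).
Proof. by move=> mO; exact: integrableD. Qed.

Lemma L2_le O f g h (k : R) : measurable (O : set mT) -> 0 <= k -> L2 O g -> L2 O h ->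
  measurable_fun (O : set mT) (f : mT -> R) ->
  (forall z, O z -> f z ^+ 2 <= k * g z ^+ 2 + k * h z ^+ 2) ->
  L2 O f /\ sqint O f <= k * sqint O g + k * sqint O h.
Proof.
move=> mO k0 Lg Lh mf fgh.
have ig := L2_integrable mO Lg; have ih := L2_integrable mO Lh.
have ikg := integrable_scale k mO ig; have ikh := integrable_scale k mO ih.
have igh := integrable_add mO ikg ikh.
have If : (lebesgue2 R).-integrable O (EFin \o (fun z => f z ^+ 2)).
  apply: le_integrable igh => //; first exact: measurable_sqr.
  move=> z Oz /=; rewrite lee_fin !ger0_norm ?sqr_ge0//; first exact: fgh.
  by rewrite addr_ge0// mulr_ge0// sqr_ge0.
split; first exact/L2P.
rewrite /sqint -!RintegralZl// -RintegralD//.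
exact: le_Rintegral.
Qed.

Lemma L2D O f g : measurable (O : set mT) -> L2 O f -> L2 O g ->
  L2 O (fun z => f z + g z) /\ sqint O (fun z => f z + g z) <= 2 * sqint O f + 2 * sqint O g.
Proof.
move=> mO Lf Lg; apply: L2_le => //; first by apply: measurable_funD; [case: Lf|case: Lg].
by move=> z _; have := sqr_ge0 (f z - g z); lra.
Qed.

Lemma L2B O f g : measurable (O : set mT) -> L2 O f -> L2 O g -> L2 O (fun z => f z - g z).
Proof.
move=> mO Lf Lg; apply: (proj1 (@L2_le O _ f g 2 mO _ Lf Lg _ _)) => //.
  by apply: measurable_funB; [case: Lf|case: Lg].
by move=> z _; have := sqr_ge0 (f z + g z); lra.
Qed.

(** Young's inequality with parameter [e], applied pointwise to the cross term; it replaces the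
    triangle inequality of the L2 norm in the passage to the limit. *)
Lemma sqint_perturb O f g (e : R) : measurable (O : set mT) -> L2 O f -> L2 O g -> 0 < e ->
  `|sqint O f - sqint O g| <= e * sqint O f + (1 + e^-1) * sqint O (fun z => g z - f z).
Proof.
move=> mO Lf Lg e0; have Lh := L2B mO Lg Lf.
have If := L2_integrable mO Lf; have Ig := L2_integrable mO Lg; have Ih := L2_integrable mO Lh.
have iZ k h := @integrable_scale O k h mO; have iD h1 h2 := @integrable_add O h1 h2 mO.
have young (p q : R) : 2 * p * q <= e * p ^+ 2 + e^-1 * q ^+ 2 /\ - (2 * p * q) <= e * p ^+ 2 + e^-1 * q ^+ 2.
  have h1 := sqr_ge0 (e * p - q); have h2 := sqr_ge0 (e * p + q).
  have ei : 0 <= e^-1 by rewrite invr_ge0 ltW.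
  have n := lt0r_neq0 e0.
  split; rewrite -subr_ge0.
    by apply: le_trans (mulr_ge0 ei h1) _; rewrite le_eqVlt; apply/orP; left; apply/eqP; field.
  by apply: le_trans (mulr_ge0 ei h2) _; rewrite le_eqVlt; apply/orP; left; apply/eqP; field.
have bnd : sqint O f <= sqint O g + (e * sqint O f + (1 + e^-1) * sqint O (fun z => g z - f z)) /\
           sqint O g <= sqint O f + (e * sqint O f + (1 + e^-1) * sqint O (fun z => g z - f z)).
  have i1 := iZ e _ If; have i2 := iZ (1 + e^-1) _ Ih; have i3 := iD _ _ i1 i2.
  have i4 := iD _ _ Ig i3; have i5 := iD _ _ If i3.
  rewrite /sqint -!RintegralZl// -!RintegralD//.
  split; apply: le_Rintegral => //.
  - move=> z _; have [_ h] := young (f z) (g z - f z).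
    have := sqr_ge0 (g z - f z); move: h; move: (e^-1) => d; lra.
  - move=> z _; have [h _] := young (f z) (g z - f z); move: h; move: (e^-1) => d; lra.
by rewrite ler_norml; move: bnd => []; lra.
Qed.

Lemma sqint_cvg O (f_ : nat -> R * R -> R) f : measurable (O : set mT) -> (forall n, L2 O (f_ n)) -> L2 O f ->
  sqint O (fun z => f_ n z - f z) @[n --> \oo] --> (0 : R) ->
  sqint O (f_ n) @[n --> \oo] --> sqint O f.
Proof.
move=> mO Lf_ Lf d0; apply/cvgrPdist_le => eps eps0.
set S := sqint O f; have S0 : 0 <= S := sqint_ge0 O f.
(* Half of [eps] pays for [e * S], with [S + 1] to avoid dividing by 0; the other half pays for the
   difference, small for large [n]. *)
set e := eps / (2 * (S + 1)).
have e0 : 0 < e by rewrite divr_gt0// mulr_gt0//; lra.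
have k0 : 0 < 1 + e^-1 by rewrite addr_gt0// invr_gt0.
near=> n.
apply: le_trans (sqint_perturb mO Lf (Lf_ n) e0) _; rewrite -/S.
have h1 : e * S <= eps / 2.
  rewrite /e invfM mulrA mulrAC ler_pdivrMr; last by lra.
  by rewrite ler_wpM2l//; lra.
have h2 : sqint O (fun z => f_ n z - f z) <= eps / 2 / (1 + e^-1).
  near: n; apply: (cvgr_le _ d0); rewrite divr_gt0//; lra.
have h3 : (1 + e^-1) * sqint O (fun z => f_ n z - f z) <= eps / 2.
  by rewrite mulrC -ler_pdivlMr.
lra.
Unshelve. all: end_near. Qed.

Lemma L2_cvg_sqint O (f_ : nat -> R * R -> R) f : measurable (O : set mT) -> (forall n, L2 O (f_ n)) ->
  L2 O f ->
  L2_cvg O f_ f -> sqint O (fun z => f_ n z - f z) @[n --> \oo] --> (0 : R).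
Proof. by move=> mO Lf_ Lf /fine_cvgP[]. Qed.

Lemma sqint_cvgD O (f_ : nat -> R * R -> R) f (g_ : nat -> R * R -> R) g : measurable (O : set mT) ->
  (forall n, L2 O (f_ n)) -> L2 O f ->
  (forall n, L2 O (g_ n)) -> L2 O g ->
  sqint O (fun z => f_ n z - f z) @[n --> \oo] --> (0 : R) ->
  sqint O (fun z => g_ n z - g z) @[n --> \oo] --> (0 : R) ->
  sqint O (fun z => f_ n z + g_ n z) @[n --> \oo] --> sqint O (fun z => f z + g z).
Proof.
move=> mO Lf_ Lf Lg_ Lg df dg.
apply: sqint_cvg => //; [by move=> n; exact: (L2D mO (Lf_ n) (Lg_ n)).1|exact: (L2D mO Lf Lg).1|].
have hc : 2 * sqint O (fun z => f_ n z - f z) + 2 * sqint O (fun z => g_ n z - g z) @[n --> \oo] --> (0 : R).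
  rewrite -[X in _ --> X](_ : 2 * 0 + 2 * 0 = 0 :> R); last by ring.
  by apply: cvgD; apply: cvgM => //; exact: cvg_cst.
apply: (squeeze_cvgr _ (cvg_cst 0) hc); apply: nearW => n.
rewrite sqint_ge0 /=; apply: le_trans (L2D mO (L2B mO (Lf_ n) Lf) (L2B mO (Lg_ n) Lg)).2.
by rewrite le_eqVlt; apply/orP; left; apply/eqP; apply: eq_Rintegral => z _; congr (_ ^+ 2); ring.
Qed.

Lemma sqint_eq0 O f : measurable (O : set mT) -> L2 O f -> sqint O f = 0 ->
  {ae lebesgue2 R, forall z, O z -> f z = 0}.
Proof.
move=> mO Lf f0; have [mf _] := Lf; have If := L2_integrable mO Lf.
have : (\int[lebesgue2 R]_(z in O) `|(EFin \o (fun z => (f z ^+ 2)%R)) z| = 0)%E.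
  rewrite abse_sqr.
  by rewrite -[LHS]fineK ?integrable_fin_num// -/(Rintegral _ _ _) -/(sqint O f) f0.
move/ae_eq_integral_abs => /(_ mO (measurable_sqr mO mf)).
apply: filterS => z h /h /eqP; rewrite /= eqe sqrf_eq0 => /eqP.
by [].
Qed.

Lemma sqint_ae0 O f : measurable (O : set mT) -> L2 O f ->
  {ae lebesgue2 R, forall z, O z -> f z = 0} -> sqint O f = 0.
Proof.
move=> mO [mf _] f0; rewrite /sqint /Rintegral.
have -> : (\int[lebesgue2 R]_(z in O) (f z ^+ 2)%:E = \int[lebesgue2 R]_(z in O) (cst 0 : mT -> \bar R) z)%E.
  apply: ae_eq_integral => //; first exact: measurable_sqr.
  case: f0 => N [mN N0 sN]; exists N; split => // z /= nz; apply: sN => /= h.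
  by apply: nz => /h ->; rewrite expr0n.
by rewrite integral0.
Qed.

End square_integrable.

(** * The eigenvalues of the disk and of the ellipse *)

Section eigenvalue_bounds.
Context {R : realType}.
Notation mT := (measurableTypeR R * measurableTypeR R)%type.
Implicit Types (f g h : R * R -> R) (O : set (R * R)) (c : R * R).

Lemma sum2 (F : 'I_2 -> R) : \sum_(k < 2) F k = F ord0 + F ord_max.
Proof. by rewrite big_ord_recl big_ord1; congr (_ + F _); exact: val_inj. Qed.

Lemma rayleighE (mu lambda : R) O (u : 'I_2 -> R * R -> R) (Du : 'I_2 -> 'I_2 -> R * R -> R) :
  measurable (O : set mT) -> (forall k, L2 O (u k)) -> (forall k i, L2 O (Du k i)) ->
  rayleigh mu lambda O u Du =
  (mu * (sqint O (Du ord0 ord0) + sqint O (Du ord0 ord_max)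
         + sqint O (Du ord_max ord0) + sqint O (Du ord_max ord_max))
   + (lambda + mu) * sqint O (fun z => Du ord0 ord0 z + Du ord_max ord_max z))
  / (sqint O (u ord0) + sqint O (u ord_max)).
Proof.
move=> mO Lu LDu; rewrite /rayleigh.
have iu k := L2_integrable mO (Lu k); have iD k i := L2_integrable mO (LDu k i).
have -> : \int[lebesgue2 R]_(x in O) (\sum_(k < 2) (u k x) ^+ 2) = sqint O (u ord0) + sqint O (u ord_max).
  by rewrite /sqint -RintegralD//; apply: eq_Rintegral => z _; rewrite sum2.
have -> : \int[lebesgue2 R]_(x in O) ((\sum_(k < 2) Du k k x) ^+ 2) =
    sqint O (fun z => Du ord0 ord0 z + Du ord_max ord_max z).
  by apply: eq_Rintegral => z _; rewrite sum2.
have -> : \int[lebesgue2 R]_(x in O) (\sum_(k < 2) \sum_(i < 2) (Du k i x) ^+ 2) =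
    (sqint O (Du ord0 ord0) + sqint O (Du ord0 ord_max))
    + (sqint O (Du ord_max ord0) + sqint O (Du ord_max ord_max)).
  have i1 := integrable_add mO (iD ord0 ord0) (iD ord0 ord_max).
  have i2 := integrable_add mO (iD ord_max ord0) (iD ord_max ord_max).
  rewrite /sqint -!RintegralD//; apply: eq_Rintegral => z _.
  by rewrite sum2 !sum2.
by rewrite addrA.
Qed.

Lemma test_L2 c (a b : R) f : 0 < a -> 0 < b -> continuous f -> L2 (ell c a b) f.
Proof.
move=> a0 b0 cf; apply/L2P; [exact: measurable_ell| |by apply: ell_integrable => //; cont].
by apply: measurable_funTS; exact: continuous_measurable_prod.
Qed.

(** Both sides are continuous along the approximating test functions, for which [test_lower]
    holds. *)
Lemma H10_lower c (r s : R) (u : 'I_2 -> R * R -> R) (Du : 'I_2 -> 'I_2 -> R * R -> R) :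
  0 < r -> 23 / 20 <= s <= 49 / 20 ->
  (forall k, H10 (ell c r r) (u k) (Du k)) ->
  29 / 5 * s * (sqint (ell c r r) (u ord0) + sqint (ell c r r) (u ord_max)) <=
  r ^+ 2 * (sqint (ell c r r) (Du ord0 ord0) + sqint (ell c r r) (Du ord0 ord_max)
    + sqint (ell c r r) (Du ord_max ord0) + sqint (ell c r r) (Du ord_max ord_max)
    + (s ^+ 2 - 1) * sqint (ell c r r) (fun z => Du ord0 ord0 z + Du ord_max ord_max z)).
Proof.
move=> r0 sb Hu; have mO := @measurable_ell R c r r; set O := ell c r r in mO Hu *.
have [[Lf HDf] [f_ [tf cvf cvDf]]] := Hu ord0.
have [[Lg HDg] [g_ [tg cvg cvDg]]] := Hu ord_max.
have LDf i := (HDf i).1; have LDg i := (HDg i).1.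
have Lt (h_ : nat -> R * R -> R) : (forall n, test_function O (h_ n)) ->
    (forall n, L2 O (h_ n)) /\ (forall i n, L2 O (partial i (h_ n))).
  move=> th; split=> [n|i n]; have [ch cp] := test_continuous (th n); exact: test_L2.
have [Lf_ LDf_] := Lt _ tf; have [Lg_ LDg_] := Lt _ tg.
have df := L2_cvg_sqint mO Lf_ Lf cvf; have dg := L2_cvg_sqint mO Lg_ Lg cvg.
have dDf i := L2_cvg_sqint mO (LDf_ i) (LDf i) (cvDf i).
have dDg i := L2_cvg_sqint mO (LDg_ i) (LDg i) (cvDg i).
have lf := sqint_cvg mO Lf_ Lf df; have lg := sqint_cvg mO Lg_ Lg dg.
have lDf i := sqint_cvg mO (LDf_ i) (LDf i) (dDf i).
have lDg i := sqint_cvg mO (LDg_ i) (LDg i) (dDg i).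
have ld := sqint_cvgD mO (LDf_ ord0) (LDf ord0) (LDg_ ord_max) (LDg ord_max) (dDf ord0) (dDg ord_max).
have k (x : R) : (fun _ : nat => x) @ \oo --> x by exact: cvg_cst.
have LHS : 29 / 5 * s * (sqint O (f_ n) + sqint O (g_ n)) @[n --> \oo] -->
    29 / 5 * s * (sqint O (u ord0) + sqint O (u ord_max)).
  by apply: cvgM; [exact: k|exact: cvgD].
have RHS : r ^+ 2 * (sqint O (partial ord0 (f_ n)) + sqint O (partial ord_max (f_ n))
    + sqint O (partial ord0 (g_ n)) + sqint O (partial ord_max (g_ n))
    + (s ^+ 2 - 1) * sqint O (fun z => partial ord0 (f_ n) z + partial ord_max (g_ n) z)) @[n --> \oo] -->
    r ^+ 2 * (sqint O (Du ord0 ord0) + sqint O (Du ord0 ord_max)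
    + sqint O (Du ord_max ord0) + sqint O (Du ord_max ord_max)
    + (s ^+ 2 - 1) * sqint O (fun z => Du ord0 ord0 z + Du ord_max ord_max z)).
  apply: cvgM; first exact: k.
  apply: cvgD; last by apply: cvgM => //; exact: k.
  by apply: cvgD => //; apply: cvgD => //; exact: cvgD.
by apply: (ler_cvg_to LHS RHS); apply: nearW => n; exact: test_lower.
Qed.

Lemma H10_test c (a b : R) f : 0 < a -> 0 < b -> test_function (ell c a b) f ->
  H10 (ell c a b) f (fun i => partial i f).
Proof.
move=> a0 b0 tf; have [cf cp] := test_continuous tf.
have z0 h : L2_cvg (ell c a b) (fun=> h) h.
  rewrite /L2_cvg (_ : (fun n : nat => _) = (fun=> 0%E)); first exact: cvg_cst.
  by apply/funext => _; rewrite integral0_eq// => z _; rewrite subrr expr0n.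
split; last by exists (fun=> f); split.
split=> [|i]; first exact: test_L2.
by split; [exact: test_L2|exact: test_weak_partial].
Qed.

Lemma test_zero O : test_function O (fun=> 0 : R).
Proof.
have E : [set x : R * R | (0 : R) != 0] = set0 by apply/seteqP; split => x //=; rewrite eqxx.
split; rewrite ?E ?closure0; [exact: (smooth_eval (Ec 0))|exact: compact0|exact: sub0set].
Qed.

Lemma test_trial c (a b : R) n : 0 < a -> 0 < b ->
  test_function (ell c a b) (trial n \o ainv c a b).
Proof.
move=> a0 b0; have N0 : 0 < n.+1%:R :> R by rewrite ltr0n.
(* The cutoff vanishes off this closed set, which lies inside the open ellipse; it therefore
   contains the closure of the support. *)
pose A := [set z | 1 <= n.+1%:R * rho (ainv c a b z)].
have cl : closed A.
  have c1 : continuous (fun z => rho (ainv c a b z)) := @caff_comp _ _ _ _ _ (@crho R).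
  have c2 : continuous (fun z => n.+1%:R * rho (ainv c a b z)) by cont.
  by apply: (@preimage_closed _ _ _ _ (fun z _ => c2 z) (@closed_ge R 1)).
have sA : closure [set x | (trial n \o ainv c a b) x != 0] `<=` A.
  rewrite [X in _ `<=` X]((closure_id A).1 cl); apply: closureS => z /=; apply: contraR.
  by rewrite /A /= -ltNge => /ltW /trial_flat[-> _ _].
have sO : A `<=` ell c a b.
  move=> z /= h; have : 0 < rho (ainv c a b z) by rewrite -(pmulr_rgt0 _ N0); apply: lt_le_trans h.
  by rewrite /rho /ell /preimage /udisk /=; lra.
split.
- by have [e ->] := @trial_eval R n; exact: smooth_eval_aff.
- have [M h] := ell_box c a0 b0.
  have cB : compact (`[- M, M] `*` `[- M, M] : set (R * R)).
    by apply: compact_setX; exact: segment_compact.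
  apply: (subclosed_compact (@closed_closure _ _) cB).
  by move=> z /sA /sO; exact: h.
- by move=> z /sA /sO.
Qed.

Lemma partial_trial c (a b : R) n : 
  partial ord0 (trial n \o ainv c a b) = (fun z => a^-1 * trialx n (ainv c a b z)) /\
  partial ord_max (trial n \o ainv c a b) = (fun z => b^-1 * trialy n (ainv c a b z)).
Proof.
have [[_ _ _ dx dy] _ _ _] := @C1c_trial R n.
by split; apply/funext => z; [have [_] := d_aff1 (dx (ainv c a b z))|have [_] := d_aff2 (dy (ainv c a b z))].
Qed.

Lemma sqint_trial c (a b : R) n : 0 < a -> 0 < b ->
  [/\ sqint (ell c a b) (trial n \o ainv c a b) = a * b * I (fun z : R * R => trial n z ^+ 2),
      sqint (ell c a b) (partial ord0 (trial n \o ainv c a b)) = a * b * (a ^- 2 * I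
      (fun z : R * R => trialx n z ^+ 2)) &
      sqint (ell c a b) (partial ord_max (trial n \o ainv c a b)) = a * b * (b ^- 2 * I
      (fun z : R * R => trialy n z ^+ 2))].
Proof.
move=> a0 b0; have [[cf cfx cfy _ _] _ _ _] := @C1c_trial R n.
have [-> ->] := partial_trial c a b n.
have h (k : R) F : continuous F ->
    sqint (ell c a b) (fun z => k * F (ainv c a b z)) = a * b * (k ^+ 2 * I (fun z => F z ^+ 2)).
  move=> cF; have cF' : continuous (fun z => F (ainv c a b z)) := @caff_comp _ _ _ _ _ cF.
  rewrite /sqint ell_Rintegral//; last by cont.
  by congr (_ * _); rewrite -IZ; [apply: eq_I => z _; rewrite affK// exprMn|cont].
split.
- have := h 1 _ cf; rewrite expr1n mul1r => <-.
  by apply: eq_Rintegral => z _; rewrite mul1r.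
- by rewrite h// exprVn.
- by rewrite h// exprVn.
Qed.

Lemma moment_gt0 : 0 < moment 0 0 0 :> R.
Proof.
have E : moment 0 0 0 = fine (lebesgue2 R (udisk : set mT)).
  have mD := @measurable_udisk R.
  rewrite /moment /I /Rintegral (eq_integral (cst 1%E)) ?integral_cst ?mul1e//.
  by move=> z _ /=; rewrite !expr0 !mulr1.
rewrite E fine_gt0// udisk_lty andbT.
have mI : measurable (`[(0 : R), 1 / 2]%classic : set (measurableTypeR R)) by exact: measurable_itv.
(* A small square inside the disk shows that the area is positive. *)
apply: (@lt_le_trans _ _ (lebesgue2 R (`[0, 1 / 2] `*` `[0, 1 / 2]))).
  rewrite product_measure1E//.
  have := @lebesgue_measure_itv R `[0, 1 / 2]; rewrite /= => ->.
  have h : (0 : R) < 1 / 2 by rewrite divr_gt0.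
  by rewrite lte_fin h oppr0 -EFinD addr0 -EFinM lte_fin mulr_gt0.
apply: le_measure; rewrite ?inE; [exact: measurableX|exact: measurable_udisk|].
move=> [x y] [/=]; rewrite !in_itv /udisk /= => /andP[? ?] /andP[? ?]; nra.
Qed.

(** In the limit the quotient is (11/3) / (19/30) = 110/19, and 110 * 5 = 550 < 551 = 29 * 19. The
    inequality is strict, so it survives for large [n]. *)
Lemma trial_quotient : exists n, 0 < I (fun z : R * R => trial n z ^+ 2) /\
  I (fun z : R * R => trialx n z ^+ 2) + I (fun z : R * R => trialy n z ^+ 2) < 29 / 5 * I
    (fun z : R * R => trial n z ^+ 2).
Proof.
have [C _ [M bM] lim] := @trial_approximates R.
have [mf mfx mfy _] := @f0_moments R; have [cf cfx cfy] := @cf0 R.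
have m0 := moment_gt0.
have sq (F_ : nat -> R * R -> R) F : (forall n, continuous (F_ n)) -> continuous F ->
    (forall n z, udisk z -> `|F_ n z| <= M) -> (forall z, udisk z -> F_ n z @[n --> \oo] --> F z) ->
    I (fun z => F_ n z ^+ 2) @[n --> \oo] --> I (fun z => F z ^+ 2).
  move=> cF_ cF FM FF; apply: (@I_cvg _ _ _ (M ^+ 2)); [by move=> n; have cn := cF_ n; cont|by cont| |].
    move=> n z zd; rewrite normrX; have h := FM n z zd.
    by rewrite ler_sqr ?nnegrE//; apply: le_trans h.
  by move=> z zd; rewrite expr2; apply: (cvgM (FF z zd) (FF z zd)).
have l : I (fun z : R * R => trial n z ^+ 2) @[n --> \oo] --> (19 / 30 * moment 0 0 0 : R).
  rewrite -mf; refine (sq trial f0 _ _ _ _) => // [n|n z /(bM n)[]|z /lim[]] //;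
    by have [[cn _ _ _ _] _ _ _] := C n.
have lx : I (fun z : R * R => trialx n z ^+ 2) @[n --> \oo] --> (11 / 6 * moment 0 0 0 : R).
  rewrite -mfx; refine (sq trialx f0x _ _ _ _) => // [n|n z /(bM n)[]|z /lim[]] //;
    by have [[_ cn _ _ _] _ _ _] := C n.
have ly : I (fun z : R * R => trialy n z ^+ 2) @[n --> \oo] --> (11 / 6 * moment 0 0 0 : R).
  rewrite -mfy; refine (sq trialy f0y _ _ _ _) => // [n|n z /(bM n)[]|z /lim[]] //;
    by have [[_ _ cn _ _] _ _ _] := C n.
have ld : I (fun z : R * R => trialx n z ^+ 2) + I (fun z : R * R => trialy n z ^+ 2)
  - 29 / 5 * I (fun z : R * R => trial n z ^+ 2) @[n --> \oo] -->
    (11 / 6 * moment 0 0 0 + 11 / 6 * moment 0 0 0 - 29 / 5 * (19 / 30 * moment 0 0 0) : R).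
  by apply: cvgB; [exact: cvgD|apply: cvgM => //; exact: cvg_cst].
have /filter_ex[n [h1 h2]] : \forall n \near \oo, 0 < I (fun z : R * R => trial n z ^+ 2) /\
    I (fun z : R * R => trialx n z ^+ 2) + I (fun z : R * R => trialy n z ^+ 2)
    - 29 / 5 * I (fun z : R * R => trial n z ^+ 2) < 0.
  near=> n; split; near: n; [apply: (cvgr_gt _ l)|apply: (cvgr_lt _ ld)]; lra.
by exists n; split => //; rewrite -subr_lt0.
Unshelve. all: end_near. Qed.

Lemma Lame_lower (mu lambda : R) c (r s : R) : 0 < mu -> 0 < r -> 23 / 20 <= s <= 49 / 20 ->
  lambda + mu = mu * (s ^+ 2 - 1) ->
  ((mu * (29 / 5 * s) / r ^+ 2)%:E <= Lame_eigenvalue mu lambda (ell c r r))%E.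
Proof.
move=> mu0 r0 sb lmu; apply: le_ereal_inf_tmp => _ [u [Du [Hu nz ->]]]; rewrite lee_fin.
have mO := @measurable_ell R c r r.
have Lu k : L2 (ell c r r) (u k) by have [[]] := Hu k.
have LDu k i : L2 (ell c r r) (Du k i) by have [[_ h] _] := Hu k; have [] := h i.
rewrite rayleighE// lmu -[mu * _ * sqint _ _]mulrA -mulrDr.
have g0 k := sqint_ge0 (ell c r r) (u k).
(* A zero denominator would make [rayleigh] equal to 0 by convention; it is excluded because [u] is
   nonzero modulo null sets. *)
have N0 : 0 < sqint (ell c r r) (u ord0) + sqint (ell c r r) (u ord_max).
  rewrite lt_neqAle addr_ge0// andbT eq_sym; apply/eqP => N0; apply: nz.
  have h0 : sqint (ell c r r) (u ord0) = 0 by have := g0 ord0; have := g0 ord_max; lra.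
  have h1 : sqint (ell c r r) (u ord_max) = 0 by have := g0 ord0; have := g0 ord_max; lra.
  have [A [mA A0 sA]] := sqint_eq0 mO (Lu ord0) h0.
  have [B [mB B0 sB]] := sqint_eq0 mO (Lu ord_max) h1.
  exists (A `|` B); split; first exact: measurableU.
    have e : (lebesgue2 R A + lebesgue2 R B = 0)%E by rewrite A0 B0 adde0.
    apply/eqP; rewrite -measure_le0; apply: le_trans (measureU2 _ mA mB) _.
    by rewrite [leLHS]e.
  move=> z /= h; apply: contrapT => /not_orP[nA nB]; apply: h => Oz k.
  have : k = ord0 \/ k = ord_max by case: k => [[|[|//]] p]; [left|right]; exact: val_inj.
  case=> ->.
  - by apply: contrapT => h; apply: nA; apply: sA => /= /(_ Oz).
  - by apply: contrapT => h; apply: nB; apply: sB => /= /(_ Oz).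
have := H10_lower r0 sb Hu.
rewrite ler_pdivlMr// => h.
rewrite -[X in X * _ <= _]mulrA -[X in X <= _]mulrA ler_pM2l// mulrAC ler_pdivrMr ?exprn_gt0//.
by rewrite [leRHS]mulrC.
Qed.

End eigenvalue_bounds.

(** * The ellipse beats the disk *)

Theorem theorem1p2 (R : realType) (mu lambda nu : R)
    (mu_gt0 : 0 < mu) (lambda_mu_gt0 : 0 < lambda + mu)
    (nu_gtN1 : -1 < nu) (nu_lt_half : nu < 1 / 2)
    (poisson : (lambda + mu) / mu = 1 / (1 - 2 * nu))
    (nu_lt : nu < 4 / 10)
    (c : R * R) (r : R) (r_gt0 : 0 < r) :
  exists Omega : set (R * R),
    [/\ open Omega,
        bounded_set Omega,
        (lebesgue2 R) Omega = (lebesgue2 R) (disk c r) &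
        (Lame_eigenvalue mu lambda Omega
           < Lame_eigenvalue mu lambda (disk c r))%E].
Proof.
have d0 : 0 < 1 - 2 * nu by lra.
have a1 : 1 / 3 < (lambda + mu) / mu by rewrite poisson ltr_pdivlMr//; lra.
have a2 : (lambda + mu) / mu < 5 by rewrite poisson ltr_pdivrMr//; lra.
pose s := Num.sqrt (1 + (lambda + mu) / mu).
have ss : s ^+ 2 = 1 + (lambda + mu) / mu by rewrite sqr_sqrtr//; lra.
have s0 : 0 <= s := sqrtr_ge0 _.
(* (23/20)^2 = 1.3225 < 4/3 and 6 < (49/20)^2 = 6.0025. *)
have sb : 23 / 20 <= s <= 49 / 20 by apply/andP; split; rewrite -ler_sqr ?nnegrE//; lra.
have sp : 0 < s by case/andP: sb; lra.
have lmu : lambda + mu = mu * (s ^+ 2 - 1) by rewrite ss [1 + _]addrC addrK mulrC mulfVK// lt0r_neq0.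
pose q := Num.sqrt s; have q0 : 0 < q by rewrite sqrtr_gt0.
have qq : q ^+ 2 = s by rewrite sqr_sqrtr.
have al : 0 < r * q by rewrite mulr_gt0.
have be : 0 < r / q by rewrite divr_gt0.
have ab : r * q * (r / q) = r * r by field; exact: lt0r_neq0.
exists (ell c (r * q) (r / q)); split.
- exact: open_ell.
- exact: bounded_ell.
- rewrite (disk_ell c r_gt0); apply: (etrans (lebesgue2_ell c al be)); rewrite ab.
  exact/esym/(lebesgue2_ell c r_gt0 r_gt0).
- rewrite disk_ell//; apply: lt_le_trans (Lame_lower c mu_gt0 r_gt0 sb lmu).
  have [n [N0 quot]] := @trial_quotient R.
  pose psi := trial n \o ainv c (r * q) (r / q).
  have tpsi : test_function (ell c (r * q) (r / q)) psi by exact: test_trial.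
  pose u (k : 'I_2) : R * R -> R := if k == ord0 then psi else (fun=> 0).
  have tu k : test_function (ell c (r * q) (r / q)) (u k).
    by rewrite /u; case: ifP => _ //; exact: test_zero.
  pose Du (k i : 'I_2) := partial i (u k).
  have mO := @measurable_ell R c (r * q) (r / q).
  have Lu k : L2 (ell c (r * q) (r / q)) (u k).
    by apply: test_L2 => //; exact: (test_continuous (tu k)).1.
  have LDu k i : L2 (ell c (r * q) (r / q)) (Du k i).
    by apply: test_L2 => //; exact: (test_continuous (tu k)).2.
  have [e0 ex ey] := sqint_trial c n al be.
  have sq0 f : (forall z, f z = 0) -> sqint (ell c (r * q) (r / q)) f = 0.
    by move=> f0; rewrite /sqint /Rintegral integral0_eq// => z _; rewrite f0 expr0n.
  have D0 i z : Du ord_max i z = 0 by have [_ h] := dC z (basis_vec R i) (0 : R); exact: h.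
  apply: (@le_lt_trans _ _ (rayleigh mu lambda (ell c (r * q) (r / q)) u Du)%:E).
    apply: ereal_inf_lbound; exists u, Du; split => //; first by move=> k; exact: H10_test.
    move=> ae0; have : sqint (ell c (r * q) (r / q)) (u ord0) = 0.
      apply: sqint_ae0 => //; case: ae0 => A [mA A0 sA]; exists A; split => // z /= nz.
      by apply: sA => /= h; apply: nz => /h.
    by rewrite [sqint _ _]e0; apply/eqP; rewrite lt0r_neq0// ab !mulr_gt0.
  have z1 := sq0 (u ord_max) (fun=> erefl); have z2 := sq0 _ (D0 ord0); have z3 := sq0 _ (D0 ord_max).
  have RE := rayleighE mu lambda mO Lu LDu.
  rewrite z1 z2 ?z3 in RE; rewrite lte_fin RE lmu.
  have -> : sqint (ell c (r * q) (r / q)) (fun z => Du ord0 ord0 z + Du ord_max ord_max z) =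
      sqint (ell c (r * q) (r / q)) (Du ord0 ord0).
    by apply: eq_Rintegral => z _; rewrite D0 addr0.
  rewrite [sqint _ (u ord0)]e0 [sqint _ (Du ord0 ord0)]ex [sqint _ (Du ord0 ord_max)]ey ab !addr0.
  move: N0 quot; set N := I _; set X := I _; set Y := I _ => N0 quot.
  (* With [q ^+ 2 = s] the weight [s ^+ 2 / q ^+ 2] of the x-derivative equals the weight [q ^+ 2]
     of the y-derivative; the semi-axes are chosen for this balance. *)
  have -> : (mu * (r * r * ((r * q) ^- 2 * X) + r * r * ((r / q) ^- 2 * Y))
      + mu * (s ^+ 2 - 1) * (r * r * ((r * q) ^- 2 * X))) / (r * r * N) = mu * s / r ^+ 2 * ((X + Y) / N).
    rewrite -qq; clearbody q N X Y; field; rewrite ?lt0r_neq0//.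
  have -> : mu * (29 / 5 * s) / r ^+ 2 = mu * s / r ^+ 2 * (29 / 5) by field; exact: lt0r_neq0.
  by rewrite ltr_pM2l ?divr_gt0 ?mulr_gt0 ?exprn_gt0// ltr_pdivrMr.
Qed.
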